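(* Let $\mathcal S$ be a Damek--Ricci space and let $\alpha>1/2$. Then there is a constant $C>0$ such that $$\|S^*f\|_{L^{2,\infty}(\mathcal S)}\le C\,\|f\|_{H^\alpha(\mathcal S)}\qquad\text{for all } f\in\mathscr S^2(\mathcal S)_o.$$
   Context: Damek--Ricci spaces: let $\mathfrak n$ be a two-step real nilpotent Lie algebra with inner product, center $\mathfrak z$, $\mathfrak v=\mathfrak z^\perp$. It is of $H$-type if for every $Z\in\mathfrak z$ the map $J_Z:\mathfrak v\to\mathfrak v$, $\langle J_ZX,Y\rangle=\langle[X,Y],Z\rangle$, satisfies $J_Z^2=-|Z|^2 I$. Let $N$ be the connected simply connected Lie group of $\mathfrak n$, with elements $(X,Z)$ and product $(X,Z)(X',Z')=(X+X',Z+Z'+\frac12[X,X'])$. $A=\mathbb R^+$ acts on $N$ by $(X,Z)\mapsto(\sqrt a X,aZ)$, and $\mathcal S=NA$ is the semidirect product, with the left-invariant Riemannian metric induced by $\langle(X,Z,l),(X',Z',l')\rangle=\langle X,X'\rangle+\langle Z,Z'\rangle+ll'$ on its Lie algebra $\mathfrak v\oplus\mathfrak z\oplus\mathbb R$. Put $m_{\mathfrak v}=\dim\mathfrak v$, $m_{\mathfrak z}=\dim\mathfrak z$, $n=m_{\mathfrak v}+m_{\mathfrak z}+1=\dim\mathcal S$, $Q=\frac{m_{\mathfrak v}}2+m_{\mathfrak z}=2\rho$. Let $e$ be the identity, $d$ the geodesic distance, $s=d(e,x)$. A function is radial if it depends only on $s$; we then write $f(x)=f(s)$. The left Haar (Riemannian)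 measure $dx$ is normalized so that for radial $f$, $\int_{\mathcal S}f\,dx=\int_0^\infty f(s)A(s)\,ds$, $A(s)=2^{m_{\mathfrak v}+m_{\mathfrak z}}(\sinh(s/2))^{m_{\mathfrak v}+m_{\mathfrak z}}(\cosh(s/2))^{m_{\mathfrak z}}$. Weak $L^2$: $\|F\|_{L^{2,\infty}(\mathcal S)}=\sup_{\tau>0}\tau\,d_F(\tau)^{1/2}$, where $d_F(\tau)$ is the left Haar measure of $\{x\in\mathcal S:|F(x)|>\tau\}$. Spherical analysis: $\Delta$ is the Laplace--Beltrami operator; $\varphi_\lambda$ ($\lambda\in\mathbb C$) is the radial smooth function with $\Delta\varphi_\lambda=-(\lambda^2+\rho^2)\varphi_\lambda$, $\varphi_\lambda(e)=1$. The spherical Fourier transform of a radial function is $\widehat f(\lambda)=\int_0^\infty f(s)\varphi_\lambda(s)A(s)\,ds$. Harish-Chandra's function is $\mathbf c(\lambda)=\frac{4^{\rho-i\lambda}\,\Gamma(2i\lambda)}{\Gamma(\rho+i\lambda)}\,\frac{\Gamma(n/2)}{\Gamma\left(\frac{m_{\mathfrak v}+4i\lambda+2}{4}\right)}$, $\lambda\in\mathbb R\setminus\{0\}$. $\mathscr S^2(\mathcal S)_o$ (radial $L^2$-Schwartz class) is the set of smooth radial $f$ on $\mathcal S$ with $\sup_{s>0}(1+s)^Ne^{\rho s}|(d/ds)^Mf(s)|<\infty$ for all integers $M,N\ge0$. For such $f$ and $\alpha\ge0$, $\|f\|_{H^\alpha(\mathcal S)}=\left(\int_0^\infty(\lambda^2+\rho^2)^\alpha|\widehat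 f(\lambda)|^2|\mathbf c(\lambda)|^{-2}d\lambda\right)^{1/2}$. Schrödinger maximal function: $S_tf(x)=\int_0^\infty\varphi_\lambda(x)e^{it(\lambda^2+\rho^2)}\widehat f(\lambda)|\mathbf c(\lambda)|^{-2}d\lambda$ and $S^*f(x)=\sup_{0<t<1/\rho^2}|S_tf(x)|$. *)

(* Defs.v *)
From HB Require Import structures.
From mathcomp Require Import all_boot all_order all_algebra.
From mathcomp Require Import complex.
From mathcomp Require Import all_classical all_reals all_analysis
  measurable_realfun.

Set Implicit Arguments.
Unset Strict Implicit.
Unset Printing Implicit Defensive.
Import Order.TTheory GRing.Theory Num.Theory.
Import numFieldNormedType.Exports.
Local Open Scope classical_set_scope.
Local Open Scope ring_scope.
Local Open Scope complex_scope.

(* the projections of R[i], not the 'Re and 'Im of numClosedFieldType *)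
Local Notation Re := (@complex.Re _).
Local Notation Im := (@complex.Im _).

Section ComplexValued.
Context {R : realType}.
Local Notation C := R[i].

Definition cexp (z : C) : C :=
  (expR (Re z) * cos (Im z)) +i* (expR (Re z) * sin (Im z)).

Definition cpow (a : R) (z : C) : C := cexp (z * (ln a)%:C).

(* Gauss's product: Gamma z = lim k! k^z / (z (z+1) ... (z+k)), valid for every
   z that is not a nonpositive integer. *)
Definition gauss_prod (z : C) (k : nat) : C :=
  (k`!)%:R * cpow k%:R z / \prod_(j < k.+1) (z + j%:R).

Definition Gamma (z : C) : C :=
  lim (Re (gauss_prod z k) @[k --> \oo]) +i*
  lim (Im (gauss_prod z k) @[k --> \oo]).

Definition cintegral (D : set R) (h : R -> C) : C :=
  (\int[lebesgue_measure]_(t in D) Re (h t)) +i*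
  (\int[lebesgue_measure]_(t in D) Im (h t)).

Definition cderive1n (M : nat) (h : R -> C) (s : R) : C :=
  derive1n M (Re \o h) s +i* derive1n M (Im \o h) s.

End ComplexValued.

Section Smooth.
Context {R : realType} {m : nat}.
Implicit Types f : 'rV[R]_m -> R.

Definition iter_derive (vs : seq 'rV[R]_m) f : 'rV[R]_m -> R :=
  foldr (fun v (g : 'rV[R]_m -> R) x => 'D_v g x) f vs.

Definition smooth_on (U : set 'rV[R]_m) f :=
  forall vs x v, U x ->
    derivable (iter_derive vs f) x v /\ {for x, continuous (iter_derive vs f)}.

Definition csmooth_on (U : set 'rV[R]_m) (f : 'rV[R]_m -> R[i]) :=
  smooth_on U (fun x => Re (f x)) /\ smooth_on U (fun x => Im (f x)).

End Smooth.

Definition dot {R : realType} {m : nat} (u v : 'rV[R]_m) : R := (u *m v^T) 0 0.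

(* A two-step H-type algebra, in orthonormal bases of v = R^mv and z = R^mz.
   Only the bracket v x v -> z is recorded, all brackets with z being zero;
   lemma [htype_center] shows that z is then the whole center.  [ht_J] is
   determined by [ht_br] through [ht_J_adj].  [ht_nonabelian] excludes the
   degenerate cases mv = 0 and mz = 0. *)
Record htype (R : realType) (mv mz : nat) := HType {
  ht_br : 'rV[R]_mv -> 'rV[R]_mv -> 'rV[R]_mz;
  ht_br_linearl : forall Y, linear (ht_br^~ Y);
  ht_br_linearr : forall X, linear (ht_br X);
  ht_br_alt : forall X, ht_br X X = 0;
  ht_nonabelian : exists X Y, ht_br X Y != 0;
  ht_J : 'rV[R]_mz -> 'rV[R]_mv -> 'rV[R]_mv;
  ht_J_adj : forall Z X Y, dot (ht_J Z X) Y = dot (ht_br X Y) Z;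
  ht_J_sqr : forall Z X, ht_J Z (ht_J Z X) = - (dot Z Z) *: X
}.

Lemma dotE {R : realType} {m} (u v : 'rV[R]_m) : dot u v = \sum_i u 0 i * v 0 i.
Proof. by rewrite /dot mxE; apply: eq_bigr => i _; rewrite mxE. Qed.

Lemma dot_eq0 {R : realType} {m} (u : 'rV[R]_m) : dot u u = 0 -> u = 0.
Proof.
rewrite dotE => /eqP.
rewrite psumr_eq0 => [/allP h|i _]; last by rewrite -expr2 sqr_ge0.
apply/rowP => i; rewrite mxE; apply/eqP.
by have := h i (mem_index_enum i); rewrite /= mulf_eq0 orbb.
Qed.

Lemma htype_center {R : realType} {mv mz} (h : htype R mv mz) (X : 'rV[R]_mv) :
  (forall Y, ht_br h X Y = 0) -> X = 0.
Proof.
move=> cX; have [U [V UV]] := ht_nonabelian h.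
set Z := ht_br h U V in UV.
have J0 : ht_J h Z X = 0.
  by apply: dot_eq0; rewrite ht_J_adj cX /dot mul0mx mxE.
have J00 : ht_J h Z 0 = 0.
  apply: dot_eq0; rewrite ht_J_adj.
  have -> : ht_br h 0 (ht_J h Z 0) = 0; last by rewrite /dot mul0mx mxE.
  have := ht_br_linearl h (ht_J h Z 0) (-1) 0 0.
  by rewrite scaler0 add0r scaleN1r addNr.
have := ht_J_sqr h Z X; rewrite J0 J00 => /esym/eqP.
rewrite scaler_eq0 oppr_eq0 => /orP[/eqP/dot_eq0 Z0|/eqP//].
by rewrite Z0 eqxx in UV.
Qed.

Section DamekRicci.
Context {R : realType} {mv mz : nat} (h : htype R mv mz).
Local Notation C := R[i].

(* (X, Z, a) is stored as one row vector, so that S = N A is the open half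
   space a > 0 of R^n, a global chart. *)
Local Notation n := (mv + mz + 1)%N.
Local Notation pt := 'rV[R]_n.

Definition mkpt (X : 'rV[R]_mv) (Z : 'rV[R]_mz) (a : R) : pt :=
  row_mx (row_mx X Z) a%:M.
Definition vpart (p : pt) : 'rV[R]_mv := lsubmx (lsubmx p).
Definition zpart (p : pt) : 'rV[R]_mz := rsubmx (lsubmx p).
Definition apart (p : pt) : R := rsubmx p 0 0.

Definition dr_set : set pt := [set p | 0 < apart p].

(* (X, Z, a) (X', Z', a') = ((X, Z) (sqrt a X', a Z'), a a') *)
Definition dr_mul (p q : pt) : pt :=
  let a := apart p in
  let X := vpart p in
  let X' := Num.sqrt a *: vpart q in
  mkpt (X + X') (zpart p + a *: zpart q + 2^-1 *: ht_br h X X') (a * apart q).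

Definition dr_e : pt := mkpt 0 0 1.

Definition dr_inv (p : pt) : pt :=
  mkpt (- (Num.sqrt (apart p))^-1 *: vpart p) (- (apart p)^-1 *: zpart p)
       (apart p)^-1.

(* The left-invariant metric.  The tangent space at e is v + z + R: since
   l in R corresponds to e^l in A, the tangent vector (X, Z, b) at e = (0, 0, 1)
   has l = b, and its squared length is the Euclidean one. *)
Definition dr_metric (p u v : pt) : R :=
  dot ('D_u (dr_mul (dr_inv p)) p) ('D_v (dr_mul (dr_inv p)) p).

Definition dr_curve (x y : pt) (g : R -> pt) : Prop :=
  [/\ forall t, derivable g t 1,
      continuous (derive1 g),
      forall t, 0 <= t <= 1 -> dr_set (g t),
      g 0 = x & g 1 = y].

Definition dr_length (g : R -> pt) : R :=
  \int[lebesgue_measure]_(t in `[0, 1])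
    Num.sqrt (dr_metric (g t) (derive1 g t) (derive1 g t)).

Definition dr_dist (x y : pt) : R := inf [set dr_length g | g in dr_curve x y].

(* The Laplace--Beltrami operator in the global chart,
   (det G)^(-1/2) sum_ij d_i ((det G)^(1/2) G^ij d_j f). *)
Definition dr_gram (p : pt) : 'M[R]_n :=
  \matrix_(i, j) dr_metric p (delta_mx 0 i) (delta_mx 0 j).

Definition dr_laplace (f : pt -> R) (p : pt) : R :=
  (Num.sqrt (\det (dr_gram p)))^-1 *
  \sum_(i < n) 'D_(delta_mx 0 i)
    (fun q : pt => Num.sqrt (\det (dr_gram q)) *
       \sum_(j < n) invmx (dr_gram q) i j * 'D_(delta_mx 0 j) f q) p.

Definition dr_claplace (f : pt -> C) (p : pt) : C :=
  dr_laplace (fun x => Re (f x)) p +i* dr_laplace (fun x => Im (f x)) p.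

Definition radial {T : Type} (f : pt -> T) :=
  forall x y, dr_set x -> dr_set y ->
    dr_dist dr_e x = dr_dist dr_e y -> f x = f y.

(* f(s) for radial f: the value of f at any point of S at distance s from e *)
Definition profile {T : Type} (f : pt -> T) (s : R) : T :=
  f (xget dr_e [set x | dr_set x /\ dr_dist dr_e x = s]).

Definition rho : R := mv%:R / 4 + mz%:R / 2.

Definition density (s : R) : R :=
  2 ^+ (mv + mz) * ((expR (s / 2) - expR (- (s / 2))) / 2) ^+ (mv + mz)
                 * ((expR (s / 2) + expR (- (s / 2))) / 2) ^+ mz.

Local Notation borel := (g_sigma_algebraType (@open pt)).

(* mu is a Borel measure on the whole chart, of which only the restriction to S
   matters; these conditions determine that restriction. *)
Record normalized_left_haar (mu : {measure set borel -> \bar R}) : Prop := {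
  haar_left_invariant : forall (p : pt) (B : set borel),
    dr_set p -> measurable B -> B `<=` dr_set ->
    mu [set dr_mul p q | q in B] = mu B;
  haar_compact : forall K : set pt,
    compact K -> K `<=` dr_set -> (mu K < +oo)%E;
  haar_normalized : forall f : borel -> \bar R,
    radial f -> measurable_fun (dr_set : set borel) f ->
    (forall x, dr_set x -> (0 <= f x)%E) ->
    (\int[mu]_(x in dr_set) f x =
     \int[lebesgue_measure]_(s in `]0%R, +oo[) (profile f s * (density s)%:E))%E
}.

Definition weakL2 (mu : {measure set borel -> \bar R}) (F : pt -> \bar R) :
    \bar R :=
  ereal_sup
    [set (tau%:E * poweR (mu [set x | dr_set x /\ tau%:E < `|F x|]) 2^-1)%E
      | tau in [set tau : R | 0 < tau]].

Definition is_spherical (lambda : C) (phi : pt -> C) : Prop :=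
  [/\ radial phi,
      csmooth_on dr_set phi,
      forall x, dr_set x ->
        dr_claplace phi x = - (lambda ^+ 2 + (rho ^+ 2)%:C) * phi x &
      phi dr_e = 1].

(* unique on S; its values outside S are irrelevant *)
Definition spherical (lambda : C) : pt -> C :=
  xget (fun=> 0) [set phi | is_spherical lambda phi].

Definition sph_transform (f : pt -> C) (lambda : C) : C :=
  cintegral `]0%R, +oo[
    (fun s => profile f s * profile (spherical lambda) s * (density s)%:C).

Definition cfun (lambda : R) : C :=
  let il : C := 0 +i* lambda in
  cpow 4 (rho%:C - il) * Gamma (2 * il) / Gamma (rho%:C + il) *
  (Gamma (n%:R / 2) / Gamma ((mv%:R + 4 * il + 2) / 4)).

Definition plancherel (lambda : R) : R := (Normc.normc (cfun lambda) ^+ 2)^-1.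

Record schwartz2_radial (f : pt -> C) : Prop := {
  schwartz_radial : radial f;
  schwartz_smooth : csmooth_on dr_set f;
  schwartz_decay : forall M N : nat, exists K : R, forall s : R, 0 < s ->
    (1 + s) ^+ N * expR (rho * s) * Normc.normc (cderive1n M (profile f) s) <= K
}.

Definition sobolev_norm (alpha : R) (f : pt -> C) : \bar R :=
  poweR (\int[lebesgue_measure]_(lambda in `]0%R, +oo[)
    (((lambda ^+ 2 + rho ^+ 2) `^ alpha *
      Normc.normc (sph_transform f lambda%:C) ^+ 2 *
      plancherel lambda)%:E))%E 2^-1.

Definition schrodinger (f : pt -> C) (t : R) (x : pt) : C :=
  cintegral `]0%R, +oo[
    (fun lambda => spherical lambda%:C x *
       cexp (0 +i* (t * (lambda ^+ 2 + rho ^+ 2))) *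
       sph_transform f lambda%:C * (plancherel lambda)%:C).

Definition schrodinger_max (f : pt -> C) (x : pt) : \bar R :=
  ereal_sup [set (Normc.normc (schrodinger f t x))%:E
              | t in [set t : R | 0 < t < (rho ^+ 2)^-1]].

End DamekRicci.

(* Main.v *)
(* The time oscillation plays no role.  By the Cauchy-Schwarz inequality,
     |S_t f (x)| <= || f ||_(H^alpha) (int |phi_lam (x)|^2 |c (lam)|^(-2) (lam^2 + rho^2)^(-alpha) dlam)^(1/2),
   and |phi_lam (x)| |c (lam)|^(-1) <= K A (s)^(-1/2), where s = d (e, x), with K independent of
   lam and s.  As alpha > 1/2 the remaining integral in lam converges, so that S^* f is bounded by
   a multiple of A (s)^(-1/2) || f ||_(H^alpha).  Since A' >= A, the ball {A (s) < T} has measure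
   at most T, which says that A (s)^(-1/2) belongs to weak L^2.
   The bound for phi_lam comes from the radial equation u'' + (A'/A) u' + (lam^2 + rho^2) u = 0,
   the one for c (lam) from Gauss's product, and the radial equation itself from the explicit
   formula cosh^2 (s / 2) = ((1 + a + |X|^2 / 4)^2 + |Z|^2) / (4 a) for the distance.
   Neither the existence of phi_lam nor its measurability in lam is used: [spherical] is 0 when
   there is no spherical function, and the integral of a nonmeasurable nonnegative function is
   its lower integral.  The superlevel sets of S^* f are measurable because each S_t f is
   continuous off e; domination in lam is provided by one integration by parts in f^(lam). *)

Require Import Defs.
From HB Require Import structures.
From mathcomp Require Import all_boot all_order all_algebra.
From mathcomp Require Import complex.
From mathcomp Require Import all_classical all_reals all_analysis
  measurable_realfun.
From mathcomp Require Import ring lra.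

Set Implicit Arguments.
Unset Strict Implicit.
Unset Printing Implicit Defensive.
Import Order.TTheory GRing.Theory Num.Theory.
Import numFieldNormedType.Exports.
Local Open Scope classical_set_scope.
Local Open Scope ring_scope.

(** * Differential and algebraic preliminaries *)

(** The powers of lam balance exactly. With W of order lam (1 + lam)^((mv + mz - 2)/2), called
    [weight] below, |phi_lam| <= K / (W sqrt A) and |c|^(-2) <= B W^2, so that Cauchy-Schwarz leaves
    (lam^2 + rho^2)^(-alpha) alone. The bound for c rests on mv being even: the Gamma factors that
    depend on lam then have real parts in half the integers, and finite products over even and odd
    integers can be compared with each other. The main obstacle is that integrands in lam may fail
    to be measurable, so that neither linearity of the integral nor dominated convergence applies.
    Continuity of S_t f in s therefore comes from a modulus of continuity uniform in lam up to a
    weight, found by interpolating between the size and the Lipschitz constant of phi_lam.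
    Integration by parts gives f^ = O(1 / (W (lam^2 + rho^2))), and phi_lam f^ |c|^(-2) becomes O(1
    / (lam^2 + rho^2)), which leaves room for this interpolation. On the geometric side the
    Laplacian of a radial function is computed on the axis (0, 0, a) only, from second derivatives
    along straight lines through it. *)

Section Calculus.
Context {R : realType}.
Implicit Types (f g : R -> R) (x c : R).

Definition has_deriv f x df := is_derive x 1 f df.

Lemma der1_cst x c : has_deriv (fun=> c) x 0.
Proof. exact: is_derive_cst. Qed.

Lemma der1_id x : has_deriv (fun y : R => y) x 1.
Proof. exact: is_derive_id. Qed.

Lemma der1D f g x df dg : has_deriv f x df -> has_deriv g x dg ->
  has_deriv (fun y => f y + g y) x (df + dg).
Proof. move=> hf hg; exact: is_deriveD. Qed.

Lemma der1N f x df : has_deriv f x df ->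
  has_deriv (fun y => - f y) x (- df).
Proof. move=> hf; exact: is_deriveN. Qed.

Lemma der1M f g x df dg : has_deriv f x df -> has_deriv g x dg ->
  has_deriv (fun y => f y * g y) x (f x * dg + g x * df).
Proof. move=> hf hg; exact: is_deriveM. Qed.

Lemma der1V f x df : f x != 0 -> has_deriv f x df ->
  has_deriv (fun y => (f y)^-1) x (- (f x ^+ 2)^-1 * df).
Proof. move=> fx hf; exact: is_deriveV. Qed.

Lemma der1X f x df n : has_deriv f x df ->
  has_deriv (fun y => f y ^+ n) x (n%:R * f x ^+ n.-1 * df).
Proof.
case: n => [|n] hf.
  rewrite !mul0r /has_deriv; have -> : (fun y => f y ^+ 0) = (fun=> 1); last exact: is_derive_cst.
  by apply/funext => y; rewrite expr0.
have -> : (fun y => f y ^+ n.+1) = f ^+ n.+1.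
  by apply/funext => y; rewrite exprfctE.
exact: is_deriveX hf.
Qed.

Lemma der1_comp f g x df dg : has_deriv f (g x) df ->
  has_deriv g x dg -> has_deriv (fun y => f (g y)) x (df * dg).
Proof. exact: is_derive1_comp. Qed.

Lemma der1_expR f x df : has_deriv f x df ->
  has_deriv (fun y => expR (f y)) x (expR (f x) * df).
Proof. by move=> hf; exact: (der1_comp (is_derive_expR (f x))) hf. Qed.

Lemma der1_ln f x df : 0 < f x -> has_deriv f x df ->
  has_deriv (fun y => ln (f y)) x ((f x)^-1 * df).
Proof. by move=> fx hf; exact: (der1_comp (is_derive1_ln fx)) hf. Qed.

Lemma der1_sqrt f x df : 0 < f x -> has_deriv f x df ->
  has_deriv (fun y => Num.sqrt (f y)) x ((2 * Num.sqrt (f x))^-1 * df).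
Proof.
by move=> fx hf; exact: (der1_comp (is_derive1_sqrt fx)) hf.
Qed.

Lemma der1_cos f x df : has_deriv f x df ->
  has_deriv (fun y => cos (f y)) x (- sin (f x) * df).
Proof. by move=> hf; exact: (der1_comp (is_derive_cos (f x))) hf. Qed.

Lemma der1_eq f x df df' : has_deriv f x df -> df = df' ->
  has_deriv f x df'.
Proof. by move=> h <-. Qed.

Lemma der1_continuous f x df : has_deriv f x df -> {for x, continuous f}.
Proof.
move=> [h _]; exact/differentiable_continuous/derivable1_diffP.
Qed.

Lemma der1_near f g x df : (\forall y \near x, f y = g y) ->
  has_deriv f x df -> has_deriv g x df.
Proof.
move=> h; apply: near_eq_is_derive.
by near=> y; near: y.
Unshelve. all: by end_near. Qed.

Lemma nonincreasing_is_derive f (df : R -> R) (a b : R) : a <= b ->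
  (forall x, a < x < b -> has_deriv f x (df x)) ->
  (forall x, a < x < b -> df x <= 0) ->
  {for a, continuous f} -> {for b, continuous f} -> f b <= f a.
Proof.
move=> ab hd h0 ca cb.
have dI x : x \in `]a, b[ -> derivable f x 1.
  by rewrite in_itv/= => xab; have [] := hd x xab.
have d0 x : x \in `]a, b[ -> derive1 f x <= 0.
  rewrite in_itv/= => xab; rewrite derive1E; have [_ ->] := hd x xab; exact: h0.
apply: (@ler0_derive1_le_cc R f a b) => //.
- apply: continuous_in_subspaceT => x; rewrite inE/= in_itv/= => /andP[].
  rewrite le_eqVlt => /predU1P[<-//|ax]; rewrite le_eqVlt => /predU1P[->//|xb].
  by apply: (@der1_continuous _ _ (df x)); apply: hd; rewrite ax xb.
- by rewrite in_itv/= lexx ab.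
- by rewrite in_itv/= lexx ab.
Qed.

End Calculus.

(** The derivative stays an existential variable that the rules fill in; [der1_eq] then compares it
    with the intended value by [ring] or [field]. [eassumption] comes first, so that hypotheses on
    abstract functions are used. *)
Ltac derive_rules :=
  repeat (first [ eassumption | apply: der1_cst | apply: der1_id
    | apply: der1D | apply: der1N | apply: der1X
    | apply: der1M | apply: der1_expR | apply: der1_cos
    | apply: der1V | apply: der1_ln | apply: der1_sqrt ]).

Section Dot.
Context {R : realType} {m : nat}.
Implicit Types (u v w : 'rV[R]_m) (a : R).

Lemma dotC u v : dot u v = dot v u.
Proof. by rewrite !dotE; apply: eq_bigr => i _; rewrite mulrC. Qed.

Lemma dotDl u v w : dot (u + v) w = dot u w + dot v w.
Proof. by rewrite /dot mulmxDl mxE. Qed.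

Lemma dotDr u v w : dot w (u + v) = dot w u + dot w v.
Proof. by rewrite dotC dotDl !(dotC w). Qed.

Lemma dotZl a u v : dot (a *: u) v = a * dot u v.
Proof. by rewrite /dot -scalemxAl mxE. Qed.

Lemma dotZr a u v : dot u (a *: v) = a * dot u v.
Proof. by rewrite dotC dotZl dotC. Qed.

Lemma dotNl u v : dot (- u) v = - dot u v.
Proof. by rewrite -scaleN1r dotZl mulN1r. Qed.

Lemma dotNr u v : dot u (- v) = - dot u v.
Proof. by rewrite dotC dotNl dotC. Qed.

Lemma dot0l u : dot 0 u = 0.
Proof. by rewrite -(scale0r u) dotZl mul0r. Qed.

Lemma dot0r u : dot u 0 = 0.
Proof. by rewrite dotC dot0l. Qed.

Lemma dot_ge0 u : 0 <= dot u u.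
Proof. by rewrite dotE sumr_ge0// => i _; rewrite -expr2 sqr_ge0. Qed.

Lemma dot_eq_ext u v : (forall w, dot u w = dot v w) -> u = v.
Proof.
move=> uv; apply/eqP; rewrite -subr_eq0; apply/eqP/dot_eq0.
by rewrite dotDl dotNl uv subrr.
Qed.

Lemma dot_delta u i : dot u (delta_mx 0 i) = u 0 i.
Proof.
rewrite dotE (bigD1 i)//= big1 => [|j ji]; last by rewrite mxE (negbTE ji) andbF mulr0.
by rewrite mxE !eqxx mulr1 addr0.
Qed.

Lemma cauchy_schwarz u v : dot u v ^+ 2 <= dot u u * dot v v.
Proof.
have [v0|v0] := eqVneq (dot v v) 0.
  by rewrite (dot_eq0 v0) !dot0r mulr0 expr0n.
have vgt0 : 0 < dot v v by rewrite lt_def v0 dot_ge0.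
have := dot_ge0 (dot v v *: u - dot u v *: v).
rewrite !(dotDl, dotDr, dotNl, dotNr, dotZl, dotZr) (dotC v u).
set x := dot u u; set y := dot u v; set z := dot v v.
rewrite [leRHS](_ : _ = z * (x * z - y ^+ 2)); last by ring.
by rewrite pmulr_rge0// subr_ge0.
Qed.

End Dot.

(** * The bracket and the maps J_Z of an H-type algebra *)

Section HType.
Context {R : realType} {mv mz : nat} (h : htype R mv mz).
Local Notation br := (ht_br h).
Local Notation J := (ht_J h).

Lemma brDl X X' Y : br (X + X') Y = br X Y + br X' Y.
Proof. by have := ht_br_linearl h Y 1 X X'; rewrite !scale1r. Qed.

Lemma brDr X Y Y' : br X (Y + Y') = br X Y + br X Y'.
Proof. by have := ht_br_linearr h X 1 Y Y'; rewrite !scale1r. Qed.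

Lemma br0l Y : br 0 Y = 0.
Proof. by apply: (addrI (br 0 Y)); rewrite -brDl !addr0. Qed.

Lemma br0r X : br X 0 = 0.
Proof. by apply: (addrI (br X 0)); rewrite -brDr !addr0. Qed.

Lemma brZl a X Y : br (a *: X) Y = a *: br X Y.
Proof. by have := ht_br_linearl h Y a X 0; rewrite br0l !addr0. Qed.

Lemma brZr a X Y : br X (a *: Y) = a *: br X Y.
Proof. by have := ht_br_linearr h X a Y 0; rewrite br0r !addr0. Qed.

Lemma brC X Y : br X Y = - br Y X.
Proof.
apply/eqP; rewrite -addr_eq0; apply/eqP.
by have := ht_br_alt h (X + Y); rewrite brDl !brDr !ht_br_alt add0r addr0.
Qed.

Lemma JDl Z W X : J (Z + W) X = J Z X + J W X.
Proof. by apply: dot_eq_ext => Y; rewrite dotDl !ht_J_adj dotDr. Qed.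

Lemma JDr Z X Y : J Z (X + Y) = J Z X + J Z Y.
Proof. by apply: dot_eq_ext => W; rewrite dotDl !ht_J_adj brDl dotDl. Qed.

Lemma JZr a Z X : J Z (a *: X) = a *: J Z X.
Proof. by apply: dot_eq_ext => W; rewrite dotZl !ht_J_adj brZl dotZl. Qed.

Lemma J_skew Z X Y : dot (J Z X) Y = - dot X (J Z Y).
Proof. by rewrite (dotC X) !ht_J_adj brC dotNl. Qed.

Lemma J_orth Z X : dot (J Z X) X = 0.
Proof. by rewrite ht_J_adj ht_br_alt dot0l. Qed.

Lemma J_norm Z X : dot (J Z X) (J Z X) = dot Z Z * dot X X.
Proof. by rewrite J_skew ht_J_sqr scaleNr dotNr opprK dotZr. Qed.

(** Polarizing |J_Z X|^2 = |Z|^2 |X|^2 in Z gives <J_Z X, J_W X> = <Z, W> |X|^2, whose left side is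
    <[X, J_Z X], W>. *)
Lemma br_J X Z : br X (J Z X) = dot X X *: Z.
Proof.
apply: dot_eq_ext => W; rewrite -ht_J_adj dotZl (dotC Z).
have := J_norm (Z + W) X.
rewrite JDl !(dotDl, dotDr) !J_norm !mulrDl (dotC (J Z X)) (dotC Z W).
by move=> /eqP; lra.
Qed.

Lemma mz_gt0 : (0 < mz)%N.
Proof.
have [X [Y]] := ht_nonabelian h; rewrite lt0n; apply: contra_neq => m0.
by apply/rowP => i; have := ltn_ord i; rewrite {2}m0.
Qed.

Lemma exists_nonzero_center : exists Z : 'rV[R]_mz, dot Z Z != 0.
Proof.
have [X [Y Z0]] := ht_nonabelian h; exists (br X Y).
by apply: contra_neq Z0; exact: dot_eq0.
Qed.

Lemma mv_gt0 : (0 < mv)%N.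
Proof.
have [X [Y]] := ht_nonabelian h; rewrite lt0n; apply: contra_neq => m0.
have -> : X = 0 by apply/rowP => i; have := ltn_ord i; rewrite {2}m0.
exact: br0l.
Qed.

(* A skew matrix of odd size is singular, whereas [J_Z] is invertible. *)
Lemma mv_even : ~~ odd mv.
Proof.
have [Z Z0] := exists_nonzero_center.
pose M : 'M[R]_mv := \matrix_(i, j) J Z (delta_mx 0 i) 0 j.
have ME i : row i M = J Z (delta_mx 0 i) by apply/rowP => j; rewrite !mxE.
have MJ X : X *m M = J Z X.
  rewrite {2}[X]row_sum_delta mulmx_sum_row.
  pose P (u v : 'rV[R]_mv) := u = J Z v.
  apply: (big_rec2 P) => [|i u v _ Puv].
    by apply: dot_eq_ext => Y; rewrite ht_J_adj br0l !dot0l.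
  by rewrite /P JDr JZr ME Puv.
have MM : M *m M = (- dot Z Z)%:M.
  apply/row_matrixP => i; rewrite row_mul ME MJ ht_J_sqr.
  by rewrite -scalemx1 linearZ/= row1.
have Mt : M^T = - M.
  apply/matrixP => i j; rewrite !mxE -(dot_delta _ i) J_skew.
  by rewrite dotC dot_delta.
apply: contra Z0 => omv.
have d0 : \det M = 0.
  have := det_tr M; rewrite Mt -scaleN1r detZ -signr_odd omv expr1 mulN1r.
  by move=> /eqP; lra.
have := congr1 determinant MM; rewrite det_mulmx d0 mul0r det_scalar => /esym/eqP.
by rewrite expf_eq0 mv_gt0 oppr_eq0.
Qed.

End HType.

(** * The metric and the Laplacian *)

Section Lines.
Context {R : realType} {V : normedModType R}.
Implicit Types (p v : V).

(** Reduces directional derivatives on the chart to the one-variable rules. *)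
Lemma is_derive_line (f : V -> R) p v d :
  is_derive p v f d <-> has_deriv (fun t => f (t *: v + p)) 0 d.
Proof.
have E : (fun h : R => h^-1 *: (f (h *: v + p) - f p)) =
    (fun h => h^-1 *: (f ((h *: (1 : R) + 0) *: v + p) - f (0 *: v + p))).
  by apply/funext => t; rewrite addr0 scale0r add0r /GRing.scale/= mulr1.
split=> -[h1 h2]; split.
- by move: h1; rewrite /derivable /= -E.
- by move: h2; rewrite /derive /= -E.
- by move: h1; rewrite /derivable /= -E.
- by move: h2; rewrite /derive /= -E.
Qed.

Lemma derive_affine (W : normedModType R) (f : V -> W) p v w :
  (forall t, f (t *: v + p) = f p + t *: w) -> 'D_v f p = w.
Proof.
move=> fE; rewrite /derive; apply: cvg_lim => //.
apply: cvg_near_cst.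
near=> t; have t0 : t != 0 by near: t; exact: nbhs_dnbhs_neq.
by rewrite /= fE addrC addKr scalerA mulVf ?scale1r.
Unshelve. all: by end_near. Qed.

Lemma derive_line_ext (f g : V -> R) p v d :
  (\forall t \near (0 : R), f (t *: v + p) = g (t *: v + p)) ->
  is_derive p v f d -> is_derive p v g d.
Proof. by move=> fg /is_derive_line/(der1_near fg)/is_derive_line. Qed.

End Lines.

Section LinearMatrix.
Context {R : realType} {m n : nat} (f : 'rV[R]_m -> 'rV[R]_n).
Hypotheses (fD : forall u v, f (u + v) = f u + f v)
           (fZ : forall a u, f (a *: u) = a *: f u).

Lemma mul_rV_mx_of u : u *m \matrix_(i, j) f (delta_mx 0 i) 0 j = f u.
Proof.
rewrite {2}[u]row_sum_delta mulmx_sum_row.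
apply: (big_rec2 (fun x y => x = f y)) => [|i x y _ ->].
  by have := fZ 0 0; rewrite !scale0r.
by rewrite fD fZ; congr (_ *: _ + _); apply/rowP => j; rewrite !mxE.
Qed.

End LinearMatrix.

Section Points.
Context {R : realType} {mv mz : nat}.
Local Notation n := (mv + mz + 1)%N.
Local Notation pt := 'rV[R]_n.
Implicit Types (X U : 'rV[R]_mv) (Z W : 'rV[R]_mz) (a b : R) (p q : pt).

Lemma vpart_mkpt X Z a : vpart (mkpt X Z a) = X.
Proof. by rewrite /vpart /mkpt !row_mxKl. Qed.

Lemma zpart_mkpt X Z a : zpart (mkpt X Z a) = Z.
Proof. by rewrite /zpart /mkpt row_mxKl row_mxKr. Qed.

Lemma apart_mkpt X Z a : apart (mkpt X Z a) = a.
Proof. by rewrite /apart /mkpt row_mxKr mxE eqxx. Qed.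

Lemma mkptK p : mkpt (vpart p) (zpart p) (apart p) = p.
Proof.
rewrite /mkpt /vpart /zpart /apart hsubmxK.
by rewrite -[RHS]hsubmxK [rsubmx p in RHS]mx11_scalar.
Qed.

Lemma vpartD p q : vpart (p + q) = vpart p + vpart q.
Proof. by rewrite /vpart !linearD. Qed.

Lemma zpartD p q : zpart (p + q) = zpart p + zpart q.
Proof. by rewrite /zpart !linearD. Qed.

Lemma apartD p q : apart (p + q) = apart p + apart q.
Proof. by rewrite /apart !linearD mxE. Qed.

Lemma vpartZ b p : vpart (b *: p) = b *: vpart p.
Proof. by rewrite /vpart !linearZ. Qed.

Lemma zpartZ b p : zpart (b *: p) = b *: zpart p.
Proof. by rewrite /zpart !linearZ. Qed.

Lemma apartZ b p : apart (b *: p) = b * apart p.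
Proof. by rewrite /apart !linearZ mxE. Qed.

Lemma mkptD X Z a U W b : mkpt X Z a + mkpt U W b = mkpt (X + U) (Z + W) (a + b).
Proof. by rewrite -[LHS]mkptK vpartD zpartD apartD !(vpart_mkpt, zpart_mkpt, apart_mkpt). Qed.

Lemma mkptZ b X Z a : b *: mkpt X Z a = mkpt (b *: X) (b *: Z) (b * a).
Proof. by rewrite -[LHS]mkptK vpartZ zpartZ apartZ !(vpart_mkpt, zpart_mkpt, apart_mkpt). Qed.

Lemma dot_mkpt X Z a U W b : dot (mkpt X Z a) (mkpt U W b) = dot X U + dot Z W + a * b.
Proof.
rewrite /dot /mkpt tr_row_mx mul_row_col mxE tr_row_mx mul_row_col mxE.
by rewrite tr_scalar_mx -scalar_mxM !mxE eqxx.
Qed.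

Lemma delta_v (i : 'I_mv) :
  delta_mx 0 (lshift 1 (lshift mz i)) = mkpt (delta_mx 0 i) 0 0 :> pt.
Proof.
by rewrite /mkpt -[0%:M]/((0:R)%:M) raddf0 -!delta_mx_lshift.
Qed.

Lemma delta_z (i : 'I_mz) :
  delta_mx 0 (lshift 1 (rshift mv i)) = mkpt 0 (delta_mx 0 i) 0 :> pt.
Proof. by rewrite /mkpt raddf0 -delta_mx_rshift -delta_mx_lshift. Qed.

Lemma delta_a (i : 'I_1) : delta_mx 0 (rshift (mv + mz) i) = mkpt 0 0 1 :> pt.
Proof.
rewrite /mkpt row_mx0 delta_mx_rshift; congr row_mx.
by apply/matrixP => j k; rewrite !mxE !ord1.
Qed.

End Points.

Section Metric.
Context {R : realType} {mv mz : nat} (h : htype R mv mz).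
Local Notation br := (ht_br h).
Local Notation n := (mv + mz + 1)%N.
Local Notation pt := 'rV[R]_n.
Implicit Types (X U : 'rV[R]_mv) (Z W : 'rV[R]_mz) (a b : R) (p q u v : pt).

(** The differential at [p] of the left translation that carries [p] to the identity: it expresses
    [u] in the left-invariant orthonormal frame. In this chart the translation is affine, hence
    equal to its differential up to a constant. *)
Definition dr_frame p u : pt :=
  let a := apart p in
  mkpt ((Num.sqrt a)^-1 *: vpart u)
       (a^-1 *: (zpart u - 2^-1 *: br (vpart p) (vpart u))) (a^-1 * apart u).

Definition dr_coframe p u : pt :=
  let a := apart p in
  mkpt (Num.sqrt a *: vpart u)
       (a *: zpart u + (2^-1 * Num.sqrt a) *: br (vpart p) (vpart u)) (a * apart u).

Lemma dr_frameK p u : dr_set p -> dr_coframe p (dr_frame p u) = u.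
Proof.
rewrite /dr_set/= => a0; rewrite -[RHS]mkptK /dr_coframe.
rewrite !(vpart_mkpt, zpart_mkpt, apart_mkpt).
have s0 : Num.sqrt (apart p) != 0 by rewrite gt_eqF// sqrtr_gt0.
have a0' : apart p != 0 by rewrite gt_eqF.
congr mkpt.
- by rewrite scalerA mulfV// scale1r.
- rewrite scalerA mulfV// scale1r brZr scalerA -mulrA mulfV// mulr1.
  by rewrite subrK.
- by rewrite mulrA mulfV// mul1r.
Qed.

Lemma derive_dr_mul p u : dr_set p ->
  'D_u (dr_mul h (dr_inv p)) p = dr_frame p u.
Proof.
rewrite /dr_set/= => a0; apply: derive_affine => t.
have s0 : Num.sqrt (apart p) != 0 by rewrite gt_eqF// sqrtr_gt0.
rewrite /dr_mul /dr_inv /dr_frame.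
rewrite !(vpart_mkpt, zpart_mkpt, apart_mkpt, vpartD, zpartD, apartD, vpartZ, zpartZ, apartZ).
rewrite mkptZ mkptD sqrtrV ?ltW//; congr mkpt.
- rewrite !scalerDr (addrC (_ *: _) (_ *: vpart p)) addrA; congr (_ + _).
  by rewrite !scalerA mulrC.
- rewrite !(brDr, brZl, brZr, ht_br_alt); apply/rowP => i; rewrite !mxE.
  have := sqr_sqrtr (ltW a0); move: (Num.sqrt _) s0 => s s0 <-.
  by field.
- by ring.
Qed.

Lemma dr_metricE p u v : dr_set p ->
  dr_metric h p u v = dot (dr_frame p u) (dr_frame p v).
Proof. by move=> ap; rewrite /dr_metric !derive_dr_mul. Qed.

Definition frame_mx p : 'M[R]_n :=
  let a := apart p in
  block_mx (block_mx (Num.sqrt a)^-1%:M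
      (\matrix_(i, j) (a^-1 *: - (2^-1 *: br (vpart p) (delta_mx 0 i))) 0 j)
      0 a^-1%:M) 0 0 a^-1%:M.

Definition coframe_mx p : 'M[R]_n :=
  let a := apart p in
  block_mx (block_mx (Num.sqrt a)%:M
      (\matrix_(i, j) ((2^-1 * Num.sqrt a) *: br (vpart p) (delta_mx 0 i)) 0 j)
      0 a%:M) 0 0 a%:M.

Lemma mul_frame_mx p u : u *m frame_mx p = dr_frame p u.
Proof.
rewrite -{1}(mkptK u) {1}/mkpt /frame_mx mul_row_block !mulmx0 addr0 add0r.
rewrite mul_row_block !mulmx0 !addr0 !mul_mx_scalar /dr_frame /mkpt.
congr (row_mx (row_mx _ _) _).
  rewrite (@mul_rV_mx_of _ _ _ (fun U => (apart p)^-1 *: - (2^-1 *: br (vpart p) U))).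
  - by rewrite addrC -scalerDr.
  - by move=> X U; rewrite brDr scalerDr opprD scalerDr.
  - by move=> b U; rewrite brZr; apply/rowP => i; rewrite !mxE; ring.
by rewrite scale_scalar_mx.
Qed.

Lemma mul_coframe_mx p u : u *m coframe_mx p = dr_coframe p u.
Proof.
rewrite -{1}(mkptK u) {1}/mkpt /coframe_mx mul_row_block !mulmx0 addr0 add0r.
rewrite mul_row_block !mulmx0 !addr0 !mul_mx_scalar /dr_coframe /mkpt.
congr (row_mx (row_mx _ _) _).
  rewrite (@mul_rV_mx_of _ _ _ (fun U => (2^-1 * Num.sqrt (apart p)) *: br (vpart p) U)).
  - by rewrite addrC.
  - by move=> X U; rewrite brDr scalerDr.
  - by move=> b U; rewrite brZr; apply/rowP => i; rewrite !mxE; ring.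
by rewrite scale_scalar_mx.
Qed.

Lemma frame_mxK p : dr_set p -> frame_mx p *m coframe_mx p = 1%:M.
Proof.
move=> ap; apply/row_matrixP => i; rewrite row_mul rowE mul_frame_mx.
by rewrite mul_coframe_mx dr_frameK// rowE mulmx1.
Qed.

Lemma dr_gramE p : dr_set p -> dr_gram h p = frame_mx p *m (frame_mx p)^T.
Proof.
move=> ap; apply/matrixP => i j; rewrite mxE dr_metricE// -!mul_frame_mx /dot.
by rewrite -!rowE !mxE; apply: eq_bigr => k _; rewrite !mxE.
Qed.

Lemma invmx_dr_gram p : dr_set p ->
  invmx (dr_gram h p) = (coframe_mx p)^T *m coframe_mx p.
Proof.
move=> ap; rewrite dr_gramE//.
have FC := frame_mxK ap.
have CF : coframe_mx p *m frame_mx p = 1%:M by exact: mulmx1C.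
have CFt : (frame_mx p)^T *m (coframe_mx p)^T = 1%:M.
  by rewrite -trmx_mul CF trmx1.
have inv : frame_mx p *m (frame_mx p)^T *m ((coframe_mx p)^T *m coframe_mx p) = 1%:M.
  by rewrite mulmxA -(mulmxA (frame_mx p)) CFt mulmx1.
have [U _] := mulmx1_unit inv.
by rewrite -[LHS]mulmx1 -inv mulKmx.
Qed.

(** [frame_mx] is block triangular with scalar diagonal blocks, whence a^(-(mv/2 + mz + 1)). The
    exponential form accommodates the half-integral exponent and is easy to differentiate. *)
Lemma sqrt_det_dr_gram p : dr_set p ->
  Num.sqrt (\det (dr_gram h p)) =
  expR (- (mv%:R / 2 + mz%:R + 1) * ln (apart p)).
Proof.
rewrite /dr_set/= => ap; rewrite dr_gramE// det_mulmx det_tr -expr2 sqrtr_sqr.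
have Es : Num.sqrt (apart p) = expR (2^-1 * ln (apart p)).
  by rewrite -powR12_sqrt ?ltW// /powR gt_eqF.
have Ea : (apart p)^-1 = expR (- ln (apart p)) by rewrite expRN lnK.
rewrite det_ublock det_ublock !det_scalar expr1 Es Ea -expRN.
rewrite -!expRM_natl -!expRD ger0_norm ?expR_ge0//; congr expR.
by field.
Qed.

End Metric.

Section LaplaceAxis.
Context {R : realType} {mv mz : nat} (h : htype R mv mz).
Local Notation br := (ht_br h).
Local Notation n := (mv + mz + 1)%N.
Local Notation pt := 'rV[R]_n.
Implicit Types (X U : 'rV[R]_mv) (Z W : 'rV[R]_mz) (a b : R) (p q u v : pt).

Lemma mul_tr_coframe_mx p U : mkpt U 0 0 *m (coframe_mx h p)^T =
  mkpt (Num.sqrt (apart p) *: U) 0 0.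
Proof.
rewrite /coframe_mx !tr_block_mx !trmx0 !tr_scalar_mx {1}/mkpt raddf0.
rewrite mul_row_block !mulmx0 mul0mx !addr0 mul_row_block !mulmx0 !mul0mx !addr0.
by rewrite mul_mx_scalar /mkpt raddf0.
Qed.

Lemma mul_tr_coframe_mx0 p u : vpart p = 0 -> u *m (coframe_mx h p)^T =
  mkpt (Num.sqrt (apart p) *: vpart u) (apart p *: zpart u) (apart p * apart u).
Proof.
move=> p0; rewrite -{1}(mkptK u) /coframe_mx p0.
rewrite (_ : (\matrix_(i, j) _) = 0); last first.
  by apply/matrixP => i j; rewrite !mxE br0l mxE mulr0.
rewrite !tr_block_mx !trmx0 !tr_scalar_mx {1}/mkpt.
rewrite mul_row_block !mulmx0 add0r addr0 mul_row_block !mulmx0 add0r addr0.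
by rewrite !mul_mx_scalar /mkpt scale_scalar_mx.
Qed.

(** The i-th summand of the Laplacian is differentiated in direction e_i only, so the i-th row of
    the inverse Gram matrix matters only on the line through the axis in that direction. There X is
    a multiple of e_i, the bracket [X, e_i] vanishes and the row is diagonal; in the directions of z
    and A this holds because X = 0. *)
Lemma invmx_gram_v p (i : 'I_mv) t : dr_set p -> vpart p = t *: delta_mx 0 i ->
  row (lshift 1 (lshift mz i)) (invmx (dr_gram h p)) =
  apart p *: delta_mx 0 (lshift 1 (lshift mz i)).
Proof.
move=> ap pX; rewrite invmx_dr_gram// rowE mulmxA delta_v mul_tr_coframe_mx.
rewrite mul_coframe_mx /dr_coframe !(vpart_mkpt, zpart_mkpt, apart_mkpt) pX.
rewrite brZr brZl ht_br_alt !scaler0 addr0 mulr0 scalerA -expr2 sqr_sqrtr.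
  by rewrite mkptZ scaler0 mulr0.
by rewrite ltW.
Qed.

Lemma invmx_gram_z p (i : 'I_mz) : dr_set p -> vpart p = 0 ->
  row (lshift 1 (rshift mv i)) (invmx (dr_gram h p)) =
  apart p ^+ 2 *: delta_mx 0 (lshift 1 (rshift mv i)).
Proof.
move=> ap p0; rewrite invmx_dr_gram// rowE mulmxA mul_tr_coframe_mx0//.
rewrite mul_coframe_mx /dr_coframe delta_z !(vpart_mkpt, zpart_mkpt, apart_mkpt) p0.
by rewrite br0l !scaler0 addr0 !mulr0 scalerA -expr2 mkptZ scaler0 mulr0.
Qed.

Lemma invmx_gram_a p (i : 'I_1) : dr_set p -> vpart p = 0 ->
  row (rshift (mv + mz) i) (invmx (dr_gram h p)) =
  apart p ^+ 2 *: delta_mx 0 (rshift (mv + mz) i).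
Proof.
move=> ap p0; rewrite invmx_dr_gram// rowE mulmxA mul_tr_coframe_mx0//.
rewrite mul_coframe_mx /dr_coframe delta_a !(vpart_mkpt, zpart_mkpt, apart_mkpt) p0.
by rewrite br0l !scaler0 addr0 !mulr1 -expr2 mkptZ !scaler0 mulr1.
Qed.

Lemma sum_row_delta (M : 'M[R]_n) (i : 'I_n) k (x : 'I_n -> R) :
  row i M = k *: delta_mx 0 i -> \sum_(j < n) M i j * x j = k * x i.
Proof.
move=> rM; have ME j : M i j = k * (j == i)%:R.
  by have := congr1 (fun r : 'rV[R]_n => r 0 j) rM; rewrite !mxE eqxx.
rewrite (bigD1 i)//= big1 => [|j ji]; first by rewrite ME eqxx mulr1 addr0.
by rewrite ME (negbTE ji) mulr0 mul0r.
Qed.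

Lemma is_derive_smooth (U : set pt) (f : pt -> R) vs p v : smooth_on U f -> U p ->
  is_derive p v (iter_derive vs f) ('D_v (iter_derive vs f) p).
Proof. by move=> sf Up; apply: derivableP; have [] := sf vs p v Up. Qed.

Lemma dr_laplace_axis (f : pt -> R) a : 0 < a -> smooth_on dr_set f ->
  let p : pt := mkpt 0 0 a in
  let DD v := 'D_v ('D_v f) p in
  dr_laplace h f p =
    a * (\sum_(i < mv) DD (mkpt (delta_mx 0 i) 0 0)) +
    a ^+ 2 * (\sum_(i < mz) DD (mkpt 0 (delta_mx 0 i) 0)) +
    a ^+ 2 * DD (mkpt 0 0 1) +
    (1 - (mv%:R / 2 + mz%:R)) * a * 'D_(mkpt 0 0 1) f p.
Proof.
move=> a0 sf p DD; pose w (b : R) := expR (- (mv%:R / 2 + mz%:R + 1) * ln b).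
have Sp b : 0 < b -> dr_set (mkpt 0 0 b : pt) by rewrite /dr_set/= apart_mkpt.
have w0 : w a != 0 by rewrite gt_eqF ?expR_gt0.
pose F (i : 'I_n) (q : pt) := Num.sqrt (\det (dr_gram h q)) *
  \sum_(j < n) invmx (dr_gram h q) i j * 'D_(delta_mx 0 j) f q.
have wE q : dr_set q -> Num.sqrt (\det (dr_gram h q)) = w (apart q).
  exact: sqrt_det_dr_gram.
have -> : dr_laplace h f p = (w a)^-1 * \sum_(i < n) 'D_(delta_mx 0 i) (F i) p.
  by rewrite /dr_laplace; congr (_^-1 * _); rewrite wE ?apart_mkpt//; exact: Sp.
have Fv (i : 'I_mv) : 'D_(mkpt (delta_mx 0 i) 0 0) (F (lshift 1 (lshift mz i))) p =
    w a * a * DD (mkpt (delta_mx 0 i) 0 0).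
  apply: derive_val; apply: (@derive_line_ext _ _ (fun q => (w a * a) * 'D_(mkpt (delta_mx 0 i) 0 0) f q)).
    near=> t.
    have Eq : apart (t *: mkpt (delta_mx 0 i) 0 0 + p : pt) = a.
      by rewrite /p mkptZ mkptD apart_mkpt mulr0 add0r.
    have Sq : dr_set (t *: mkpt (delta_mx 0 i) 0 0 + p : pt) by rewrite /dr_set/= Eq.
    rewrite /F (wE _ Sq) (sum_row_delta _ (@invmx_gram_v _ i t _ _))//; last first.
      by rewrite /p mkptZ mkptD vpart_mkpt addr0.
    by rewrite Eq mulrA -delta_v.
  have D1 := is_derive_smooth [:: mkpt (delta_mx 0 i) 0 0] (mkpt (delta_mx 0 i) 0 0) sf (Sp _ a0).
  apply/is_derive_line; move/is_derive_line: D1 => D1.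
  by apply: der1_eq (der1M (der1_cst 0 (w a * a)) D1) _; rewrite mulr0 addr0.
have Fz (i : 'I_mz) : 'D_(mkpt 0 (delta_mx 0 i) 0) (F (lshift 1 (rshift mv i))) p =
    w a * a ^+ 2 * DD (mkpt 0 (delta_mx 0 i) 0).
  apply: derive_val; apply: (@derive_line_ext _ _ (fun q => (w a * a ^+ 2) * 'D_(mkpt 0 (delta_mx 0 i) 0) f q)).
    near=> t.
    have Eq : apart (t *: mkpt 0 (delta_mx 0 i) 0 + p : pt) = a.
      by rewrite /p mkptZ mkptD apart_mkpt mulr0 add0r.
    have Sq : dr_set (t *: mkpt 0 (delta_mx 0 i) 0 + p : pt) by rewrite /dr_set/= Eq.
    rewrite /F (wE _ Sq) (sum_row_delta _ (@invmx_gram_z _ i _ _))//; last first.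
      by rewrite /p mkptZ mkptD vpart_mkpt scaler0 addr0.
    by rewrite Eq [RHS]mulrA -delta_z.
  have D1 := is_derive_smooth [:: mkpt 0 (delta_mx 0 i) 0] (mkpt 0 (delta_mx 0 i) 0) sf (Sp _ a0).
  apply/is_derive_line; move/is_derive_line: D1 => D1.
  by apply: der1_eq (der1M (der1_cst 0 (w a * a ^+ 2)) D1) _; rewrite mulr0 addr0.
(* Along v and z the factors w a and w a^2 are constant. Along A the factor varies and yields the
   first-order term: (w a^2)' = (1 - mv/2 - mz) w a. *)
have Fa : 'D_(mkpt 0 0 1) (F (rshift (mv + mz) ord0)) p =
    w a * (a ^+ 2 * DD (mkpt 0 0 1) + (1 - (mv%:R / 2 + mz%:R)) * a * 'D_(mkpt 0 0 1) f p).
  apply: derive_val; apply/is_derive_line.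
  apply: (@der1_near _ (fun t => w (t + a) * ((t + a) ^+ 2 * 'D_(mkpt 0 0 1) f (t *: mkpt 0 0 1 + p)))).
    near=> t.
    have ta : 0 < t + a.
      rewrite -ltrBlDr sub0r; near: t.
      by apply: lt_nbhsr; rewrite oppr_lt0.
    have Eq : t *: mkpt 0 0 1 + p = mkpt 0 0 (t + a) :> pt.
      by rewrite /p mkptZ mkptD mulr1 !scaler0 !addr0.
    have Sq : dr_set (t *: mkpt 0 0 1 + p : pt) by rewrite Eq; exact: Sp.
    have v0 : vpart (t *: mkpt 0 0 1 + p : pt) = 0 by rewrite Eq vpart_mkpt.
    rewrite /F (wE _ Sq) (sum_row_delta _ (@invmx_gram_a _ ord0 Sq v0)).
    by rewrite Eq apart_mkpt delta_a.
  have Df : has_deriv (fun t => 'D_(mkpt 0 0 1) f (t *: mkpt 0 0 1 + p)) 0 (DD (mkpt 0 0 1)).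
    by have /is_derive_line := is_derive_smooth [:: mkpt 0 0 1] (mkpt 0 0 1) sf (Sp _ a0).
  rewrite /w; eapply der1_eq.
    by derive_rules; rewrite add0r.
  rewrite /= !add0r scale0r add0r; field.
  by rewrite gt_eqF.
rewrite big_split_ord/= big_split_ord/= big_ord1.
under eq_bigr => i _ do rewrite delta_v Fv.
under [X in (w a)^-1 * (_ + X + _)]eq_bigr => i _ do rewrite delta_z Fz.
rewrite delta_a Fa -!mulr_sumr; field.
by rewrite expR_eq0.
Unshelve. all: by end_near. Qed.

End LaplaceAxis.

Section Continuity.
Context {R : realType} {T : topologicalType}.
Implicit Types (f g : T -> R) (x : T).

Lemma contD f g x : continuous_at x f -> continuous_at x g ->
  continuous_at x (fun y => f y + g y).
Proof. by move=> hf hg; exact: continuousD. Qed.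

Lemma contN f x : continuous_at x f -> continuous_at x (fun y => - f y).
Proof. by move=> hf; exact: continuousN. Qed.

Lemma contM f g x : continuous_at x f -> continuous_at x g ->
  continuous_at x (fun y => f y * g y).
Proof. by move=> hf hg; exact: continuousM. Qed.

Lemma contV f x : f x != 0 -> continuous_at x f ->
  continuous_at x (fun y => (f y)^-1).
Proof. by move=> fx hf; exact: continuousV. Qed.

Lemma contX f n x : continuous_at x f -> continuous_at x (fun y => f y ^+ n).
Proof.
move=> hf; elim: n => [|n ih].
  by under eq_fun do rewrite expr0; exact: cst_continuous.
by under eq_fun do rewrite exprS; exact: contM.
Qed.

Lemma cont_cst (c : R) x : continuous_at x (fun=> c).
Proof. exact: cst_continuous. Qed.

Lemma cont_comp (h : R -> R) f x : continuous_at (f x) h -> continuous_at x f ->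
  continuous_at x (fun y => h (f y)).
Proof. by move=> hh hf; exact: continuous_comp. Qed.

Lemma cont_sqrt f x : continuous_at x f -> continuous_at x (fun y => Num.sqrt (f y)).
Proof. by move=> hf; apply: cont_comp => //; exact: sqrt_continuous. Qed.

Lemma cont_expR f x : continuous_at x f -> continuous_at x (fun y => expR (f y)).
Proof. by move=> hf; apply: cont_comp => //; exact: continuous_expR. Qed.

Lemma cont_ln f x : 0 < f x -> continuous_at x f -> continuous_at x (fun y => ln (f y)).
Proof. by move=> fx hf; apply: cont_comp => //; exact: continuous_ln. Qed.

Lemma cont_sum I (r : seq I) (F : I -> T -> R) x :
  (forall i, continuous_at x (F i)) ->
  continuous_at x (fun y => \sum_(i <- r) F i y).
Proof.
move=> hF; elim: r => [|i r ih].
  by under eq_fun do rewrite big_nil; exact: cont_cst.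
by under eq_fun do rewrite big_cons; exact: contD.
Qed.

Lemma cont_dot m (u v : T -> 'rV[R]_m) x :
  (forall i, continuous_at x (fun y => u y 0 i)) ->
  (forall i, continuous_at x (fun y => v y 0 i)) ->
  continuous_at x (fun y => dot (u y) (v y)).
Proof.
move=> hu hv; under eq_fun do rewrite dotE.
by apply: cont_sum => i; exact: contM.
Qed.

End Continuity.

Lemma has_deriv_sum {R : realType} I (r : seq I) (F : I -> R -> R) (dF : I -> R) (x : R) :
  (forall i, has_deriv (F i) x (dF i)) ->
  has_deriv (fun y => \sum_(i <- r) F i y) x (\sum_(i <- r) dF i).
Proof.
move=> hF; elim: r => [|i r ih].
  by under eq_fun do rewrite big_nil; rewrite big_nil; exact: der1_cst.
by under eq_fun do rewrite big_cons; rewrite big_cons; exact: der1D.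
Qed.

Lemma has_deriv_dot {R : realType} m (u v : R -> 'rV[R]_m) (du dv : 'rV[R]_m) (x : R) :
  (forall i, has_deriv (fun y => u y 0 i) x (du 0 i)) ->
  (forall i, has_deriv (fun y => v y 0 i) x (dv 0 i)) ->
  has_deriv (fun y => dot (u y) (v y)) x (dot du (v x) + dot (u x) dv).
Proof.
move=> hu hv; under eq_fun do rewrite dotE.
rewrite !dotE -big_split/=; apply: has_deriv_sum => i.
by apply: der1_eq (der1M (hu i) (hv i)) _; ring.
Qed.

(** Makes the bracket a polynomial in the coordinates, from which its continuity along a curve
    follows. *)
Lemma br_coord {R : realType} {mv mz : nat} (h : htype R mv mz) X U k :
  ht_br h X U 0 k =
  \sum_i \sum_j X 0 i * U 0 j * ht_br h (delta_mx 0 i) (delta_mx 0 j) 0 k.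
Proof.
pose P k (u : 'rV[R]_mz) (s : R) := u 0 k = s.
rewrite {1}[X]row_sum_delta; apply: (big_rec2 (fun Y s => ht_br h Y U 0 k = s)).
  by rewrite br0l mxE.
move=> i s Y _ <-; rewrite brDl brZl !mxE; congr (_ + _).
rewrite {1}[U]row_sum_delta.
transitivity (X 0 i * \sum_j U 0 j * ht_br h (delta_mx 0 i) (delta_mx 0 j) 0 k); last first.
  by rewrite mulr_sumr; apply: eq_bigr => j _; rewrite mulrA.
congr (_ * _).
apply: (big_rec2 (fun V s => ht_br h (delta_mx 0 i) V 0 k = s)); first by rewrite br0r mxE.
by move=> j s' V _ <-; rewrite brDr brZr !mxE.
Qed.

(** * The distance to the identity *)

Section Distance.
Context {R : realType} {mv mz : nat} (h : htype R mv mz).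
Local Notation br := (ht_br h).
Local Notation J := (ht_J h).
Local Notation n := (mv + mz + 1)%N.
Local Notation pt := 'rV[R]_n.
Implicit Types (X U : 'rV[R]_mv) (Z W : 'rV[R]_mz) (a b : R) (p q u v : pt).

Definition dr_b p : R := 1 + apart p + dot (vpart p) (vpart p) / 4.

(* the square of cosh (d / 2), where d is the distance to the identity *)
Definition dr_c p : R :=
  (dr_b p ^+ 2 + dot (zpart p) (zpart p)) / (4 * apart p).

Definition dr_dc p u : R :=
  (2 * dr_b p * (apart u + dot (vpart p) (vpart u) / 2)
    + 2 * dot (zpart p) (zpart u)) / (4 * apart p) - dr_c p * apart u / apart p.

(** The gradient of [dr_c] in the left-invariant orthonormal frame; [dr_dc] is the differential of
    [dr_c] in the chart. *)
Definition dr_grad p : pt :=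
  mkpt ((4 * Num.sqrt (apart p))^-1 *: (dr_b p *: vpart p + J (zpart p) (vpart p)))
       (2^-1 *: zpart p) (dr_b p / 2 - dr_c p).

Definition dr_speed p u : R := Num.sqrt (dr_metric h p u u).

Lemma dr_c_ge1 p : dr_set p -> 1 <= dr_c p.
Proof.
rewrite /dr_set/= => a0; rewrite /dr_c ler_pdivlMr ?mulr_gt0// mul1r /dr_b.
have := dot_ge0 (zpart p); have := dot_ge0 (vpart p).
set x := dot _ _; set z := dot _ _; set a := apart p in a0 * => x0 z0.
have -> : (1 + a + x / 4) ^+ 2 + z = 4 * a + ((1 - a) ^+ 2 + (x / 4) * (2 * (1 + a) + x / 4) + z) by field.
rewrite lerDl !addr_ge0 ?sqr_ge0// mulr_ge0//; first by rewrite divr_ge0.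
by rewrite addr_ge0 ?divr_ge0// mulr_ge0// addr_ge0// ltW.
Qed.

Lemma dr_dcE p u : dr_set p -> dr_dc p u = dot (dr_grad p) (dr_frame h p u).
Proof.
rewrite /dr_set/= => a0.
rewrite /dr_grad /dr_frame dot_mkpt !(dotZl, dotZr, dotDl, dotDr, dotNr) ht_J_adj.
rewrite (dotC (br _ _)) /dr_dc.
have s0 : Num.sqrt (apart p) != 0 by rewrite gt_eqF// sqrtr_gt0.
have := sqr_sqrtr (ltW a0); move: (Num.sqrt _) s0 => s s0 <-.
by field.
Qed.

(** The eikonal equation: for c = cosh^2 (d/2) it reads |grad d| = 1. The H-type condition enters
    through |J_Z X| = |Z| |X| and the orthogonality of J_Z X and X. *)
Lemma dot_dr_grad p : dr_set p ->
  dot (dr_grad p) (dr_grad p) = dr_c p * (dr_c p - 1).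
Proof.
rewrite /dr_set/= => a0.
rewrite /dr_grad dot_mkpt !(dotZl, dotZr, dotDl, dotDr, dotNr) (dotC (vpart p) (J _ _)).
rewrite J_orth J_norm /dr_c /dr_b.
have s0 : Num.sqrt (apart p) != 0 by rewrite gt_eqF// sqrtr_gt0.
have := sqr_sqrtr (ltW a0); move: (Num.sqrt _) s0 => s s0 <-.
by field.
Qed.

Lemma dr_dc_le p u : dr_set p ->
  `|dr_dc p u| <= Num.sqrt (dr_c p * (dr_c p - 1)) * dr_speed p u.
Proof.
move=> Sp; rewrite /dr_speed dr_metricE// -sqrtrM; last first.
  by rewrite -dot_dr_grad// dot_ge0.
rewrite -sqrtr_sqr ler_sqrt ?dr_dcE//; last first.
  by rewrite mulr_ge0 ?dot_ge0// -dot_dr_grad// dot_ge0.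
by rewrite -dot_dr_grad// cauchy_schwarz.
Qed.

Section Curve.
Variables (g : R -> pt).
Hypotheses (dg : forall t, derivable g t 1) (cg : continuous (derive1 g)).

Lemma has_deriv_coord t k : has_deriv (fun s => g s 0 k) t (derive1 g t 0 k).
Proof.
rewrite derive1E derive_mx ?mxE//.
by apply: derivableP; move: (@dg t) => /derivable_mxP; exact.
Qed.

Lemma cont_coord k t : continuous_at t (fun s => g s 0 k).
Proof. exact: der1_continuous (has_deriv_coord t k). Qed.

Lemma cont_deriv_coord k t : continuous_at t (fun s => derive1 g s 0 k).
Proof.
apply: (continuous_comp (g := fun M : pt => M 0 k)); first exact: cg.
exact: coord_continuous.
Qed.

Let apartE p : apart p = p 0 (rshift _ ord0).
Proof. by rewrite /apart mxE. Qed.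

Let vpartE p i : vpart p 0 i = p 0 (lshift 1 (lshift mz i)).
Proof. by rewrite /vpart !mxE. Qed.

Let zpartE p i : zpart p 0 i = p 0 (lshift 1 (rshift mv i)).
Proof. by rewrite /zpart !mxE. Qed.

Lemma has_deriv_dr_c t : dr_set (g t) ->
  has_deriv (fun s => dr_c (g s)) t (dr_dc (g t) (derive1 g t)).
Proof.
move=> Sg; have da : has_deriv (fun s => apart (g s)) t (apart (derive1 g t)).
  by under eq_fun do rewrite apartE; rewrite apartE; exact: has_deriv_coord.
have dv : has_deriv (fun s => dot (vpart (g s)) (vpart (g s))) t
    (dot (vpart (derive1 g t)) (vpart (g t)) + dot (vpart (g t)) (vpart (derive1 g t))).
  by apply: has_deriv_dot => i; under eq_fun do rewrite vpartE; rewrite vpartE; exact: has_deriv_coord.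
have dz : has_deriv (fun s => dot (zpart (g s)) (zpart (g s))) t
    (dot (zpart (derive1 g t)) (zpart (g t)) + dot (zpart (g t)) (zpart (derive1 g t))).
  by apply: has_deriv_dot => i; under eq_fun do rewrite zpartE; rewrite zpartE; exact: has_deriv_coord.
have a0 : apart (g t) != 0 by rewrite gt_eqF.
rewrite /dr_c /dr_b; eapply der1_eq.
  derive_rules; first by rewrite mulf_neq0.
rewrite /= /dr_dc /dr_c /dr_b (dotC (vpart (derive1 g t))) (dotC (zpart (derive1 g t))).
by field.
Qed.

Lemma cont_dr_speed t : dr_set (g t) ->
  continuous_at t (fun s => dr_speed (g s) (derive1 g s)).
Proof.
move=> Sg.
have ca : continuous_at t (fun s => apart (g s)).
  by under eq_fun do rewrite apartE; exact: cont_coord.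
have ca' : continuous_at t (fun s => apart (derive1 g s)).
  by under eq_fun do rewrite apartE; exact: cont_deriv_coord.
have cv i : continuous_at t (fun s => vpart (g s) 0 i).
  by under eq_fun do rewrite vpartE; exact: cont_coord.
have cv' i : continuous_at t (fun s => vpart (derive1 g s) 0 i).
  by under eq_fun do rewrite vpartE; exact: cont_deriv_coord.
have cz' i : continuous_at t (fun s => zpart (derive1 g s) 0 i).
  by under eq_fun do rewrite zpartE; exact: cont_deriv_coord.
have a0 : apart (g t) != 0 by rewrite gt_eqF.
have cai : continuous_at t (fun s => (apart (g s))^-1) by exact: contV.
have cs : continuous_at t (fun s => (Num.sqrt (apart (g s)))^-1).
  by apply: contV; [rewrite gt_eqF ?sqrtr_gt0|exact: cont_sqrt].
pose W s := zpart (derive1 g s) - 2^-1 *: br (vpart (g s)) (vpart (derive1 g s)).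
have cW i : continuous_at t (fun s => W s 0 i).
  have -> : (fun s => W s 0 i) = (fun s => zpart (derive1 g s) 0 i - 2^-1 *
      \sum_k \sum_l vpart (g s) 0 k * vpart (derive1 g s) 0 l *
        br (delta_mx 0 k) (delta_mx 0 l) 0 i).
    by apply/funext => s; rewrite -br_coord /W !mxE.
  apply: contD; first exact: cz'.
  apply: contN; apply: contM; first exact: cont_cst.
  apply: cont_sum => k; apply: cont_sum => l; apply: contM; last exact: cont_cst.
  by apply: contM; [exact: cv|exact: cv'].
pose N s := (apart (g s))^-1 * dot (vpart (derive1 g s)) (vpart (derive1 g s)) +
  ((apart (g s))^-1) ^+ 2 * dot (W s) (W s) + ((apart (g s))^-1 * apart (derive1 g s)) ^+ 2.
apply: cont_sqrt.
(* [dr_metric] has its explicit form where a > 0, hence the passage to a neighbourhood of t. *)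
have SN : \forall s \near t, N s = dr_metric h (g s) (derive1 g s) (derive1 g s).
  have : \forall s \near t, 0 < apart (g s).
    by apply: (cvgr_gt _ ca).
  apply: filterS => s Ss; rewrite dr_metricE// /dr_frame dot_mkpt.
  rewrite !dotZl !dotZr -/(W s) /N mulrA -invfM -expr2 sqr_sqrtr ?ltW//.
  by rewrite mulrA -expr2.
have : continuous_at t N.
  apply: contD; last by apply: contX; exact: contM.
  by apply: contD; apply: contM => //; [exact: cont_dot|exact: contX|exact: cont_dot].
rewrite /continuous_at -(nbhs_singleton SN).
by apply: cvg_trans; apply: near_eq_cvg.
Qed.

End Curve.

End Distance.

(** * The fundamental theorem of calculus, with inequalities *)

Section FundamentalTheorem.
Context {R : realType}.
Local Notation mu := (@lebesgue_measure R).
Implicit Types (F f s : R -> R) (a b : R).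

Lemma within_continuous_at f a b : (forall t, a <= t <= b -> continuous_at t f) ->
  {within `[a, b], continuous f}.
Proof.
by move=> cf; apply: continuous_in_subspaceT => t; rewrite inE/= in_itv/= => /cf.
Qed.

Lemma integrable_itv f a b : (forall t, a <= t <= b -> continuous_at t f) ->
  mu.-integrable `[a, b] (EFin \o f).
Proof.
move=> cf; apply: continuous_compact_integrable; first exact: segment_compact.
exact: within_continuous_at.
Qed.

(** F minus the primitive of [s] is nonincreasing. This form bounds an increment by the length of a
    curve, and later the volume of a ball by an increment of A. *)
Lemma le_Rintegral_derive F f s a b : a < b ->
  (forall t, a <= t <= b -> has_deriv F t (f t)) ->
  (forall t, a <= t <= b -> f t <= s t) ->
  (forall t, a <= t <= b -> continuous_at t s) ->
  F b - F a <= \int[mu]_(t in `[a, b]) s t.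
Proof.
move=> ab dF fs cs; have is_ := integrable_itv cs.
pose S x : R := \int[mu]_(t in `[a, x]) s t.
pose D x := F x - S x.
have dS x : x \in `]a, b[ -> has_deriv S x (s x).
  rewrite in_itv/= => /andP[ax xb].
  have cx : continuous_at x s by apply: cs; rewrite !ltW.
  have [d1 d2] := continuous_FTC1_closed xb is_ ax cx.
  by split; [exact: d1|rewrite -d2 derive1E].
have dD x : x \in `]a, b[ -> has_deriv D x (f x - s x).
  move=> xab; apply: der1D; last by apply: der1N; exact: dS.
  by apply: dF; move: xab; rewrite in_itv/= => /andP[/ltW -> /ltW ->].
have : D b <= D a.
  apply: (@ler0_derive1_le_cc R D a b).
  - by move=> x /dD [].
  - move=> x xab; rewrite derive1E; have [_ ->] := dD x xab; rewrite subr_le0.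
    by apply: fs; move: xab; rewrite in_itv/= => /andP[/ltW -> /ltW ->].
  - have cF : {within `[a, b], continuous F}.
      by apply: within_continuous_at => t /dF/der1_continuous.
    have cS : {within `[a, b], continuous S}.
      exact: parameterized_integral_continuous (ltW ab) is_.
    by move=> x; apply: continuousB; [exact: cF|exact: cS].
  - by rewrite in_itv/= lexx ltW.
  - by rewrite in_itv/= lexx ltW.
  - exact: ltW.
rewrite /D lerBlDr -lerBlDl opprB addrA lerBlDr => h.
have Sa : S a = 0 by rewrite /S set_itv1 Rintegral_set1.
by rewrite -/(S b); move: h; rewrite Sa; lra.
Qed.

Lemma Rintegral_derive F f a b : a < b ->
  (forall t, a <= t <= b -> has_deriv F t (f t)) ->
  (forall t, a <= t <= b -> continuous_at t f) ->
  \int[mu]_(t in `[a, b]) f t = F b - F a.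
Proof.
move=> ab dF cf; apply/eqP; rewrite eq_le (le_Rintegral_derive ab dF)// andbT.
have := @le_Rintegral_derive (fun t => - F t) (fun t => - f t) (fun t => - f t) a b ab.
move=> /(_ (fun t tab => der1N (dF t tab)) (fun=> fun=> lexx _) (fun t tab => contN (cf t tab))).
under [X in _ <= X]eq_Rintegral do rewrite -mulN1r.
rewrite RintegralZl//; last exact: integrable_itv.
by rewrite mulN1r; lra.
Qed.

End FundamentalTheorem.

(** With [e = 0] this differentiates arcosh away from 1; a positive [e] regularizes it at 1. *)
Lemma has_deriv_ln_sqrt {R : realType} (C : R -> R) dC t e : has_deriv C t dC ->
  0 < C t -> 0 < C t ^+ 2 - 1 + e ->
  has_deriv (fun t => ln (C t + Num.sqrt (C t ^+ 2 - 1 + e))) t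
    ((Num.sqrt (C t ^+ 2 - 1 + e))^-1 * dC).
Proof.
move=> dCt C0 Ce; have s0 : 0 < Num.sqrt (C t ^+ 2 - 1 + e) by rewrite sqrtr_gt0.
eapply der1_eq; first by derive_rules => //=; exact: addr_gt0.
by rewrite /=; field; rewrite !gt_eqF ?addr_gt0.
Qed.

(** * Lower bound for the length of curves from the identity *)

Section DistanceLower.
Context {R : realType} {mv mz : nat} (h : htype R mv mz).
Local Notation n := (mv + mz + 1)%N.
Local Notation pt := 'rV[R]_n.
Implicit Types (p q u v : pt).

Definition arcosh (c : R) : R := ln (c + Num.sqrt (c ^+ 2 - 1)).

(** From cosh d = 2 cosh^2 (d/2) - 1. *)
Definition dr_r p : R := arcosh (2 * dr_c p - 1).

Lemma dr_c_e : dr_c (dr_e : pt) = 1.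
Proof.
rewrite /dr_c /dr_b /dr_e !(vpart_mkpt, zpart_mkpt, apart_mkpt) !dot0l.
by field.
Qed.

Lemma dr_r_le_length g p : dr_curve dr_e p g -> dr_r p <= dr_length h g.
Proof.
move=> [dg cg Sg g0 g1]; apply/ler_addgt0Pr => e e0.
(* arcosh is not differentiable at 1, which is the value of C at the identity: it is regularized
   by e ^+ 2 under the square root. *)
pose C t := 2 * dr_c (g t) - 1.
pose F t := ln (C t + Num.sqrt (C t ^+ 2 - 1 + e ^+ 2)).
have C1 t : 0 <= t <= 1 -> 1 <= C t.
  by move=> /Sg/dr_c_ge1 ?; rewrite /C; lra.
have e2 : 0 < e ^+ 2 by rewrite exprn_gt0.
have Cpos t : 0 <= t <= 1 -> 0 < C t ^+ 2 - 1 + e ^+ 2.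
  by move=> /C1 c1; rewrite ltr_wpDl// subr_ge0 -[leLHS](expr1n _ 2) lerXn2r// ?nnegrE; lra.
have dC t : 0 <= t <= 1 -> has_deriv C t (2 * dr_dc (g t) (derive1 g t)).
  move=> /Sg St; have d := has_deriv_dr_c dg St.
  by apply: der1_eq (der1D (der1M (der1_cst t 2) d) (der1_cst t (-1))) _; ring.
have key : F 1 - F 0 <= dr_length h g.
  pose f t := (Num.sqrt (C t ^+ 2 - 1 + e ^+ 2))^-1 * (2 * dr_dc (g t) (derive1 g t)).
  pose s t := dr_speed h (g t) (derive1 g t).
  have -> : dr_length h g = \int[lebesgue_measure]_(t in `[0, 1]) s t by [].
  apply: (@le_Rintegral_derive _ F f s 0 1); rewrite /f /s.
  - exact: ltr01.
  - move=> t t01; have c1 := C1 t t01; apply: has_deriv_ln_sqrt (dC t t01) _ (Cpos t t01).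
    by lra.
  - move=> t t01; have Cp := Cpos t t01; have c1 := C1 t t01.
    rewrite ler_pdivrMl ?sqrtr_gt0//.
    (* Since (2 c - 1)^2 - 1 = 4 c (c - 1), the eikonal bound for the derivative of c cancels
       against the denominator, which the regularization only enlarges. *)
    apply: le_trans (_ : 2 * (Num.sqrt (dr_c (g t) * (dr_c (g t) - 1)) * dr_speed h (g t) (derive1 g t)) <= _).
      by rewrite ler_pM2l// (le_trans (ler_norm _))// dr_dc_le//; exact: Sg.
    rewrite mulrA ler_wpM2r ?sqrtr_ge0//.
    have E2 : Num.sqrt (2 ^+ 2) = 2 :> R by rewrite sqrtr_sqr ger0_norm.
    rewrite -{1}E2 -sqrtrM ?sqr_ge0//.
    rewrite ler_sqrt//; last exact: ltW.
    by rewrite /C; move: (dr_c (g t)) => c; nra.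
  - by move=> t t01; apply: cont_dr_speed => //; exact: Sg.
have F0 : F 0 <= e.
  rewrite /F /C g0 dr_c_e mulr1 (_ : 2 - 1 = 1)//; last by ring.
  rewrite expr1n subrr add0r sqrtr_sqr gtr0_norm//.
  by rewrite -[leRHS]expRK ler_ln ?posrE ?expR_gt0 ?addr_gt0// expR_ge1Dx.
have F1 : dr_r p <= F 1.
  have c1 : 1 <= C 1 by apply: C1; rewrite ler01 lexx.
  have Cp : 0 < C 1 ^+ 2 - 1 + e ^+ 2 by apply: Cpos; rewrite ler01 lexx.
  rewrite /F /dr_r /arcosh -g1 -/(C 1).
  have p0 x : 0 < C 1 + Num.sqrt x by rewrite ltr_pwDl ?sqrtr_ge0// (lt_le_trans ltr01).
  rewrite ler_ln ?posrE//.
  by rewrite lerD2l ler_sqrt ?(ltW Cp)// lerDl ltW.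
apply: le_trans F1 _; rewrite -lerBlDr; apply: le_trans key.
by rewrite lerB.
Qed.

End DistanceLower.

Section GeodesicCoefficients.
Context {R : realType} (B z x : R).
Implicit Types t : R.

(* In the ball model, the image of N A under the Cayley transform, the geodesics through the
   origin are straight segments.  Transporting the segment {t y : 0 <= t <= 1} back to N A gives
   the curve (geo_a X + geo_b J_Z X, geo_c Z, geo_d), where B = dr_b, z = |Z|^2, x = |X|^2 and
   the complex number geo_re + i (1 - t) |Z| has squared modulus geo_den. *)
Definition geo_re t : R := (1 - t) * (B - 1) + (1 + t).
Definition geo_den t : R := geo_re t ^+ 2 + (1 - t) ^+ 2 * z.
Definition geo_num t : R :=
  (1 - t ^+ 2) * (B ^+ 2 + z) + 4 * (B - 1 - x / 4) * t ^+ 2.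

Definition geo_a t : R := 2 * t * geo_re t / geo_den t.
Definition geo_b t : R := - (2 * t * (1 - t)) / geo_den t.
Definition geo_c t : R := 4 * t / geo_den t.
Definition geo_d t : R := geo_num t / geo_den t.

Definition geo_da t : R :=
  2 * (B * (geo_re t ^+ 2 - z * (1 - t) ^+ 2) + 2 * z * geo_re t * (1 - t)) / geo_den t ^+ 2.
Definition geo_db t : R :=
  2 * (geo_re t ^+ 2 - z * (1 - t) ^+ 2 - 2 * B * geo_re t * (1 - t)) / geo_den t ^+ 2.
Definition geo_dden t : R := 2 * geo_re t * (2 - B) - 2 * (1 - t) * z.
Definition geo_dc t : R := 4 * (geo_den t - t * geo_dden t) / geo_den t ^+ 2.
Definition geo_dd t : R :=
  ((8 * (B - 1 - x / 4) * t - 2 * t * (B ^+ 2 + z)) * geo_den t - geo_num t * geo_dden t)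
  / geo_den t ^+ 2.

(** The summands on the left are the squared components along v, z and A in the left-invariant
    frame. With B - 1 - x/4 = a and E = B^2 + z, the right side is (2 k / (1 - k^2 t^2))^2 for k^2 =
    1 - 4 a / E, the squared speed of a segment in the ball model. *)
Lemma geo_speed t : geo_den t != 0 -> geo_num t != 0 ->
  (geo_da t ^+ 2 + geo_db t ^+ 2 * z) * x / geo_d t
  + (geo_dc t - (geo_a t * geo_db t - geo_b t * geo_da t) * x / 2) ^+ 2 * z / geo_d t ^+ 2
  + (geo_dd t / geo_d t) ^+ 2
  = 4 * (B ^+ 2 + z) * (B ^+ 2 + z - 4 * (B - 1 - x / 4)) / geo_num t ^+ 2.
Proof.
rewrite /geo_a /geo_b /geo_d /geo_da /geo_db /geo_dc /geo_dd /geo_dden /geo_num /geo_den /geo_re.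
move=> d0 n0; field; rewrite d0 andbT.
by rewrite (_ : _ + _ = (1 - t ^+ 2) * (B ^+ 2 + z) + 4 * (B - 1 - x / 4) * t ^+ 2)//; field.
Qed.

Lemma has_deriv_geo t : geo_den t != 0 ->
  [/\ has_deriv geo_a t (geo_da t), has_deriv geo_b t (geo_db t),
      has_deriv geo_c t (geo_dc t) & has_deriv geo_d t (geo_dd t)].
Proof.
rewrite /geo_a /geo_b /geo_c /geo_d /geo_da /geo_db /geo_dc /geo_dd /geo_dden /geo_num /geo_den /geo_re.
by move=> d0; split; (eapply der1_eq; [derive_rules => //|rewrite /=; field]).
Qed.

End GeodesicCoefficients.

Ltac cont_rules :=
  lazymatch goal with
  | |- continuous_at _ (fun _ => ?c) => exact: cont_cst
  | |- continuous_at _ (fun y => @?f y + @?g y) => apply: (@contD _ _ f g); cont_rules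
  | |- continuous_at _ (fun y => - @?f y) => apply: (@contN _ _ f); cont_rules
  | |- continuous_at _ (fun y => @?f y * @?g y) => apply: (@contM _ _ f g); cont_rules
  | |- continuous_at _ (fun y => @?f y ^+ _) => apply: (@contX _ _ f); cont_rules
  | |- continuous_at _ (fun y => (@?f y)^-1) => apply: (@contV _ _ f); cont_rules
  | |- continuous_at _ _ => try eassumption
  | |- _ => idtac
  end.

(** * A curve that attains the lower bound *)

Section DistanceUpper.
Context {R : realType} {mv mz : nat} (h : htype R mv mz).
Local Notation J := (ht_J h).
Local Notation n := (mv + mz + 1)%N.
Local Notation pt := 'rV[R]_n.
Variable p : pt.
Hypothesis Sp : dr_set p.

Let X := vpart p.
Let Z := zpart p.
Let a := apart p.
Let x := dot X X.
Let z := dot Z Z.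
Let B := dr_b p.
Let E := B ^+ 2 + z.
(** [k] is tanh (d/2), because E / (4 a) = cosh^2 (d/2); in the ball model it is the norm of the
    endpoint of the segment. *)
Let k := Num.sqrt ((E - 4 * a) / E).

Let a_gt0 : 0 < a. Proof. exact: Sp. Qed.
Let x_ge0 : 0 <= x. Proof. exact: dot_ge0. Qed.
Let z_ge0 : 0 <= z. Proof. exact: dot_ge0. Qed.
Let aE : B - 1 - x / 4 = a. Proof. by rewrite /B /dr_b -/a -/x; ring. Qed.
Let B_gt1 : 1 < B.
Proof. by have := a_gt0; have := x_ge0; move: aE; lra. Qed.
Let E_gt0 : 0 < E.
Proof. by have := B_gt1; have := z_ge0; rewrite /E; nra. Qed.
Let cE : dr_c p = E / (4 * a). Proof. by []. Qed.
Let E_ge : 4 * a <= E.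
Proof. by have := dr_c_ge1 Sp; rewrite cE ler_pdivlMr ?mulr_gt0// mul1r. Qed.

Let k_ge0 : 0 <= k. Proof. exact: sqrtr_ge0. Qed.
Let k_sqr : k ^+ 2 = (E - 4 * a) / E.
Proof. by rewrite sqr_sqrtr// divr_ge0 ?subr_ge0// ltW. Qed.
Let k_lt1 : k < 1.
Proof.
have : k ^+ 2 < 1.
  by rewrite k_sqr ltr_pdivrMr// mul1r ltrBlDr ltrDl mulr_gt0.
by rewrite expr_lt1.
Qed.

(* [dr_curve] requires a curve differentiable on the whole line; tau stays in [0, 1]. *)
Let tau (t : R) := (1 - cos (pi * t)) / 2.
Let dtau (t : R) := pi * sin (pi * t) / 2.

Let tau01 t : 0 <= tau t <= 1.
Proof.
by rewrite /tau; have := cos_le1 (pi * t); have := cos_geN1 (pi * t); lra.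
Qed.

Let tau_lt t : 0 <= k * tau t < 1.
Proof.
have /andP[t0 t1] := tau01 t; rewrite mulr_ge0//=.
by rewrite (le_lt_trans _ k_lt1)// ler_piMr.
Qed.

Let dtau_ge0 t : 0 <= t <= 1 -> 0 <= dtau t.
Proof.
move=> /andP[t0 t1]; rewrite /dtau divr_ge0// mulr_ge0 ?pi_ge0// sin_ge0_pi//.
by rewrite mulr_ge0 ?pi_ge0//= ler_piMr ?pi_ge0.
Qed.

Let has_deriv_tau t : has_deriv tau t (dtau t).
Proof.
by rewrite /tau /dtau; eapply der1_eq; [derive_rules|rewrite /=; field].
Qed.

Let cont_tau t : continuous_at t tau.
Proof. exact: der1_continuous (has_deriv_tau t). Qed.

Let cont_dtau t : continuous_at t dtau.
Proof.
have cs : continuous_at t (fun s => sin (pi * s)).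
  apply: cont_comp; first exact: continuous_sin.
  by apply: contM; [exact: cont_cst|exact: cvg_id].
by rewrite /dtau; cont_rules.
Qed.

Let den_gt0 s : 0 <= s <= 1 -> 0 < geo_den B z s.
Proof.
move=> s01; have r0 : 0 < geo_re B s by rewrite /geo_re; have := B_gt1; nra.
by rewrite /geo_den ltr_wpDr ?exprn_gt0// mulr_ge0// sqr_ge0.
Qed.

Let num_gt0 s : 0 <= s <= 1 -> 0 < geo_num B z x s.
Proof.
move=> /andP[s0 s1]; rewrite /geo_num aE -/E.
rewrite (_ : _ + _ = 4 * a + (1 - s ^+ 2) * (E - 4 * a)); last by ring.
by rewrite ltr_pwDl ?mulr_gt0// mulr_ge0 ?subr_ge0 ?expr_le1.
Qed.

Let g t : pt :=
  mkpt (geo_a B z (tau t) *: X + geo_b B z (tau t) *: J Z X)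
       (geo_c B z (tau t) *: Z) (geo_d B z x (tau t)).

Let dg t : pt :=
  mkpt ((dtau t * geo_da B z (tau t)) *: X + (dtau t * geo_db B z (tau t)) *: J Z X)
       ((dtau t * geo_dc B z (tau t)) *: Z) (dtau t * geo_dd B z x (tau t)).

Let decomp (c1 c2 c3 c4 : R) : mkpt (c1 *: X + c2 *: J Z X) (c3 *: Z) c4 =
  c1 *: mkpt X 0 0 + c2 *: mkpt (J Z X) 0 0 + c3 *: mkpt 0 Z 0 + c4 *: mkpt 0 0 1 :> pt.
Proof. by rewrite !mkptZ !mkptD !scaler0 !mulr0 mulr1 !addr0 !add0r. Qed.

Let g_derivative t : derivable g t 1 /\ derive1 g t = dg t.
Proof.
have [da db dc dd] := @has_deriv_geo _ B z x (tau t) (lt0r_neq0 (den_gt0 (tau01 t))).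
have D f df : has_deriv f (tau t) df -> has_deriv (fun s => f (tau s)) t (dtau t * df).
  by move=> hf; apply: der1_eq (der1_comp hf (has_deriv_tau t)) _; rewrite mulrC.
have dgk i : has_deriv (fun s => g s 0 i) t (dg t 0 i).
  have -> : (fun s => g s 0 i) = (fun s => geo_a B z (tau s) * (mkpt X 0 0 : pt) 0 i +
     geo_b B z (tau s) * (mkpt (J Z X) 0 0 : pt) 0 i + geo_c B z (tau s) * (mkpt 0 Z 0 : pt) 0 i +
     geo_d B z x (tau s) * (mkpt 0 0 1 : pt) 0 i).
    by apply/funext => s; rewrite /g decomp !mxE.
  have -> : dg t 0 i = dtau t * geo_da B z (tau t) * (mkpt X 0 0 : pt) 0 i +
     dtau t * geo_db B z (tau t) * (mkpt (J Z X) 0 0 : pt) 0 i +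
     dtau t * geo_dc B z (tau t) * (mkpt 0 Z 0 : pt) 0 i +
     dtau t * geo_dd B z x (tau t) * (mkpt 0 0 1 : pt) 0 i.
    by rewrite /dg decomp !mxE.
  have M f df c : has_deriv f t df -> has_deriv (fun s => f s * c) t (df * c).
    by move=> hf; apply: der1_eq (der1M hf (der1_cst t c)) _; rewrite mulr0 add0r mulrC.
  by do 3?[apply: der1D]; apply: M; exact: D.
have dgt : derivable g t 1.
  by apply/derivable_mxP => i j; rewrite ord1; have [] := dgk j.
split=> //; rewrite derive1E derive_mx//; apply/rowP => i; rewrite mxE.
by have [_ ->] := dgk i.
Qed.

Let cont_dg : continuous dg.
Proof.
move=> t; have d0 : geo_den B z (tau t) != 0 by rewrite gt_eqF ?den_gt0.
have cr : continuous_at t (fun s => geo_re B (tau s)).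
  by have := @cont_tau t; rewrite /geo_re => ct; cont_rules.
have cd : continuous_at t (fun s => geo_den B z (tau s)).
  by have := @cont_tau t; rewrite /geo_den => ct; cont_rules.
have cd2 : continuous_at t (fun s => (geo_den B z (tau s) ^+ 2)^-1).
  by apply: contV; [rewrite expf_neq0|exact: contX].
have cdd : continuous_at t (fun s => geo_dden B z (tau s)).
  by have := @cont_tau t; rewrite /geo_dden => ct; cont_rules.
have cn : continuous_at t (fun s => geo_num B z x (tau s)).
  by have := @cont_tau t; rewrite /geo_num => ct; cont_rules.
have ct := @cont_tau t; have cdt := @cont_dtau t.
have -> : dg = (fun t => (dtau t * geo_da B z (tau t)) *: mkpt X 0 0
   + (dtau t * geo_db B z (tau t)) *: mkpt (J Z X) 0 0
   + (dtau t * geo_dc B z (tau t)) *: mkpt 0 Z 0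
   + (dtau t * geo_dd B z x (tau t)) *: mkpt 0 0 1).
  by apply/funext => s; rewrite /dg decomp.
have cZ (f : R -> R) (v : pt) : continuous_at t f -> (fun s => f s *: v) @ t --> f t *: v.
  by move=> cf; apply: cvgZ => //; exact: cvg_cst.
have ca (r T i : R -> R) : continuous_at t r -> continuous_at t T -> continuous_at t i ->
    continuous_at t (fun s => 2 * (B * (r s ^+ 2 - z * (1 - T s) ^+ 2)
      + 2 * z * r s * (1 - T s)) * i s) by move=> *; cont_rules.
have cb (r T i : R -> R) : continuous_at t r -> continuous_at t T -> continuous_at t i ->
    continuous_at t (fun s => 2 * (r s ^+ 2 - z * (1 - T s) ^+ 2
      - 2 * B * r s * (1 - T s)) * i s) by move=> *; cont_rules.
have cc (d d1 T i : R -> R) : continuous_at t d -> continuous_at t d1 -> continuous_at t T ->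
    continuous_at t i -> continuous_at t (fun s => 4 * (d s - T s * d1 s) * i s).
  by move=> *; cont_rules.
have ce (d d1 e T i : R -> R) : continuous_at t d -> continuous_at t d1 -> continuous_at t e ->
    continuous_at t T -> continuous_at t i ->
    continuous_at t (fun s => ((8 * (B - 1 - x / 4) * T s - 2 * T s * (B ^+ 2 + z)) * d s
      - e s * d1 s) * i s) by move=> *; cont_rules.
apply: cvgD; first apply: cvgD; first apply: cvgD.
- by apply: cZ; apply: contM cdt _; exact: ca cr ct cd2.
- by apply: cZ; apply: contM cdt _; exact: cb cr ct cd2.
- by apply: cZ; apply: contM cdt _; exact: cc cd cdd ct cd2.
- by apply: cZ; apply: contM cdt _; exact: ce cd cdd cn ct cd2.
Qed.

Let Sg t : dr_set (g t).
Proof.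
by rewrite /dr_set/= /g apart_mkpt /geo_d divr_gt0 ?num_gt0 ?den_gt0.
Qed.

Let curve_g : dr_curve dr_e p g.
Proof.
split=> //.
- by move=> t; have [] := g_derivative t.
- have -> : derive1 g = dg by apply/funext => t; have [] := g_derivative t.
  exact: cont_dg.
- have t0 : tau 0 = 0 by rewrite /tau mulr0 cos0 subrr mul0r.
  have -> : g 0 = mkpt (0 *: X + 0 *: J Z X) (0 *: Z) 1.
    rewrite /g t0; congr (mkpt (_ *: _ + _ *: _) (_ *: _) _).
    - by rewrite /geo_a mulr0 !mul0r.
    - by rewrite /geo_b mulr0 !mul0r oppr0 mul0r.
    - by rewrite /geo_c mulr0 mul0r.
    - rewrite /geo_d (_ : geo_num B z x 0 = E); last by rewrite /geo_num /E; ring.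
      rewrite (_ : geo_den B z 0 = E); last by rewrite /geo_den /geo_re /E; ring.
      by rewrite divff ?gt_eqF.
  by rewrite !scale0r addr0.
- have t1 : tau 1 = 1 by rewrite /tau mulr1 cospi; field.
  have -> : g 1 = mkpt (1 *: X + 0 *: J Z X) (1 *: Z) a.
    rewrite /g t1; have d4 : geo_den B z 1 = 4 by rewrite /geo_den /geo_re; ring.
    congr (mkpt (_ *: _ + _ *: _) (_ *: _) _).
    - by rewrite /geo_a d4 /geo_re; field.
    - by rewrite /geo_b d4 subrr mulr0 oppr0 mul0r.
    - by rewrite /geo_c d4; field.
    - by rewrite /geo_d d4 /geo_num aE; field.
  by rewrite scale0r addr0 !scale1r mkptK.
Qed.

Let speed_g t : 0 <= t <= 1 ->
  dr_speed h (g t) (derive1 g t) = 2 * k / (1 - k ^+ 2 * tau t ^+ 2) * dtau t.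
Proof.
move=> t01; rewrite (proj2 (g_derivative t)).
have n0 : geo_num B z x (tau t) != 0 by rewrite gt_eqF ?num_gt0.
have d0 : geo_den B z (tau t) != 0 by rewrite gt_eqF ?den_gt0.
have rhs0 : 0 <= 2 * k / (1 - k ^+ 2 * tau t ^+ 2) * dtau t.
  rewrite mulr_ge0 ?dtau_ge0// divr_ge0 ?mulr_ge0// subr_ge0 -exprMn.
  by have /andP[? ?] := tau_lt t; rewrite expr_le1// ltW.
rewrite /dr_speed -[RHS]ger0_norm// -sqrtr_sqr; congr Num.sqrt.
(* [geo_num] equals E (1 - k^2 tau^2). *)
have Eg : (2 * k / (1 - k ^+ 2 * tau t ^+ 2)) ^+ 2 = 4 * E * (E - 4 * a) / geo_num B z x (tau t) ^+ 2.
  rewrite exprMn exprVn exprMn k_sqr.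
  move: n0; rewrite /geo_num aE -/E; move: (tau t) => s n0.
  have E0 : E != 0 by rewrite gt_eqF.
  have n1 : 1 - (E - 4 * a) / E * s ^+ 2 != 0.
    rewrite (_ : 1 - _ = ((1 - s ^+ 2) * E + 4 * a * s ^+ 2) / E); last by field.
    by rewrite mulf_neq0 ?invr_eq0.
  by field; rewrite E0 n0.
rewrite exprMn Eg /E -{1}aE -geo_speed//.
have Sgt := Sg t; rewrite dr_metricE// /dr_frame dot_mkpt.
have ga : apart (g t) = geo_d B z x (tau t) by rewrite /g apart_mkpt.
have gv : vpart (g t) = geo_a B z (tau t) *: X + geo_b B z (tau t) *: J Z X.
  by rewrite /g vpart_mkpt.
rewrite !(dotZl, dotZr) ga gv /dg !(vpart_mkpt, zpart_mkpt, apart_mkpt).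
have d_gt0 : 0 < geo_d B z x (tau t) by move: Sgt; rewrite /dr_set/= ga.
rewrite mulrA -invfM -expr2 sqr_sqrtr ?(ltW d_gt0)//.
(* As [X, J_Z X] = |X|^2 Z, the central component of the velocity remains a multiple of Z. *)
rewrite !(brDl, brDr, brZl, brZr) !ht_br_alt br_J (brC h (J Z X)) br_J.
rewrite -/x !scaler0 !addr0 !add0r.
rewrite !(dotDl, dotDr, dotNl, dotNr, dotZl, dotZr).
rewrite (dotC X (J Z X)) J_orth J_norm -/x -/z.
move: (geo_d B z x (tau t)) d_gt0 => d d_gt0.
field.
by rewrite gt_eqF.
Qed.

Lemma dr_dist_e : dr_dist h dr_e p = dr_r p.
Proof.
(* L is 2 artanh (k tau), a primitive of the speed. *)
pose L t := ln (1 + k * tau t) - ln (1 - k * tau t).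
have lenE : dr_length h g = L 1 - L 0.
  pose f (t : R) : R := 2 * k / (1 - k ^+ 2 * tau t ^+ 2) * dtau t.
  have -> : dr_length h g = \int[lebesgue_measure]_(t in `[0, 1]) f t.
    by apply: eq_Rintegral => t; rewrite inE/= in_itv/=; exact: speed_g.
  have k1 t : 1 - k * tau t != 0 by have /andP[? ?] := tau_lt t; rewrite gt_eqF// subr_gt0.
  have k2 t : 1 + k * tau t != 0 by have /andP[? ?] := tau_lt t; rewrite gt_eqF// ltr_pwDl.
  have k12 t : 1 - k ^+ 2 * tau t ^+ 2 != 0.
    by rewrite (_ : _ - _ = (1 - k * tau t) * (1 + k * tau t)) ?mulf_neq0//; ring.
  apply: (@Rintegral_derive R L f) => // t _.
    have dt := has_deriv_tau t.
    rewrite /L; eapply der1_eq.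
      derive_rules; have /andP[? ?] := tau_lt t; first by rewrite ltr_pwDl.
      by rewrite subr_gt0.
    by rewrite /f /=; field; rewrite k1 k2 exprMn k12.
  have ct := @cont_tau t; have cdt := @cont_dtau t.
  by rewrite /f; cont_rules; exact: k12.
have L0 : L 0 = 0 by rewrite /L /tau mulr0 cos0 subrr mul0r mulr0 addr0 subr0 subrr.
have L1 : L 1 = dr_r p.
  have E0 : E != 0 by rewrite gt_eqF.
  have a0 : a != 0 by rewrite gt_eqF.
  rewrite /L (_ : tau 1 = 1); last by rewrite /tau mulr1 cospi; field.
  (* The claim is (1 + k) / (1 - k) = e^d = cosh d + sinh d, where cosh d = 2 c - 1 and sinh d = 2 c
     k. *)
  rewrite !mulr1 -ln_div ?posrE ?subr_gt0 ?ltr_pwDl// /dr_r /arcosh; congr ln.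
  have -> : (2 * dr_c p - 1) ^+ 2 - 1 = (2 * dr_c p * k) ^+ 2.
    by rewrite exprMn k_sqr cE; field; rewrite E0 a0.
  rewrite sqrtr_sqr ger0_norm; last first.
    by rewrite mulr_ge0 ?k_ge0// mulr_ge0//; apply: le_trans (dr_c_ge1 Sp).
  have k1 : 1 - k != 0 by rewrite gt_eqF// subr_gt0.
  have cK : dr_c p * (1 - k ^+ 2) = 1 by rewrite k_sqr cE; field; rewrite E0 a0.
  apply: (mulIf k1); rewrite mulfVK//.
  have -> : (2 * dr_c p - 1 + 2 * dr_c p * k) * (1 - k) =
    2 * (dr_c p * (1 - k ^+ 2)) - (1 - k) by ring.
  by rewrite cK; ring.
have mem : [set dr_length h c | c in dr_curve dr_e p] (dr_r p).
  by exists g => //; rewrite lenE L0 L1 subr0.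
have lb : lbound [set dr_length h c | c in dr_curve dr_e p] (dr_r p).
  by move=> _ [c cc <-]; exact: dr_r_le_length.
apply/eqP; rewrite eq_le; apply/andP; split.
  by apply: ge_inf => //; exists (dr_r p).
by apply: lb_le_inf => //; exists (dr_r p).
Qed.

End DistanceUpper.

(** * Radial functions *)

Section Arcosh.
Context {R : realType}.
Implicit Types (c s : R).

Lemma arcosh_cosh s : 0 <= s -> arcosh ((expR s + expR (- s)) / 2) = s.
Proof.
move=> s0; rewrite /arcosh; have e0 := expR_gt0 s.
have -> : ((expR s + expR (- s)) / 2) ^+ 2 - 1 = ((expR s - expR (- s)) / 2) ^+ 2.
  by rewrite expRN; field; rewrite gt_eqF.
rewrite sqrtr_sqr ger0_norm; last first.
  by rewrite divr_ge0// subr_ge0 ler_expR; lra.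
rewrite (_ : _ + _ = expR s); last by field.
by rewrite expRK.
Qed.

Lemma has_deriv_arcosh (C : R -> R) dC t : has_deriv C t dC -> 1 < C t ->
  has_deriv (fun t => arcosh (C t)) t ((Num.sqrt (C t ^+ 2 - 1))^-1 * dC).
Proof.
move=> dCt C1; have C2 : 0 < C t ^+ 2 - 1 + 0 by rewrite addr0 subr_gt0 exprn_egt1.
have := has_deriv_ln_sqrt dCt (lt_trans ltr01 C1) C2.
by rewrite addr0; under eq_fun do rewrite addr0.
Qed.

(** Gives second derivatives at a critical point: the first derivative has the form t m(t) there,
    and its slope at 0 is m(0) by continuity of m. *)
Lemma has_deriv_id_mul (m : R -> R) : continuous_at 0 m ->
  has_deriv (fun t => t * m t) 0 (m 0).
Proof.
move=> cm.
have E : (fun t : R => m t) @ (0 : R)^' --> m 0 by apply: cvg_within_filter; exact: cm.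
suff F : (fun t : R => t^-1 *: ((t *: (1 : R) + 0) * m (t *: (1 : R) + 0) - 0 * m 0)) @ (0 : R)^' --> m 0.
  split; first by apply/cvg_ex; exists (m 0).
  exact: cvg_lim F.
apply: cvg_trans E; apply: near_eq_cvg; near=> t.
have t0 : t != 0 by near: t; exact: nbhs_dnbhs_neq.
by rewrite /= mul0r subr0 addr0 /GRing.scale/= mulr1 mulrA mulVf// mul1r.
Unshelve. all: by end_near. Qed.

End Arcosh.

Section RadialLaplacian.
Context {R : realType} {mv mz : nat} (h : htype R mv mz).
Local Notation n := (mv + mz + 1)%N.
Local Notation pt := 'rV[R]_n.
Implicit Types (p v : pt) (s t : R).

(** The subgroup A at unit speed. Negative [s] is included: by [dr_r_axisN] a smooth radial function
    restricts to an even function of [s], smooth across 0. *)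
Definition axis s : pt := mkpt 0 0 (expR s).

Lemma axis_dr_set s : dr_set (axis s).
Proof. by rewrite /dr_set/= apart_mkpt expR_gt0. Qed.

Lemma dr_r_axis s : 0 <= s -> dr_r (axis s) = s.
Proof.
move=> s0; rewrite -[RHS](arcosh_cosh s0); congr arcosh.
rewrite /dr_c /dr_b /axis !(vpart_mkpt, zpart_mkpt, apart_mkpt) !dot0l expRN.
have := expR_gt0 s; move: (expR s) => a a0; field.
by rewrite gt_eqF.
Qed.

Lemma dr_r_axisN s : dr_r (axis (- s)) = dr_r (axis s).
Proof.
congr arcosh.
rewrite /dr_c /dr_b /axis !(vpart_mkpt, zpart_mkpt, apart_mkpt) !dot0l expRN.
have := expR_gt0 s; move: (expR s) => a a0; field.
by rewrite gt_eqF.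
Qed.

Lemma dr_r_ge0 p : dr_set p -> 0 <= dr_r p.
Proof.
move=> /dr_c_ge1 c1; rewrite /dr_r /arcosh ln_ge0//.
by rewrite ler_wpDr ?sqrtr_ge0//; lra.
Qed.

Lemma radialE {T : Type} (f : pt -> T) p : radial h f -> dr_set p ->
  f p = f (axis (dr_r p)).
Proof.
move=> rf Sp; apply: rf => //; first exact: axis_dr_set.
rewrite !dr_dist_e//; last exact: axis_dr_set.
by rewrite dr_r_axis// dr_r_ge0.
Qed.

Lemma profileE {T : Type} (f : pt -> T) s : radial h f -> 0 <= s ->
  profile h f s = f (axis s).
Proof.
move=> rf s0; rewrite /profile.
have ex : [set x | dr_set x /\ dr_dist h dr_e x = s] (axis s).
  by split; [exact: axis_dr_set|rewrite dr_dist_e ?dr_r_axis//; exact: axis_dr_set].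
have [Sx dx] := xgetPex dr_e (ex_intro _ _ ex).
apply: rf => //; first exact: axis_dr_set.
by rewrite dx dr_dist_e ?dr_r_axis//; exact: axis_dr_set.
Qed.

Section Profile.
Variable f : pt -> R.
Hypotheses (rf : radial h f) (sf : smooth_on dr_set f).
Let e_a : pt := mkpt 0 0 1.

Definition prof s := f (axis s).
Definition dprof s := expR s * 'D_e_a f (axis s).
Definition ddprof s := expR s * 'D_e_a f (axis s) + expR s ^+ 2 * 'D_e_a ('D_e_a f) (axis s).

Let has_deriv_line (F : pt -> R) s d : is_derive (axis s) e_a F d ->
  has_deriv (fun t => F (axis t)) s (expR s * d).
Proof.
move=> /is_derive_line dF.
have -> : (fun t => F (axis t)) = (fun t => F ((expR t - expR s) *: e_a + axis s)).
  apply/funext => t; congr F.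
  by rewrite /axis /e_a mkptZ mkptD !scaler0 !addr0 mulr1 subrK.
have dE : has_deriv (fun t => expR t - expR s) s (expR s).
  by eapply der1_eq; [derive_rules|rewrite /=; ring].
apply: der1_eq; first apply: (@der1_comp _ (fun y => F (y *: e_a + axis s)) _ _ d _ _ dE).
  by rewrite subrr.
by rewrite mulrC.
Qed.

Lemma has_deriv_prof s : has_deriv prof s (dprof s).
Proof. exact: has_deriv_line (is_derive_smooth [::] e_a sf (axis_dr_set s)). Qed.

Lemma has_deriv_dprof s : has_deriv dprof s (ddprof s).
Proof.
have d1 : has_deriv (fun t => 'D_e_a f (axis t)) s (expR s * 'D_e_a ('D_e_a f) (axis s)).
  exact: has_deriv_line (is_derive_smooth [:: e_a] e_a sf (axis_dr_set s)).
rewrite /dprof /ddprof; eapply der1_eq; first by apply: (der1M _ d1); derive_rules.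
by rewrite /=; ring.
Qed.

Lemma cont_ddprof s : continuous_at s ddprof.
Proof.
have d1 := has_deriv_line (is_derive_smooth [:: e_a] e_a sf (axis_dr_set s)).
have d2 := has_deriv_line (is_derive_smooth [:: e_a; e_a] e_a sf (axis_dr_set s)).
have c1 : continuous_at s (fun t => 'D_e_a f (axis t)) by exact: der1_continuous d1.
have c2 : continuous_at s (fun t => 'D_e_a ('D_e_a f) (axis t)) by exact: der1_continuous d2.
have ce : continuous_at s (@expR R) by exact: continuous_expR.
by rewrite /ddprof; apply: contD; [exact: contM|apply: contM => //; exact: contX].
Qed.

Lemma prof_even s : prof (- s) = prof s.
Proof.
apply: (rf (axis_dr_set (- s)) (axis_dr_set s)).
rewrite (dr_dist_e h (axis_dr_set (- s))) (dr_dist_e h (axis_dr_set s)).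
exact: dr_r_axisN.
Qed.

Lemma dprof0 : dprof 0 = 0.
Proof.
have d1 := has_deriv_prof 0.
have d2 : has_deriv (fun t => prof (- t)) 0 (- dprof 0).
  have dN : has_deriv (fun t : R => - t) 0 (- 1) by derive_rules.
  apply: der1_eq; first apply: (@der1_comp _ prof _ _ (dprof 0) _ _ dN).
    by rewrite oppr0.
  by rewrite mulrN1.
have d3 : has_deriv prof 0 (- dprof 0).
  by have -> : prof = (fun t => prof (- t)) by apply/funext => t; rewrite prof_even.
have [_ e1] := d1; have [_ e2] := d3.
by move: e2; rewrite e1; lra.
Qed.

(** The line leaves the axis orthogonally: c has derivative t m(t), so the first derivative of r
    vanishes at t = 0 and only f'(r) r''(0) remains. [1 < c t] keeps the line away from the
    identity, where arcosh is singular. *)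
Lemma derive2_line p v (c m : R -> R) :
  (forall t, dr_set (t *: v + p)) -> (forall t, dr_c (t *: v + p) = c t) ->
  (forall t, has_deriv c t (t * m t)) -> (forall t, 1 < c t) -> continuous_at 0 m ->
  'D_v ('D_v f) p = dprof (dr_r p) * (2 * m 0 / Num.sqrt ((2 * c 0 - 1) ^+ 2 - 1)).
Proof.
move=> Sv cE dc c1 cm.
pose r t := arcosh (2 * c t - 1).
have rE t : dr_r (t *: v + p) = r t by rewrite /dr_r cE.
have dr t : has_deriv r t (t * (2 * m t / Num.sqrt ((2 * c t - 1) ^+ 2 - 1))).
  have dC : has_deriv (fun t => 2 * c t - 1) t (2 * (t * m t)).
    by apply: der1_eq (der1D (der1M (der1_cst t 2) (dc t)) (der1_cst t (-1))) _; ring.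
  apply: der1_eq; first by apply: has_deriv_arcosh dC _; have := c1 t; lra.
  by ring.
pose M t := dprof (r t) * (2 * m t / Num.sqrt ((2 * c t - 1) ^+ 2 - 1)).
have fE t : f (t *: v + p) = prof (r t) by rewrite (radialE rf (Sv t)) rE.
have dF t : has_deriv (fun t => f (t *: v + p)) t (t * M t).
  have -> : (fun t => f (t *: v + p)) = (fun t => prof (r t)) by apply/funext.
  apply: der1_eq; first exact: (der1_comp (has_deriv_prof (r t)) (dr t)).
  by rewrite /M; ring.
have DF t : 'D_v f (t *: v + p) = t * M t.
  apply: derive_val; apply/is_derive_line.
  have dS : has_deriv (fun x : R => x + t) 0 1 by eapply der1_eq; [derive_rules|rewrite addr0].
  have -> : (fun x => f (x *: v + (t *: v + p))) = (fun x => f ((x + t) *: v + p)).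
    by apply/funext => x; rewrite scalerDl addrA.
  apply: der1_eq; first apply: (@der1_comp _ (fun x => f (x *: v + p)) _ _ (t * M t) _ _ dS).
    by rewrite add0r.
  by rewrite mulr1.
have -> : dprof (dr_r p) = dprof (r 0) by rewrite -rE scale0r add0r.
apply: derive_val; apply/is_derive_line.
have -> : (fun t => 'D_v f (t *: v + p)) = (fun t => t * M t) by apply/funext.
apply: has_deriv_id_mul; apply: contM.
  apply: cont_comp; last exact: der1_continuous (dr 0).
  exact: der1_continuous (has_deriv_dprof _).
have cc : continuous_at 0 c by exact: der1_continuous (dc 0).
apply: contM; first by apply: contM => //; exact: cont_cst.
apply: contV; last by apply: cont_sqrt; cont_rules.
rewrite gt_eqF// sqrtr_gt0 subr_gt0 exprn_egt1//.
by have := c1 0; lra.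
Qed.

(** This is A'/A in the form in which the Laplacian produces it: the second derivatives in the mv
    and mz directions transverse to the axis, and the first-order term along it. [driftE] gives the
    hyperbolic form. *)
Definition drift s : R := mv%:R * (expR s / (expR s - 1))
  + mz%:R * (2 * expR s ^+ 2 / (expR s ^+ 2 - 1)) - (mv%:R / 2 + mz%:R).

Lemma dr_laplace_prof s : 0 < s ->
  dr_laplace h f (axis s) = ddprof s + drift s * dprof s.
Proof.
move=> s0; set a := expR s.
have a1 : 1 < a by rewrite expR_gt1.
have a0 : 0 < a by rewrite expR_gt0.
have rs : dr_r (axis s) = s by rewrite dr_r_axis// ltW.
(* On the axis c0 = cosh^2 (s/2), and the square root is sinh s. *)
have sqE (c0 : R) : c0 = (1 + a) ^+ 2 / (4 * a) ->
    Num.sqrt ((2 * c0 - 1) ^+ 2 - 1) = (a ^+ 2 - 1) / (2 * a).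
  move=> ->; rewrite (_ : _ - 1 = ((a ^+ 2 - 1) / (2 * a)) ^+ 2); last first.
    by field; rewrite gt_eqF.
  rewrite sqrtr_sqr ger0_norm// divr_ge0//; last by rewrite mulr_ge0// ltW.
  by rewrite subr_ge0 exprn_ege1// ltW.
have c1 t : 0 <= t -> 1 < ((1 + a) ^+ 2 + t) / (4 * a).
  by move=> t0; rewrite ltr_pdivlMr ?mulr_gt0// mul1r; nra.
have a20 : a ^+ 2 - 1 != 0 by rewrite gt_eqF// subr_gt0 exprn_egt1.
have a10 : a - 1 != 0 by rewrite gt_eqF// subr_gt0.
have Dv (i : 'I_mv) : 'D_(mkpt (delta_mx 0 i) 0 0) ('D_(mkpt (delta_mx 0 i) 0 0) f) (axis s)
    = dprof s / (a - 1).
  pose c t := (1 + a + t ^+ 2 / 4) ^+ 2 / (4 * a).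
  pose m t := (1 + a + t ^+ 2 / 4) / (4 * a).
  rewrite (@derive2_line _ _ c m) ?rs.
  - rewrite sqE; last by rewrite /c expr0n/= mul0r addr0.
    rewrite /m expr0n/= mul0r addr0; field.
    by rewrite a10 a20 gt_eqF.
  - by move=> t; rewrite /dr_set/= /axis mkptZ mkptD apart_mkpt mulr0 add0r.
  - move=> t; rewrite /dr_c /dr_b /axis mkptZ mkptD !(vpart_mkpt, zpart_mkpt, apart_mkpt).
    rewrite !scaler0 !addr0 !dot0l mulr0 add0r -/a addr0 dotZl dotZr dot_delta mxE !eqxx.
    by rewrite mulr1 -expr2.
  - move=> t; rewrite /c /m; eapply der1_eq.
      by derive_rules; rewrite mulf_neq0// gt_eqF.
    by rewrite /=; field; rewrite gt_eqF.
  - move=> t; have t2 := sqr_ge0 t.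
    rewrite /c (_ : _ ^+ 2 = (1 + a) ^+ 2 + (t ^+ 2 / 2 * (1 + a) + (t ^+ 2 / 4) ^+ 2)).
      by apply: c1; rewrite addr_ge0 ?sqr_ge0// mulr_ge0 ?divr_ge0// addr_ge0// ltW.
    by field.
  - have ci : continuous_at 0 (fun t : R => t) by exact: cvg_id.
    by rewrite /m; cont_rules.
have Dz (i : 'I_mz) : 'D_(mkpt 0 (delta_mx 0 i) 0) ('D_(mkpt 0 (delta_mx 0 i) 0) f) (axis s)
    = dprof s * (2 / (a ^+ 2 - 1)).
  pose c t := ((1 + a) ^+ 2 + t ^+ 2) / (4 * a).
  pose m (t : R) := (2 * a)^-1.
  rewrite (@derive2_line _ _ c m) ?rs.
  - rewrite sqE; last by rewrite /c expr0n/= addr0.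
    rewrite /m; field.
    by rewrite a20 gt_eqF.
  - by move=> t; rewrite /dr_set/= /axis mkptZ mkptD apart_mkpt mulr0 add0r.
  - move=> t; rewrite /dr_c /dr_b /axis mkptZ mkptD !(vpart_mkpt, zpart_mkpt, apart_mkpt).
    rewrite !scaler0 !addr0 !dot0l mulr0 add0r -/a mul0r addr0 dotZl dotZr dot_delta mxE !eqxx.
    by rewrite mulr1 -expr2.
  - move=> t; rewrite /c /m; eapply der1_eq.
      by derive_rules; rewrite mulf_neq0// gt_eqF.
    by rewrite /=; field; rewrite gt_eqF.
  - by move=> t; apply: c1; exact: sqr_ge0.
  - exact: cont_cst.
rewrite dr_laplace_axis//.
under eq_bigr do rewrite Dv; under [X in _ + _ * X + _ + _]eq_bigr do rewrite Dz.
rewrite !sumr_const !card_ord -![dprof _ * _ *+ _]mulr_natl.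
rewrite /drift -/a /ddprof /dprof -/a -/e_a /axis -/a; field.
by rewrite a10 a20.
Qed.

End Profile.

End RadialLaplacian.

(** * The radial equation *)

Section HalfHyperbolic.
Context {R : realType}.
Implicit Types s : R.

Definition sh s : R := (expR (s / 2) - expR (- (s / 2))) / 2.
Definition ch s : R := (expR (s / 2) + expR (- (s / 2))) / 2.

Lemma has_deriv_sh s : has_deriv sh s (ch s / 2).
Proof.
by rewrite /sh /ch; eapply der1_eq; [derive_rules|rewrite /=; field].
Qed.

Lemma has_deriv_ch s : has_deriv ch s (sh s / 2).
Proof.
by rewrite /sh /ch; eapply der1_eq; [derive_rules|rewrite /=; field].
Qed.

Lemma ch_sh s : ch s ^+ 2 = 1 + sh s ^+ 2.
Proof.
rewrite /ch /sh expRN; field.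
by rewrite expR_eq0.
Qed.

Lemma ch_gt0 s : 0 < ch s.
Proof. by rewrite divr_gt0// addr_gt0 ?expR_gt0. Qed.

Lemma ch_ge1 s : 1 <= ch s.
Proof.
by rewrite -(@expr_ge1 _ 2)// ?ch_sh ?lerDl ?sqr_ge0// ltW// ch_gt0.
Qed.

Lemma sh_gt0 s : 0 < s -> 0 < sh s.
Proof. by move=> s0; rewrite divr_gt0// subr_gt0 ltr_expR; lra. Qed.

Lemma sh0 : sh 0 = 0.
Proof. by rewrite /sh mul0r oppr0 subrr mul0r. Qed.

Lemma sh_ge s : 0 <= s -> s / 2 <= sh s.
Proof.
move=> s0; have d x : has_deriv (fun x => x / 2 - sh x) x (2^-1 - ch x / 2).
  have ds := has_deriv_sh x; eapply der1_eq; first by derive_rules.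
  by rewrite /=; ring.
have := @nonincreasing_is_derive _ (fun x => x / 2 - sh x) _ 0 s s0 (fun x _ => d x).
rewrite sh0 mul0r subrr subr_le0; apply.
- by move=> x _; have := ch_ge1 x; lra.
- exact: der1_continuous (d 0).
- exact: der1_continuous (d s).
Qed.

Lemma ch_le2 s : 0 <= s <= 1 -> ch s <= 2.
Proof.
move=> /andP[s0 s1]; have e1 : expR (s / 2) <= 2.
  rewrite -[s / 2]opprK expRN -[leRHS]invrK lef_pV2 ?posrE ?expR_gt0//.
  by have := expR_ge1Dx (- (s / 2)); lra.
have : expR (- (s / 2)) <= 1 by rewrite expR_le1; lra.
by rewrite /ch; lra.
Qed.

Lemma sh_le s : 0 <= s <= 1 -> sh s <= s.
Proof.
move=> /andP[s0 s1]; have d x : has_deriv (fun x => sh x - x) x (ch x / 2 - 1).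
  have ds := has_deriv_sh x; eapply der1_eq; first by derive_rules.
  by rewrite /=; ring.
have := @nonincreasing_is_derive _ (fun x => sh x - x) _ 0 s s0 (fun x _ => d x).
rewrite sh0 subrr subr_le0; apply.
- move=> x /andP[x0 xs]; have : ch x <= 2 by apply: ch_le2; lra.
  by lra.
- exact: der1_continuous (d 0).
- exact: der1_continuous (d s).
Qed.

Lemma ch_le_sh s : 0 <= s -> ch s <= sh s + 1.
Proof.
move=> s0; have : expR (- (s / 2)) <= 1 by rewrite expR_le1; lra.
by rewrite /ch /sh; lra.
Qed.

End HalfHyperbolic.

Section Density.
Context {R : realType} (mv mz : nat).
Implicit Types s : R.
Local Notation P := ((mv + mz)%:R : R).
Local Notation K := (mz%:R : R).
Local Notation A := (@density R mv mz).
Local Notation D := (@drift R mv mz).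

Lemma densityE s : A s = 2 ^+ (mv + mz) * sh s ^+ (mv + mz) * ch s ^+ mz.
Proof. by []. Qed.

Lemma density_gt0 s : 0 < s -> 0 < A s.
Proof. by move=> s0; rewrite densityE !mulr_gt0 ?exprn_gt0 ?sh_gt0 ?ch_gt0. Qed.

Lemma driftE s : 0 < s -> D s = P / 2 * (ch s / sh s) + K / 2 * (sh s / ch s).
Proof.
move=> s0; rewrite /drift /sh /ch !expRN natrD.
have -> : expR s = expR (s / 2) ^+ 2 by rewrite -expRM_natl; congr expR; field.
have : 1 < expR (s / 2) by rewrite expR_gt1 divr_gt0.
move: (expR _) => e e1.
have e0 : e != 0 by rewrite gt_eqF//; lra.
have e2 : e ^+ 2 - 1 != 0 by rewrite gt_eqF// subr_gt0 exprn_egt1.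
have e3 : e ^+ 2 + 1 != 0 by rewrite gt_eqF// ltr_pwDr// sqr_ge0.
have e4 : (e ^+ 2) ^+ 2 - 1 != 0.
  by rewrite (_ : _ - _ = (e ^+ 2 - 1) * (e ^+ 2 + 1)) ?mulf_neq0//; ring.
field.
by rewrite e0 -!expr2 e2 e3 e4.
Qed.

Lemma drift_ge s : 0 < s -> P / 2 <= D s.
Proof.
move=> s0; rewrite driftE//; have p0 : 0 <= P by rewrite ler0n.
have k0 : 0 <= K by rewrite ler0n.
have sh0 := sh_gt0 s0; have ch0 := ch_gt0 s.
have : 1 <= ch s / sh s.
  by rewrite ler_pdivlMr// mul1r /ch /sh; have := expR_gt0 (- (s / 2)); lra.
have : 0 <= sh s / ch s by rewrite divr_ge0 ?ltW.
move: (_ / _) (ch s / sh s) => x y x0 y1.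
rewrite -[leLHS]addr0 lerD ?mulr_ge0 ?divr_ge0//.
by rewrite ler_peMr// divr_ge0.
Qed.

Lemma has_deriv_density s : 0 < s -> has_deriv A s (D s * A s).
Proof.
move=> s0; rewrite driftE//.
have ds := has_deriv_sh s; have dc := has_deriv_ch s.
have sh0 : sh s != 0 by rewrite gt_eqF ?sh_gt0.
have ch0 : ch s != 0 by rewrite gt_eqF ?ch_gt0.
have -> : A = (fun s => 2 ^+ (mv + mz) * sh s ^+ (mv + mz) * ch s ^+ mz) by [].
eapply der1_eq; first by derive_rules.
have pow m (x : R) : x != 0 -> m%:R * x ^+ m.-1 = m%:R * x ^+ m / x.
  by case: m => [|m] x0; rewrite ?mul0r//= exprSr mulrA mulfK.
rewrite /= !pow// mulr0.
by field; rewrite ch0 sh0.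
Qed.

Definition ddrift s : R := - P / 4 / sh s ^+ 2 + K / 4 / ch s ^+ 2.

Lemma has_deriv_drift s : 0 < s -> has_deriv D s (ddrift s).
Proof.
move=> s0; have ds := has_deriv_sh s; have dc := has_deriv_ch s.
have sh0 : sh s != 0 by rewrite gt_eqF ?sh_gt0.
have ch0 : ch s != 0 by rewrite gt_eqF ?ch_gt0.
apply: (@der1_near _ (fun s => P / 2 * (ch s / sh s) + K / 2 * (sh s / ch s))).
  have : \forall t \near s, 0 < t by exact: lt_nbhsr.
  by apply: filterS => t t0; rewrite driftE.
eapply der1_eq; first by derive_rules.
rewrite /= /ddrift.
transitivity (P / 4 * ((sh s ^+ 2 - ch s ^+ 2) / sh s ^+ 2) + K / 4 * ((ch s ^+ 2 - sh s ^+ 2) / ch s ^+ 2)).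
  by field; rewrite ch0 sh0.
have c2 : 1 + sh s ^+ 2 != 0 by rewrite -ch_sh expf_neq0.
by rewrite ch_sh; field; rewrite sh0 c2.
Qed.

(** The potential of Liouville's normal form. Subtracting rho^2, the limit of D^2/4 at infinity,
    leaves lam^2 as the squared frequency and a remainder of order 1/sh^2. *)
Definition potential s : R := D s ^+ 2 / 4 + ddrift s / 2 - (@rho R mv mz) ^+ 2.

(** Generous: the coefficients that occur are (P^2 - 2 P)/16 and (K^2 - 2 K)/16. The summand 1 makes
    the bound at least 1, which the energy estimate uses. *)
Definition pot_bound : R := (P + K + 1) ^+ 2.

Lemma pot_bound_ge1 : 1 <= pot_bound.
Proof.
rewrite /pot_bound exprn_ege1// lerDr addr_ge0// ?ler0n.
Qed.

Lemma potential_le s : 0 < s -> `|potential s| <= pot_bound / sh s ^+ 2.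
Proof.
move=> s0; have sh0 := sh_gt0 s0; have ch0 := ch_gt0 s.
have p0 : 0 <= P by rewrite ler0n.
have k0 : 0 <= K by rewrite ler0n.
have -> : potential s = (P ^+ 2 - 2 * P) / 16 / sh s ^+ 2 - (K ^+ 2 - 2 * K) / 16 / ch s ^+ 2.
  have := ch_sh s; rewrite /potential driftE// /ddrift /rho.
  have -> : (mv%:R : R) = P - K by rewrite natrD addrK.
  move: (sh s) (ch s) sh0 ch0 => x y x0 y0 yx.
  transitivity ((P ^+ 2 / 16 * ((y ^+ 2 - x ^+ 2) / x ^+ 2) - K ^+ 2 / 16 * ((y ^+ 2 - x ^+ 2) / y ^+ 2))
     - P / 8 / x ^+ 2 + K / 8 / y ^+ 2).
    by field; rewrite !gt_eqF.
  rewrite yx addrK; rewrite -yx; field.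
  by rewrite !gt_eqF.
apply: le_trans (ler_normB _ _) _.
have ci : (ch s ^+ 2)^-1 <= (sh s ^+ 2)^-1.
  by rewrite lef_pV2 ?posrE ?exprn_gt0// ch_sh lerDr.
have cs0 : 0 <= (ch s ^+ 2)^-1 by rewrite invr_ge0 sqr_ge0.
rewrite !normrM !(ger0_norm (_ : 0 <= (_ ^+ 2)^-1)) ?invr_ge0 ?sqr_ge0//.
have n1 : `|P ^+ 2 - 2 * P| * `|16^-1| <= (P ^+ 2 + 2 * P) / 16.
  rewrite ger0_norm ?invr_ge0// ler_wpM2r// (le_trans (ler_normB _ _))//.
  by rewrite !ger0_norm// ?sqr_ge0 ?mulr_ge0.
have n2 : `|K ^+ 2 - 2 * K| * `|16^-1| <= (K ^+ 2 + 2 * K) / 16.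
  rewrite [`|16^-1|]ger0_norm ?invr_ge0// ler_wpM2r// (le_trans (ler_normB _ _))//.
  by rewrite !ger0_norm// ?sqr_ge0 ?mulr_ge0.
apply: (@le_trans _ _ ((P ^+ 2 + 2 * P) / 16 / sh s ^+ 2 + (K ^+ 2 + 2 * K) / 16 / sh s ^+ 2)).
  apply: lerD; first by rewrite ler_wpM2r// invr_ge0 sqr_ge0.
  by apply: ler_pM => //; rewrite mulr_ge0.
rewrite -mulrDl ler_wpM2r ?invr_ge0 ?sqr_ge0// /pot_bound.
by nra.
Qed.

End Density.

(** * Bounds for solutions of the radial equation *)

Section SphericalODE.
Context {R : realType} (mv mz : nat).
Local Notation P := ((mv + mz)%:R : R).
Local Notation K := (mz%:R : R).
Local Notation A := (@density R mv mz).
Local Notation D := (@drift R mv mz).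
Local Notation rho := (@rho R mv mz).
Local Notation q := (@potential R mv mz).
Local Notation b := (@pot_bound R mv mz).

Lemma drift_le s : 0 < s <= 1 -> D s <= (2 * P + K) / s.
Proof.
move=> /andP[s0 s1]; rewrite driftE//; have sh0 := sh_gt0 s0; have ch0 := ch_gt0 s.
have k0 : 0 <= K by rewrite ler0n.
have chsh : sh s <= ch s by rewrite /sh /ch; have := expR_gt0 (- (s / 2)); lra.
have h1 : ch s / sh s <= 4 / s.
  rewrite ler_pdivrMr// mulrAC ler_pdivlMr//.
  have c2 : ch s <= 2 by apply: ch_le2; rewrite s1 ltW.
  by have := sh_ge (ltW s0); nra.
have h2 : sh s / ch s <= s^-1.
  by apply: (@le_trans _ _ 1); [rewrite ler_pdivrMr ?mul1r|rewrite invf_ge1].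
rewrite mulrDl; apply: lerD.
  rewrite -mulrA (_ : 2 * P / s = P * (2 / s)); last by ring.
  by rewrite ler_wpM2l ?ler0n//; lra.
rewrite -mulrA ler_wpM2l//; apply: le_trans h2.
by have := divr_ge0 (ltW sh0) (ltW ch0); lra.
Qed.

Lemma drift_le1 s : 1 <= s -> D s <= 2 * P + K.
Proof.
move=> s1; have s0 : 0 < s by lra.
rewrite driftE//; have sh0 := sh_gt0 s0; have ch0 := ch_gt0 s.
have k0 : 0 <= K by rewrite ler0n.
have chsh : sh s <= ch s by rewrite /sh /ch; have := expR_gt0 (- (s / 2)); lra.
have h1 : ch s / sh s <= 3.
  by rewrite ler_pdivrMr//; have := ch_le_sh (ltW s0); have := sh_ge (ltW s0); lra.
have h2 : sh s / ch s <= 1 by rewrite ler_pdivrMr ?mul1r.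
have p0 : 0 <= P by rewrite ler0n.
by have := ler_wpM2l p0 h1; have := ler_wpM2l k0 h2; lra.
Qed.

Lemma density_le s : 0 <= s <= 1 -> A s <= 2 ^+ (mv + mz + mz) * s ^+ (mv + mz).
Proof.
move=> s01; have /andP[s0 s1] := s01.
have sh0 : 0 <= sh s by have := sh_ge s0; lra.
have ch0 := ch_gt0 s.
rewrite densityE (exprD 2 (mv + mz) mz) -!mulrA ler_wpM2l ?exprn_ge0// mulrC.
apply: ler_pM; rewrite ?exprn_ge0 ?(ltW ch0)//.
  by rewrite lerXn2r ?nnegrE ?(ltW ch0)// ch_le2.
by rewrite lerXn2r ?nnegrE// sh_le.
Qed.

Variables (lam : R) (u u1 u2 : R -> R).
Hypotheses (lam0 : 0 < lam).
Let mu := lam ^+ 2 + rho ^+ 2.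
(** The condition on [u 0] is an inequality so that u = 0, the default value of [spherical], is
    covered too. *)
Hypotheses (du : forall s, has_deriv u s (u1 s))
  (du1 : forall s, has_deriv u1 s (u2 s))
  (u00 : u 0 ^+ 2 <= 1) (u10 : u1 0 = 0)
  (ode : forall s, 0 < s -> u2 s + D s * u1 s = - mu * u s).

Let mu_gt0 : 0 < mu.
Proof. by rewrite ltr_wpDr ?sqr_ge0// exprn_gt0. Qed.

(** The first-order term acts as friction: the derivative of the energy is - 2 D u'^2, and D >=
    0. *)
Lemma ode_energy s : 0 <= s -> u1 s ^+ 2 + mu * u s ^+ 2 <= mu * u 0 ^+ 2.
Proof.
move=> s0; pose e x := u1 x ^+ 2 + mu * u x ^+ 2.
have de x : has_deriv e x (2 * u1 x * u2 x + mu * (2 * u x * u1 x)).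
  have d := du x; have d1 := du1 x.
  by rewrite /e; eapply der1_eq; [derive_rules|rewrite /=; ring].
suff : e s <= e 0 by rewrite /e u10 expr0n/= add0r.
apply: (nonincreasing_is_derive s0 (fun x _ => de x)).
- move=> x /andP[x0 xs]; have o := ode x0; have d0 := drift_ge mv mz x0.
  have -> : 2 * u1 x * u2 x + mu * (2 * u x * u1 x) = - (2 * D x * u1 x ^+ 2).
    have -> : u2 x = - mu * u x - D x * u1 x by rewrite -o; ring.
    by ring.
  rewrite oppr_le0 mulr_ge0 ?sqr_ge0// mulr_ge0//.
  by apply: le_trans d0; rewrite divr_ge0 ?ler0n.
- exact: der1_continuous (de 0).
- exact: der1_continuous (de s).
Qed.

Lemma ode_le1 s : 0 <= s -> u s ^+ 2 <= 1.
Proof.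
move=> s0; have := ode_energy s0; have := sqr_ge0 (u1 s) => h1 h2.
have : mu * u s ^+ 2 <= mu * u 0 ^+ 2 by lra.
by rewrite ler_pM2l// => h3; exact: le_trans u00.
Qed.

Lemma ode_deriv_le s : 0 <= s -> u1 s ^+ 2 <= mu.
Proof.
move=> s0; have := ode_energy s0; have := sqr_ge0 (u s) => h1 h2.
have : mu * u 0 ^+ 2 <= mu * 1 by rewrite ler_pM2l.
by have := mulr_ge0 (ltW mu_gt0) h1; lra.
Qed.

(* Liouville's transformation: v = sqrt(A) u satisfies v'' = (q - lam^2) v, where
   |q| <= b / sh^2.  On s >= 1 / (1 + lam) the energy E of v, damped by exp (c / sh s), is
   nonincreasing, which transfers the bound at s = 1 / (1 + lam) to all larger s. *)
Let w s := Num.sqrt (A s).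
Let v s := w s * u s.
Let v1 s := w s * (u1 s + D s / 2 * u s).

Let has_deriv_w s : 0 < s -> has_deriv w s (D s / 2 * w s).
Proof.
move=> s0; have dA := has_deriv_density mv mz s0; have A0 := density_gt0 mv mz s0.
apply: der1_eq (der1_sqrt A0 dA) _.
rewrite /w -{2}(sqr_sqrtr (ltW A0)); field.
by rewrite gt_eqF// sqrtr_gt0.
Qed.

Let has_deriv_v s : 0 < s -> has_deriv v s (v1 s).
Proof.
move=> s0; apply: der1_eq (der1M (has_deriv_w s0) (du s)) _.
by rewrite /v1; field.
Qed.

Let has_deriv_v1 s : 0 < s -> has_deriv v1 s ((q s - lam ^+ 2) * v s).
Proof.
move=> s0; have dw := has_deriv_w s0; have dD := has_deriv_drift mv mz s0.
have d := du s; have d1 := du1 s.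
rewrite /v1; eapply der1_eq; first by derive_rules.
rewrite /= /v /potential.
have -> : u2 s = - mu * u s - D s * u1 s by rewrite -(ode s0); ring.
by rewrite /mu; field.
Qed.

Let eps s := b / sh s ^+ 2.
Let E s := v1 s ^+ 2 + (lam ^+ 2 + eps s) * v s ^+ 2.
(** The derivative - (c/2) ch / sh^2 of c / sh has to absorb the growth rate 2 eps / sqrt (lam^2 +
    eps) of E. As ch^2 (lam^2 + eps) >= lam^2 + 1 >= (1 + lam)^2 / 2, the factor 6 suffices. The
    denominator 1 + lam keeps c / sh below 12 b from s = 1 / (1 + lam) on. *)
Let c := 6 * b / (1 + lam).
Let Psi s := E s * expR (c / sh s).

Let b_ge1 : 1 <= b. Proof. exact: pot_bound_ge1. Qed.
Let b_gt0 : 0 < b. Proof. exact: lt_le_trans ltr01 b_ge1. Qed.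
Let c_gt0 : 0 < c. Proof. by apply: divr_gt0; [apply: mulr_gt0|apply: addr_gt0]. Qed.
Let eps_ge0 s : 0 <= eps s. Proof. exact: divr_ge0 (ltW b_gt0) (sqr_ge0 _). Qed.

Let has_deriv_Psi s : 0 < s -> has_deriv Psi s
  (((2 * v1 s * v s * (q s + eps s) - eps s * (ch s / sh s) * v s ^+ 2)
     - c / 2 * (ch s / sh s ^+ 2) * E s) * expR (c / sh s)).
Proof.
move=> s0; have dv := has_deriv_v s0; have dv1 := has_deriv_v1 s0.
have ds := has_deriv_sh s; have sh0 : sh s != 0 by rewrite gt_eqF ?sh_gt0.
rewrite /Psi /E /eps; eapply der1_eq.
  by derive_rules => //; rewrite expf_neq0.
by rewrite /=; field; rewrite sh0.
Qed.

Let Psi_decr s t : 0 < s -> s <= t -> Psi t <= Psi s.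
Proof.
move=> s0 st; apply: (nonincreasing_is_derive st).
- by move=> x /andP[sx _]; apply: has_deriv_Psi; exact: lt_trans sx.
- move=> x /andP[sx _]; have x0 : 0 < x by exact: lt_trans sx.
  rewrite pmulr_lle0 ?expR_gt0// subr_le0.
  have shx := sh_gt0 x0; have chx := ch_gt0 x.
  have e0 : 0 < eps x by rewrite divr_gt0 ?exprn_gt0.
  apply: le_trans (_ : 4 * eps x * `|v1 x * v x| <= _).
    (* The derivative of eps is - eps ch / sh, so its contribution to that of E has a favourable
       sign. *)
    rewrite (@le_trans _ _ (2 * v1 x * v x * (q x + eps x)))//.
      by rewrite gerBl; exact: mulr_ge0 (mulr_ge0 (ltW e0) (divr_ge0 (ltW chx) (ltW shx))) (sqr_ge0 _).
    have hq : `|q x + eps x| <= 2 * eps x.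
      apply: le_trans (ler_normD _ _) _.
      have := potential_le mv mz x0; rewrite -/(eps x) (ger0_norm (ltW e0)).
      by lra.
    have hvq : v1 x * v x * (q x + eps x) <= `|v1 x * v x| * (2 * eps x).
      by apply: le_trans (ler_norm _) _; rewrite normrM ler_wpM2l.
    by move: hvq; lra.
  have m0 : 0 < lam ^+ 2 + eps x by rewrite ltr_wpDl ?sqr_ge0.
  pose r := c / 2 * (ch x / sh x ^+ 2).
  have r0 : 0 <= r.
    by apply: mulr_ge0; apply: divr_ge0; rewrite ?sqr_ge0 ?(ltW c_gt0) ?(ltW chx).
  rewrite -/r.
  have key : (2 * eps x) ^+ 2 <= r ^+ 2 * (lam ^+ 2 + eps x).
    have -> : (2 * eps x) ^+ 2 = 4 * b ^+ 2 / sh x ^+ 4.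
      by rewrite /eps; field; rewrite gt_eqF.
    have -> : r ^+ 2 * (lam ^+ 2 + eps x) = 9 * b ^+ 2 * (ch x ^+ 2 * (lam ^+ 2 + eps x)) / (1 + lam) ^+ 2 / sh x ^+ 4.
      by rewrite /r /c; field; rewrite !gt_eqF// addr_gt0.
    rewrite ler_wpM2r ?invr_ge0 ?exprn_ge0 ?(ltW shx)//.
    rewrite ler_pdivlMr ?exprn_gt0 ?addr_gt0//.
    have h1 : lam ^+ 2 + b <= ch x ^+ 2 * (lam ^+ 2 + eps x).
      rewrite mulrDr lerD//.
        by rewrite ler_peMl ?sqr_ge0// exprn_ege1// ch_ge1.
      rewrite /eps mulrCA ler_peMr ?(ltW b_gt0)//.
      by rewrite ler_pdivlMr ?exprn_gt0// mul1r ch_sh lerDr.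
    have b2 : 0 <= b ^+ 2 by rewrite sqr_ge0.
    have h3 : 4 * (1 + lam) ^+ 2 <= 9 * (ch x ^+ 2 * (lam ^+ 2 + eps x)).
      by have := b_ge1; have := sqr_ge0 (1 - lam); move: h1; have := sqr_ge0 lam; lra.
    by have := ler_wpM2l b2 h3; lra.
  have E0 : E x = v1 x ^+ 2 + (lam ^+ 2 + eps x) * v x ^+ 2 by [].
  rewrite E0; move: (lam ^+ 2 + eps x) m0 key => m m0 key.
  have h : 2 * eps x <= r * Num.sqrt m.
    have n1 : 0 <= 2 * eps x by exact: mulr_ge0 (ltW e0).
    have n2 : 0 <= r * Num.sqrt m by exact: mulr_ge0 r0 (sqrtr_ge0 _).
    by rewrite -(@ler_pXn2r _ 2) ?nnegrE// [leRHS]exprMn sqr_sqrtr ?(ltW m0).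
  have am : 2 * (Num.sqrt m * `|v1 x * v x|) <= v1 x ^+ 2 + m * v x ^+ 2.
    have e1 : `|v1 x| ^+ 2 = v1 x ^+ 2 by rewrite real_normK ?num_real.
    have e2 : `|v x| ^+ 2 = v x ^+ 2 by rewrite real_normK ?num_real.
    rewrite normrM -e1 -e2 -{2}(sqr_sqrtr (ltW m0)).
    by have := sqr_ge0 (`|v1 x| - Num.sqrt m * `|v x|); lra.
  apply: le_trans (_ : r * (2 * (Num.sqrt m * `|v1 x * v x|)) <= _); last by rewrite ler_wpM2l.
  by have := ler_wpM2r (normr_ge0 (v1 x * v x)) h; lra.
- exact: der1_continuous (has_deriv_Psi s0).
- exact: der1_continuous (has_deriv_Psi (lt_le_trans s0 st)).
Qed.

Let s0 := (1 + lam)^-1.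

Let s0_gt0 : 0 < s0. Proof. by rewrite invr_gt0 addr_gt0. Qed.
Let s0_le1 : s0 <= 1. Proof. by rewrite invf_le1 ?addr_gt0// lerDl ltW. Qed.

(** The summands bound, in this order and up to the factor (1 + lam)^2, the quantities 2 mu, D^2/2,
    lam^2 and eps at [s0]. *)
Definition ode_const0 : R :=
  2 * (1 + rho ^+ 2) + (2 * P + K) ^+ 2 / 2 + 1 + 4 * b.

Let E_s0 : E s0 <= A s0 * (ode_const0 * (1 + lam) ^+ 2).
Proof.
have A0 := density_gt0 mv mz s0_gt0.
have w2 : w s0 ^+ 2 = A s0 by rewrite sqr_sqrtr// ltW.
have -> : E s0 = A s0 * ((u1 s0 + D s0 / 2 * u s0) ^+ 2 + (lam ^+ 2 + eps s0) * u s0 ^+ 2).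
  by rewrite /E /v1 /v !exprMn w2; ring.
rewrite ler_pM2l//.
have hu := ode_le1 (ltW s0_gt0); have hu1 := ode_deriv_le (ltW s0_gt0).
have hD : D s0 <= (2 * P + K) * (1 + lam).
  by have := @drift_le s0; rewrite /s0 invrK; apply; rewrite s0_gt0 s0_le1.
have D0 : 0 <= D s0.
  by apply: le_trans (drift_ge mv mz s0_gt0); rewrite divr_ge0 ?ler0n.
have heps : eps s0 <= 4 * b * (1 + lam) ^+ 2.
  rewrite /eps ler_pdivrMr ?exprn_gt0 ?sh_gt0//.
  have hs : 1 <= 2 * (1 + lam) * sh s0.
    have := sh_ge (ltW s0_gt0) => /(ler_wpM2l (_ : 0 <= 2 * (1 + lam))).
    rewrite [_ * (s0 / 2)](_ : _ = 1); last by rewrite /s0; field; rewrite gt_eqF// addr_gt0.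
    by apply; rewrite mulr_ge0// addr_ge0// ltW.
  have := b_ge1 => b1.
  rewrite [leRHS](_ : _ = b * (2 * (1 + lam) * sh s0) ^+ 2); last by ring.
  by rewrite ler_peMr ?exprn_ege1// ltW.
have D2 : D s0 ^+ 2 <= ((2 * P + K) * (1 + lam)) ^+ 2 by rewrite lerXn2r ?nnegrE// (le_trans D0).
have e0 : 0 <= eps s0 by rewrite eps_ge0.
have h1 : (u1 s0 + D s0 / 2 * u s0) ^+ 2 <= 2 * mu + D s0 ^+ 2 / 2.
  have := sqr_ge0 (u1 s0 - D s0 / 2 * u s0).
  have : D s0 ^+ 2 * u s0 ^+ 2 <= D s0 ^+ 2 by rewrite ler_piMr ?sqr_ge0.
  by lra.
have h2 : (lam ^+ 2 + eps s0) * u s0 ^+ 2 <= lam ^+ 2 + eps s0.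
  by rewrite ler_piMr// addr_ge0 ?sqr_ge0.
apply: le_trans (lerD h1 h2) _; rewrite /ode_const0 /mu.
have l1 : lam ^+ 2 <= (1 + lam) ^+ 2 by rewrite lerXn2r ?nnegrE ?addr_ge0 ?ltW// ltrDr.
have l2 : 1 <= (1 + lam) ^+ 2 by rewrite exprn_ege1// lerDl ltW.
have r2 : rho ^+ 2 <= rho ^+ 2 * (1 + lam) ^+ 2 by rewrite ler_peMr ?sqr_ge0.
by move: D2 heps; rewrite exprMn; lra.
Qed.

(** The power of 2 comes from [density_le], the exponential from the damping factor of [Psi], and
    the summand 1 serves the range s <= s0. *)
Definition ode_const : R := 2 ^+ (mv + mz + mz) * (1 + ode_const0) * expR (12 * b).

Let E_le s : s0 <= s -> E s <= A s0 * (ode_const0 * (1 + lam) ^+ 2) * expR (12 * b).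
Proof.
move=> s0s; have s_gt0 : 0 < s by exact: lt_le_trans s0s.
have hP := Psi_decr s0_gt0 s0s.
have E0 t : 0 <= E t.
  exact: addr_ge0 (sqr_ge0 _) (mulr_ge0 (addr_ge0 (sqr_ge0 _) (eps_ge0 _)) (sqr_ge0 _)).
apply: le_trans (_ : Psi s <= _).
  by rewrite /Psi ler_peMr// -[leLHS]expR0 ler_expR; exact: divr_ge0 (ltW c_gt0) (ltW (sh_gt0 s_gt0)).
apply: le_trans hP _; rewrite /Psi.
apply: ler_pM; [exact: E0|exact: expR_ge0|exact: E_s0|].
rewrite ler_expR ler_pdivrMr ?sh_gt0//.
have := sh_ge (ltW s0_gt0) => /(ler_wpM2l (_ : 0 <= 12 * b)).
rewrite (_ : 12 * b * (s0 / 2) = c); last first.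
  by rewrite /c /s0; field; rewrite gt_eqF// addr_gt0.
by apply; rewrite mulr_ge0// ltW.
Qed.

Lemma ode_const0_ge0 : 0 <= ode_const0.
Proof.
have := sqr_ge0 rho; have := sqr_ge0 (2 * P + K); have := b_ge1.
by rewrite /ode_const0; lra.
Qed.

Hypothesis dim2 : (2 <= mv + mz)%N.

(** Up to s0 = 1 / (1 + lam) the bound |u| <= 1 is enough, since A(s) (1 + lam)^(mv + mz) is bounded
    there. Beyond, lam^2 v^2 <= E, and E is controlled by its value at s0, of order A(s0) (1 +
    lam)^2. Both ranges yield the same power of 1 + lam. *)
Lemma ode_bound s : 0 < s ->
  lam ^+ 2 * (1 + lam) ^+ (mv + mz - 2) * (A s * u s ^+ 2) <= ode_const.
Proof.
move=> s_gt0; have l1 : 0 < 1 + lam by rewrite addr_gt0.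
have A0 t : 0 < t -> 0 < A t by exact: density_gt0.
have As (t : R) : 0 <= t <= s0 -> A t * (1 + lam) ^+ (mv + mz) <= 2 ^+ (mv + mz + mz).
  move=> /andP[t0 ts]; apply: le_trans (_ : 2 ^+ (mv + mz + mz) * t ^+ (mv + mz) * (1 + lam) ^+ (mv + mz) <= _).
    by rewrite ler_wpM2r ?exprn_ge0 ?(ltW l1)// density_le// t0 (le_trans ts).
  rewrite -mulrA -exprMn -[leRHS]mulr1 ler_wpM2l ?exprn_ge0// exprn_ile1//.
    by rewrite mulr_ge0// ltW.
  by rewrite mulrC -ler_pdivlMl// mulr1.
have e1 : 1 <= expR (12 * b).
  by rewrite -[leLHS]expR0 ler_expR mulr_ge0// ltW.
have C0 := ode_const0_ge0.
have split : (1 + lam) ^+ (mv + mz) = (1 + lam) ^+ (mv + mz - 2) * (1 + lam) ^+ 2.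
  by rewrite -exprD subnK.
have p2 : 0 < (2 : R) ^+ (mv + mz + mz) by rewrite exprn_gt0.
have [ss0|ss0] := leP s s0.
  have h := As s; rewrite (ltW s_gt0) ss0 in h; have {}h := h isT.
  have hu := ode_le1 (ltW s_gt0).
  have l2 : lam ^+ 2 <= (1 + lam) ^+ 2 by rewrite lerXn2r ?nnegrE ?ltW// ltrDr.
  apply: le_trans (_ : 2 ^+ (mv + mz + mz) <= _); last first.
    rewrite /ode_const -mulrA ler_peMr ?(ltW p2)//.
    by rewrite -[leLHS]mulr1 ler_pM// lerDl.
  apply: le_trans h; rewrite split.
  have Au : A s * u s ^+ 2 <= A s by rewrite ler_piMr// ltW// A0.
  have := ler_pM (sqr_ge0 lam) (mulr_ge0 (ltW (A0 _ s_gt0)) (sqr_ge0 (u s))) l2 Au.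
  have q0 : 0 <= (1 + lam) ^+ (mv + mz - 2) by rewrite exprn_ge0// ltW.
  by move=> /(ler_wpM2l q0); lra.
have hE := E_le (ltW ss0).
have hv : lam ^+ 2 * (A s * u s ^+ 2) <= E s.
  have w2 : A s = w s ^+ 2 by rewrite sqr_sqrtr// ltW// A0.
  rewrite w2 -exprMn -/(v s) /E mulrDl addrCA lerDl.
  exact: addr_ge0 (sqr_ge0 _) (mulr_ge0 (eps_ge0 _) (sqr_ge0 _)).
have h : A s0 * (1 + lam) ^+ (mv + mz) <= 2 ^+ (mv + mz + mz) by apply: As; rewrite lexx ltW.
have q0 : 0 <= (1 + lam) ^+ (mv + mz - 2) by rewrite exprn_ge0// ltW.
have := ler_wpM2l q0 (le_trans hv hE).
rewrite [leRHS](_ : _ = A s0 * (1 + lam) ^+ (mv + mz) * (ode_const0 * expR (12 * b))); last first.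
  by rewrite split; ring.
rewrite mulrCA mulrA => /le_trans; apply.
rewrite /ode_const -[leRHS]mulrA; apply: ler_pM => //.
- exact: mulr_ge0 (ltW (A0 _ s0_gt0)) (exprn_ge0 _ (ltW l1)).
- by rewrite mulr_ge0// expR_ge0.
- by rewrite ler_wpM2r ?expR_ge0// lerDr.
Qed.

(** The constant depends on lam, which is harmless: it serves to make the boundary term at infinity
    in Green's formula vanish. *)
Lemma ode_deriv_bounded : exists C, forall s, 1 <= s -> A s * u1 s ^+ 2 <= C.
Proof.
pose M := A s0 * (ode_const0 * (1 + lam) ^+ 2) * expR (12 * b).
exists (2 * M + (2 * P + K) ^+ 2 / 2 * (M / lam ^+ 2)) => s s1.
have s_gt0 : 0 < s by exact: lt_le_trans s1.
have hE := E_le (le_trans s0_le1 s1); rewrite -/M in hE.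
have Dle := drift_le1 s1.
have D0 : 0 <= D s.
  by apply: le_trans (drift_ge mv mz s_gt0); rewrite divr_ge0 ?ler0n.
have D2 : D s ^+ 2 <= (2 * P + K) ^+ 2 by rewrite lerXn2r ?nnegrE// (le_trans D0).
have e0 : 0 <= eps s by rewrite eps_ge0.
have hv1 : v1 s ^+ 2 <= M.
  by apply: le_trans hE; rewrite /E lerDl; exact: mulr_ge0 (addr_ge0 (sqr_ge0 _) e0) (sqr_ge0 _).
have hv : v s ^+ 2 <= M / lam ^+ 2.
  rewrite ler_pdivlMr ?exprn_gt0// mulrC; apply: le_trans hE.
  by rewrite /E mulrDl addrCA lerDl; exact: addr_ge0 (sqr_ge0 _) (mulr_ge0 e0 (sqr_ge0 _)).
have w2 : A s = w s ^+ 2 by rewrite sqr_sqrtr// ltW// density_gt0.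
have -> : A s * u1 s ^+ 2 = (v1 s - D s / 2 * v s) ^+ 2.
  by rewrite w2 /v1 /v; ring.
have h1 : (v1 s - D s / 2 * v s) ^+ 2 <= 2 * v1 s ^+ 2 + D s ^+ 2 / 2 * v s ^+ 2.
  by have := sqr_ge0 (v1 s + D s / 2 * v s); lra.
apply: le_trans h1 _; apply: lerD; first by rewrite ler_wpM2l.
apply: ler_pM => //; rewrite ?sqr_ge0//; first by rewrite divr_ge0 ?sqr_ge0.
by rewrite ler_wpM2r// invr_ge0.
Qed.

End SphericalODE.

(** * Harish-Chandra's function *)

Section ComplexNorm.
Local Open Scope complex_scope.
Context {R : realType}.
Local Notation C := R[i].
Local Notation normc := (@Normc.normc R).
Local Notation Re := (@complex.Re R).
Local Notation Im := (@complex.Im R).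
Implicit Types (z w : C).

Lemma normc_ge0 z : 0 <= normc z.
Proof. by case: z => a b; exact: sqrtr_ge0. Qed.

Lemma normc_sqr z : normc z ^+ 2 = Re z ^+ 2 + Im z ^+ 2.
Proof. by case: z => a b; rewrite /= sqr_sqrtr// addr_ge0 ?sqr_ge0. Qed.

Lemma normcD z w : normc (z + w) <= normc z + normc w.
Proof. by rewrite -lecR rmorphD; exact: (ler_normD z w). Qed.

Lemma le_Re_normc z : `|Re z| <= normc z.
Proof.
case: z => a b /=; rewrite -sqrtr_sqr ler_sqrt ?lerDl ?sqr_ge0//.
by rewrite addr_ge0 ?sqr_ge0.
Qed.

Lemma le_Im_normc z : `|Im z| <= normc z.
Proof.
case: z => a b /=; rewrite -sqrtr_sqr ler_sqrt ?lerDr ?sqr_ge0//.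
by rewrite addr_ge0 ?sqr_ge0.
Qed.

Lemma normc_le z : normc z <= `|Re z| + `|Im z|.
Proof.
rewrite -(@ler_pXn2r _ 2) ?nnegrE ?normc_ge0 ?addr_ge0// normc_sqr.
have := mulr_ge0 (normr_ge0 (Re z)) (normr_ge0 (Im z)).
have <- : `|Re z| ^+ 2 = Re z ^+ 2 by rewrite real_normK ?num_real.
have <- : `|Im z| ^+ 2 = Im z ^+ 2 by rewrite real_normK ?num_real.
by lra.
Qed.

Lemma normc_real (a : R) : normc a%:C = `|a|.
Proof. by rewrite /= expr0n/= addr0 sqrtr_sqr. Qed.

Lemma normc_nat k : normc (k%:R : C) = k%:R.
Proof. by rewrite -(rmorph_nat (real_complex R)) normc_real ger0_norm ?ler0n. Qed.

Lemma normc_prod n (F : nat -> C) : normc (\prod_(j < n) F j) = \prod_(j < n) normc (F j).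
Proof.
elim: n => [|n ih]; first by rewrite !big_ord0 Normc.normc1.
by rewrite !big_ord_recr/= Normc.normcM ih.
Qed.

Lemma normc_cexp z : normc (cexp z) = expR (Re z).
Proof.
rewrite /cexp /= !exprMn -mulrDr cos2Dsin2 mulr1 sqrtr_sqr.
by rewrite ger0_norm ?expR_ge0.
Qed.

Lemma cexpD z w : cexp (z + w) = cexp z * cexp w.
Proof.
case: z => a b; case: w => c d; rewrite /cexp /= expRD cosD sinD.
by apply/eqP; rewrite eq_complex /=; apply/andP; split; apply/eqP; ring.
Qed.

Lemma normc_cpow (a : R) z : normc (cpow a z) = expR (Re z * ln a).
Proof. by case: z => x y; rewrite /cpow normc_cexp /= mulr0 subr0. Qed.

End ComplexNorm.

Section Trig.
Local Open Scope complex_scope.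
Context {R : realType}.
Implicit Types x : R.

Lemma sin_le_id x : 0 <= x -> sin x <= x.
Proof.
move=> x0; have d (y : R) : has_deriv (fun y : R => sin y - y) y (cos y - 1).
  have ds : has_deriv sin y (cos y) by exact: is_derive_sin.
  by eapply der1_eq; [derive_rules|ring].
have := nonincreasing_is_derive x0 (fun y _ => d y).
rewrite sin0 !subr0 subr_le0; apply.
- by move=> y _; rewrite subr_le0 cos_le1.
- exact: der1_continuous (d 0).
- exact: der1_continuous (d x).
Qed.

Lemma cos_ge_quad x : 0 <= x -> 1 - cos x <= x ^+ 2 / 2.
Proof.
move=> x0; have d (y : R) : has_deriv (fun y : R => 1 - cos y - y ^+ 2 / 2) y (sin y - y).
  by eapply der1_eq; [derive_rules|rewrite /=; field].
have := nonincreasing_is_derive x0 (fun y _ => d y).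
rewrite cos0 subrr expr0n/= mul0r subr0 subr_le0; apply.
- by move=> y /andP[y0 _]; rewrite subr_le0 sin_le_id// ltW.
- exact: der1_continuous (d 0).
- exact: der1_continuous (d x).
Qed.

Lemma sin_ge_cubic x : 0 <= x -> x - sin x <= x ^+ 3.
Proof.
move=> x0; have d (y : R) : has_deriv (fun y : R => y - sin y - y ^+ 3) y (1 - cos y - 3 * y ^+ 2).
  have ds : has_deriv sin y (cos y) by exact: is_derive_sin.
  by eapply der1_eq; [derive_rules|rewrite /=; ring].
have := nonincreasing_is_derive x0 (fun y _ => d y).
rewrite sin0 subr0 expr0n/= !subr0 subr_le0; apply.
- by move=> y /andP[y0 _]; have := cos_ge_quad (ltW y0); have := sqr_ge0 y; lra.
- exact: der1_continuous (d 0).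
- exact: der1_continuous (d x).
Qed.

Lemma expR_sub1_le x : 0 <= x -> expR x - 1 <= x * expR x.
Proof.
move=> x0; have := expR_ge1Dx (- x); have e0 := expR_gt0 x.
rewrite expRN -(ler_pM2r e0) mulVf ?gt_eqF//; lra.
Qed.

Local Notation C := R[i].

(** The quadratic error makes the factors of Gauss's product differ from 1 by O(1/k^2), with t = ln
    (1 + 1/k). *)
Lemma normc_cexp_taylor (x y t : R) : 0 <= x -> 0 <= y -> 0 <= t <= 1 ->
  Normc.normc (cexp ((x +i* y) * t%:C) - 1 - (x +i* y) * t%:C) <=
  expR x * (x ^+ 2 + y ^+ 2 + y ^+ 3 + x * y) * t ^+ 2.
Proof.
move=> x0 y0 /andP[t0 t1].
apply: le_trans (normc_le _) _; rewrite /cexp /= !mulr0 subr0 add0r !subr0.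
set a := x * t; set b := y * t.
have a0 : 0 <= a by rewrite mulr_ge0.
have b0 : 0 <= b by rewrite mulr_ge0.
have e0 := expR_gt0 a.
have e1 := expR_sub1_le a0; have e2 := expR_ge1Dx a.
have c1 := cos_le1 b; have c2 := cos_ge_quad b0.
have s1 := sin_le_id b0; have s2 := sin_ge_cubic b0.
have re : `|expR a * cos b - 1 - a| <= expR a * (a ^+ 2 + b ^+ 2).
  have p1 : expR a * (1 - cos b) <= expR a * (b ^+ 2 / 2) by rewrite ler_pM2l.
  have p2 : 0 <= expR a * (1 - cos b) by rewrite mulr_ge0 ?subr_ge0// ltW.
  have p3 : a * (expR a - 1) <= a * (a * expR a) by rewrite ler_wpM2l.
  have p4 : 0 <= expR a * a ^+ 2 by rewrite mulr_ge0 ?sqr_ge0// ltW.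
  have p5 : 0 <= expR a * b ^+ 2 by rewrite mulr_ge0 ?sqr_ge0// ltW.
  by rewrite ler_norml; apply/andP; split; lra.
have im : `|expR a * sin b - b| <= expR a * (b ^+ 3 + a * b).
  have p1 : expR a * (b - sin b) <= expR a * b ^+ 3 by rewrite ler_pM2l.
  have p2 : 0 <= expR a * (b - sin b) by rewrite mulr_ge0 ?subr_ge0// ltW.
  have p3 : b * (expR a - 1) <= b * (a * expR a) by rewrite ler_wpM2l.
  have p4 : 0 <= b * (expR a - 1) by rewrite mulr_ge0// subr_ge0; lra.
  have p5 : 0 <= expR a * b ^+ 3 by rewrite mulr_ge0 ?exprn_ge0// ltW.
  have p6 : 0 <= b * (a * expR a) by rewrite !mulr_ge0// ltW.
  by rewrite ler_norml; apply/andP; split; lra.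
apply: le_trans (lerD re im) _; rewrite -mulrDr.
rewrite -mulrA; apply: ler_pM; rewrite ?(ltW e0)//.
- by rewrite !addr_ge0 ?exprn_ge0 ?mulr_ge0.
- by rewrite ler_expR ler_piMr.
- rewrite /a /b; have h : t ^+ 3 <= t ^+ 2 by rewrite exprS ler_piMl ?sqr_ge0.
  have := ler_wpM2l (exprn_ge0 3 y0) h; lra.
Qed.

End Trig.

(** * Convergence of Gauss's product *)

Section GaussProduct.
Local Open Scope complex_scope.
Context {R : realType} (x y : R).
Hypotheses (x0 : 0 <= x) (y0 : 0 < y).
Local Notation C := R[i].
Local Notation normc := (@Normc.normc R).
Local Notation Re := (@complex.Re R).
Local Notation Im := (@complex.Im R).
Let z : C := x +i* y.
Let g := gauss_prod z.

Let zk_neq0 k : z + k%:R != 0.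
Proof.
rewrite -(rmorph_nat (real_complex R)) /z /real_complex_def/= eq_complex/= addr0.
by rewrite negb_and (gt_eqF y0) orbT.
Qed.

Let step (k : nat) : C := k.+1%:R * cexp (z * (ln k.+1%:R - ln k%:R)%:C) / (z + k.+1%:R).

Let gS k : (0 < k)%N -> g k.+1 = g k * step k.
Proof.
move=> k0; rewrite /g /gauss_prod big_ord_recr/= /step factS natrM.
have -> : cpow k.+1%:R z = cpow k%:R z * cexp (z * (ln k.+1%:R - ln k%:R)%:C).
  by rewrite /cpow -cexpD -mulrDr -rmorphD addrC subrK.
rewrite invfM.
by rewrite !mulrA; congr (_ / _); rewrite -!mulrA; ring.
Qed.

Let c : R := expR x * (x ^+ 2 + y ^+ 2 + y ^+ 3 + x * y) + normc z.

Let step_sub1 k : (0 < k)%N -> normc (step k - 1) <= c / k%:R ^+ 2.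
Proof.
move=> k0; have kR : 0 < k%:R :> R by rewrite ltr0n.
pose t : R := ln k.+1%:R - ln k%:R.
have tE : t = ln (1 + k%:R^-1).
  rewrite /t -ln_div ?posrE ?ltr0n//; congr ln.
  by rewrite -addn1 natrD mulrDl mulfV ?gt_eqF// mul1r.
have k1 : 0 < k.+1%:R :> R by rewrite ltr0n.
have t1 : t <= k%:R^-1.
  by rewrite tE le_ln1Dx// (lt_trans (ltrN10 _))// invr_gt0.
have t2 : k.+1%:R^-1 <= t.
  rewrite -[t]opprK lerNr /t opprB -ln_div ?posrE ?ltr0n//.
  have -> : k%:R / k.+1%:R = 1 + - k.+1%:R^-1 :> R.
    have -> : k%:R = k.+1%:R - 1 :> R by rewrite -addn1 natrD addrK.
    by rewrite mulrBl mulfV ?gt_eqF// mul1r.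
  by rewrite le_ln1Dx// ltrN2 invf_lt1// ltr1n ltnS.
have t0 : 0 <= t by apply: le_trans t2; rewrite invr_ge0 ler0n.
have t01 : 0 <= t <= 1.
  by rewrite t0 (le_trans t1)// invf_le1// ler1n.
have T := normc_cexp_taylor x0 (ltW y0) t01.
set e := cexp _ in T.
have kE : (k.+1%:R * t - 1)%:C = k.+1%:R * t%:C - 1 :> C.
  by rewrite -(rmorph_nat (real_complex R)); apply/eqP; rewrite eq_complex /=; apply/andP; split; apply/eqP; ring.
(* The first-order terms cancel because t lies between 1/(k + 1) and 1/k. *)
have sE : step k - 1 = (k.+1%:R * (e - 1 - z * t%:C) + z * (k.+1%:R * t - 1)%:C) / (z + k.+1%:R).
  rewrite /step -/t -/e; apply: (mulIf (zk_neq0 k.+1)).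
  rewrite mulrBl !divfK ?zk_neq0// mul1r kE; ring.
rewrite sE Normc.normcM Normc.normcV.
have den : k.+1%:R <= normc (z + k.+1%:R).
  apply: le_trans (le_Re_normc _).
  rewrite -(rmorph_nat (real_complex R)) /z/= ger0_norm ?addr_ge0 ?ler0n//.
  by rewrite lerDr.
have num : normc (k.+1%:R * (e - 1 - z * t%:C) + z * (k.+1%:R * t - 1)%:C) <=
    k.+1%:R * (c / k%:R ^+ 2).
  apply: le_trans (normcD _ _) _; rewrite !Normc.normcM normc_nat normc_real.
  have h1 : normc (e - 1 - z * t%:C) <= expR x * (x ^+ 2 + y ^+ 2 + y ^+ 3 + x * y) / k%:R ^+ 2.
    apply: le_trans T _; rewrite ler_wpM2l//.
      by rewrite mulr_ge0 ?expR_ge0// !addr_ge0 ?exprn_ge0 ?mulr_ge0// ltW.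
    by rewrite -exprVn lerXn2r ?nnegrE ?invr_ge0 ?ler0n.
  have h2 : `|k.+1%:R * t - 1| <= k.+1%:R / k%:R ^+ 2.
    rewrite ger0_norm; last by rewrite subr_ge0 -ler_pdivrMl// mulr1.
    apply: (@le_trans _ _ k%:R^-1).
      rewrite lerBlDr; apply: (@le_trans _ _ (k.+1%:R * k%:R^-1)); first by rewrite ler_pM2l.
      by rewrite -[k.+1]addn1 natrD mulrDl mulfV ?gt_eqF// mul1r addrC.
    by rewrite expr2 invfM mulrA ler_peMl ?invr_ge0 ?ler0n// ler_pdivlMr// mul1r ler_nat.
  rewrite /c mulrDl mulrDr; apply: lerD; first by rewrite ler_pM2l.
  by rewrite [leRHS]mulrCA; apply: ler_wpM2l => //; exact: normc_ge0.
have c0 : 0 <= k.+1%:R * (c / k%:R ^+ 2) by exact: le_trans (normc_ge0 _) num.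
apply: le_trans (_ : k.+1%:R * (c / k%:R ^+ 2) / k.+1%:R <= _); last first.
  by rewrite mulrAC mulfV ?gt_eqF// mul1r.
apply: ler_pM num _; rewrite ?normc_ge0 ?invr_ge0 ?normc_ge0//.
by rewrite lef_pV2 ?posrE// (lt_le_trans k1).
Qed.

Let c_ge0 : 0 <= c.
Proof. by have := step_sub1 (ltn0Sn 0); rewrite expr1n divr1 => /(le_trans (normc_ge0 _)). Qed.

Let invsq k : (0 < k)%N -> k%:R ^- 2 <= 2 * (k%:R^-1 - k.+1%:R^-1) :> R.
Proof.
move=> k0; have kR : 1 <= k%:R :> R by rewrite ler1n.
have -> : k.+1%:R = k%:R + 1 :> R by rewrite -addn1 natrD.
move: (k%:R : R) kR => a a1.
have -> : 2 * (a^-1 - (a + 1)^-1) = 2 * a / (a + 1) * (a ^+ 2)^-1.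
  by field; rewrite !gt_eqF//; lra.
rewrite ler_peMl ?invr_ge0 ?sqr_ge0// ler_pdivlMr; lra.
Qed.

(** |g_j| exp (2 c / j) is nonincreasing, because |step j| <= exp (c / j^2) and 1/j^2 <= 2/j - 2/(j
    + 1). *)
Let gB k : (0 < k)%N -> normc (g k) <= normc (g 1) * expR (2 * c).
Proof.
move=> k0; pose G j := normc (g j) * expR (2 * c / j%:R).
have Gd j : (0 < j)%N -> G j.+1 <= G j.
  move=> j0; rewrite /G gS// Normc.normcM -mulrA ler_wpM2l ?normc_ge0//.
  have s1 : normc (step j) <= expR (c / j%:R ^+ 2).
    rewrite -(subrK 1 (step j)); apply: le_trans (normcD _ _) _.
    rewrite Normc.normc1 addrC; apply: le_trans (expR_ge1Dx _).
    by rewrite lerD2l step_sub1.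
  apply: le_trans (_ : expR (c / j%:R ^+ 2) * expR (2 * c / j.+1%:R) <= _).
    by rewrite ler_wpM2r ?expR_ge0.
  rewrite -expRD ler_expR; have := ler_wpM2l c_ge0 (invsq j0).
  by move: (j%:R ^- 2) (j%:R^-1) (j.+1%:R^-1) => a1 a2 a3; lra.
have Gle : G k <= G 1%N.
  elim: k k0 => [//|[//|k] ih _]; exact: le_trans (Gd _ _) (ih _).
apply: le_trans (_ : G k <= _).
  rewrite /G ler_peMr ?normc_ge0// -[leLHS]expR0 ler_expR.
  by rewrite divr_ge0 ?ler0n// mulr_ge0.
by apply: le_trans Gle _; rewrite /G divr1.
Qed.

(** The increments are at most a telescoping difference, so that adding 2 B / (k + 1) produces a
    nonincreasing sequence that is bounded below. [f] stands for the real or the imaginary part. *)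
Let cvg_part (f : C -> R) : (forall z w, f (z - w) = f z - f w) ->
  (forall z, `|f z| <= normc z) -> cvgn (fun k => f (g k)).
Proof.
move=> fB fle; pose B := normc (g 1) * expR (2 * c) * c.
have B0 : 0 <= B by rewrite mulr_ge0// mulr_ge0 ?normc_ge0 ?expR_ge0.
have d k : (0 < k)%N -> `|f (g k.+1) - f (g k)| <= 2 * B * (k%:R^-1 - k.+1%:R^-1).
  move=> k0; rewrite -fB; apply: le_trans (fle _) _.
  rewrite gS// -{2}[g k]mulr1 -mulrBr Normc.normcM.
  apply: le_trans (ler_pM (normc_ge0 _) (normc_ge0 _) (gB k0) (step_sub1 k0)) _.
  rewrite mulrA -/B; have := ler_wpM2l B0 (invsq k0).
  by move: (k%:R ^- 2) (k%:R^-1) (k.+1%:R^-1) => a1 a2 a3; rewrite mulrA; lra.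
pose a k := f (g k.+1) + 2 * B / k.+1%:R.
have cvg_a : cvgn a.
  apply: nonincreasing_is_cvgn.
    apply/nonincreasing_seqP => k; rewrite /a.
    have := d k.+1 isT; rewrite ler_norml => /andP[_].
    by move: (k.+1%:R^-1) (k.+2%:R^-1) => a1 a2; lra.
  exists (- (normc (g 1) * expR (2 * c))) => _ [k _ <-].
  rewrite /a; have := le_trans (fle _) (@gB k.+1 isT); rewrite ler_norml => /andP[h _].
  by rewrite -[leLHS]addr0 lerD// divr_ge0 ?ler0n// mulr_ge0.
have cvg_h : (2 * B / k.+1%:R) @[k --> \oo] --> 2 * B * 0.
  by apply: cvgMr; exact: cvg_harmonic.
apply/cvg_ex; exists (limn a - 2 * B * 0); rewrite -cvg_shiftS.
have -> : [sequence f (g k.+1)]_k = (fun k => a k - 2 * B / k.+1%:R).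
  by apply/funext => k; rewrite /a addrK.
exact: cvgB.
Qed.

(** [Gamma] takes the limits of the real and imaginary parts separately; both exist here, so that
    neither is a default value of [lim]. *)
Lemma cvg_normc_gauss_prod : normc (g k) @[k --> \oo] --> normc (Gamma z).
Proof.
have cR : cvgn (fun k => Re (g k)).
  by apply: cvg_part; [move=> [a b] [c' d]|exact: le_Re_normc].
have cI : cvgn (fun k => Im (g k)).
  by apply: cvg_part; [move=> [a b] [c' d]|exact: le_Im_normc].
have -> : (fun k => normc (g k)) = (fun k => Num.sqrt (Re (g k) ^+ 2 + Im (g k) ^+ 2)).
  by apply/funext => k; case: (g k).
rewrite /Gamma /=; apply: continuous_cvg; first exact: sqrt_continuous.
by rewrite !expr2; under eq_fun do rewrite !expr2; apply: cvgD; apply: cvgM.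
Qed.

Lemma normc_gauss_prod k : normc (g k) =
  k`!%:R * expR (x * ln k%:R) / \prod_(j < k.+1) Num.sqrt ((x + j%:R) ^+ 2 + y ^+ 2).
Proof.
rewrite /g /gauss_prod Normc.normcM Normc.normcV Normc.normcM normc_nat normc_cpow.
congr (_ / _); rewrite (normc_prod _ (fun j => z + j%:R)); apply: eq_bigr => j _.
by rewrite -(rmorph_nat (real_complex R)) /= addr0.
Qed.

Lemma normc_gauss_prod_sqr k : normc (g k) ^+ 2 =
  k`!%:R ^+ 2 * expR (2 * x * ln k%:R) / \prod_(j < k.+1) ((x + j%:R) ^+ 2 + y ^+ 2).
Proof.
rewrite normc_gauss_prod exprMn exprVn exprMn; congr (_ * _ / _).
  by rewrite -mulrA expRM_natl.
rewrite -prodrXl; apply: eq_bigr => j _; rewrite sqr_sqrtr//.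
by rewrite addr_ge0 ?sqr_ge0.
Qed.

End GaussProduct.

(** * Comparison of Gauss products at half-integers *)

Section HalfIntegerProducts.
Context {R : realType} (lam : R).
Hypothesis lam0 : 0 < lam.

(** Four times |j/2 + i lam|^2. Up to a power of 4, [qprod k q] is thus the squared modulus of the
    denominator of Gauss's product at q/2 + i lam, see [gauss_half]. *)
Definition qfac (j : nat) : R := j%:R ^+ 2 + 4 * lam ^+ 2.
Definition qprod (k q : nat) : R := \prod_(i < k.+1) qfac (2 * i + q).

Lemma qfac_gt0 j : 0 < qfac j.
Proof. by rewrite /qfac ltr_wpDl ?sqr_ge0// mulr_gt0// exprn_gt0. Qed.

Lemma qprod_gt0 k q : 0 < qprod k q.
Proof. by apply: prodr_gt0 => i _; exact: qfac_gt0. Qed.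

Lemma qprodS k q : qprod k.+1 q = qprod k q * qfac (2 * k.+1 + q).
Proof. by rewrite /qprod big_ord_recr. Qed.

Lemma qprod_shift k q : qprod k q.+2 * qfac q = qprod k q * qfac (2 * k.+1 + q).
Proof.
elim: k => [|k ih].
  by rewrite /qprod !big_ord1 muln0 muln1 !add0n add2n mulrC.
rewrite !qprodS mulrAC ih; congr (_ * qfac _).
by rewrite !addnS [in RHS]mulnS add2n !addSn.
Qed.

(* (j - 1)^2 + L and (j + 1)^2 + L multiply to (j^2 + L + 1)^2 - 4 j^2. *)
Lemma qfac_log_concave j : qfac j * qfac j.+2 <= (qfac j.+1 * (1 + (j.+1%:R ^+ 2)^-1)) ^+ 2.
Proof.
have j1 : 0 < j.+1%:R :> R by rewrite ltr0n.
apply: (@le_trans _ _ ((qfac j.+1 + 1) ^+ 2)).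
  rewrite /qfac; have -> : j.+2%:R = j.+1%:R + 1 :> R by rewrite -[j.+2]addn1 natrD.
  have -> : j%:R = j.+1%:R - 1 :> R by rewrite -addn1 natrD addrK.
  move: (j.+1%:R : R) j1 => a a0; have := sqr_ge0 a; nra.
have f0 := ltW (qfac_gt0 j.+1).
have i0 : 0 <= (j.+1%:R ^+ 2)^-1 :> R by rewrite invr_ge0 sqr_ge0.
have n1 : 0 <= qfac j.+1 + 1 by exact: addr_ge0.
have n2 : 0 <= qfac j.+1 * (1 + (j.+1%:R ^+ 2)^-1) by exact: mulr_ge0 f0 (addr_ge0 ler01 i0).
rewrite lerXn2r ?nnegrE//.
rewrite mulrDr mulr1 lerD2l /qfac mulrDl mulfV ?gt_eqF ?exprn_gt0//.
by rewrite lerDl; exact: mulr_ge0 (mulr_ge0 (ler0n _ 4) (sqr_ge0 _)) i0.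
Qed.

(** The term 4 / (k + 2) makes the induction close; what is used later is the bound 4. *)
Lemma prod_invsq_le k : \prod_(i < k.+1) (1 + ((2 * i + 1)%:R ^+ 2)^-1) <= 4 - 4 / k.+2%:R :> R.
Proof.
elim: k => [|k ih]; first by rewrite big_ord1 muln0 add0n expr1n invr1; lra.
rewrite big_ord_recr/=; have k0 : 0 <= k%:R :> R by rewrite ler0n.
apply: le_trans (ler_wpM2r _ ih) _; first by rewrite addr_ge0 ?invr_ge0 ?sqr_ge0.
have -> : (2 * k.+1 + 1)%:R = 2 * k%:R + 3 :> R.
  by rewrite natrD natrM -addn1 natrD; ring.
have -> : k.+2%:R = k%:R + 2 :> R by rewrite -addn2 natrD.
have -> : k.+3%:R = k%:R + 3 :> R by rewrite -addn3 natrD.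
move: (k%:R : R) k0 => a a0.
rewrite -subr_ge0.
have -> : 4 - 4 / (a + 3) - (4 - 4 / (a + 2)) * (1 + ((2 * a + 3) ^+ 2)^-1) =
    4 * (3 * a ^+ 2 + 8 * a + 6) / ((a + 2) * (a + 3) * (2 * a + 3) ^+ 2).
  by field; rewrite !gt_eqF//; lra.
by rewrite divr_ge0// ?mulr_ge0 ?sqr_ge0//; have := sqr_ge0 a; lra.
Qed.

(** Log-concavity in q up to a constant: [qfac_log_concave] is multiplied over i, and the
    corrections, enlarged to 1 + 1/(2 i + 1)^2, have product at most 4. *)
Lemma qprod_log_concave k q : qprod k q * qprod k q.+2 <= 16 * qprod k q.+1 ^+ 2.
Proof.
have -> : qprod k q * qprod k q.+2 = \prod_(i < k.+1) (qfac (2 * i + q) * qfac (2 * i + q).+2).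
  by rewrite -big_split/=; apply: eq_bigr => i _; rewrite !addnS.
apply: (@le_trans _ _ (\prod_(i < k.+1)
    (qfac (2 * i + q).+1 * (1 + ((2 * i + 1)%:R ^+ 2)^-1)) ^+ 2)).
  apply: ler_prod => i _; rewrite mulr_ge0 ?(ltW (qfac_gt0 _))//=.
  apply: le_trans (qfac_log_concave _) _.
  have f0 := ltW (qfac_gt0 (2 * i + q).+1).
  have i0 j : 0 <= (j%:R ^+ 2)^-1 :> R by rewrite invr_ge0 sqr_ge0.
  have n j : 0 <= qfac (2 * i + q).+1 * (1 + (j%:R ^+ 2)^-1).
    exact: mulr_ge0 f0 (addr_ge0 ler01 (i0 j)).
  rewrite lerXn2r ?nnegrE//.
  rewrite ler_pM2l ?qfac_gt0// lerD2l lef_pV2 ?posrE ?exprn_gt0 ?ltr0n ?addn1//.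
  by rewrite lerXn2r ?nnegrE ?ler0n// ler_nat ltnS leq_addr.
rewrite prodrXl big_split/= exprMn mulrC.
have -> : \prod_(i < k.+1) qfac (2 * i + q).+1 = qprod k q.+1.
  by apply: eq_bigr => i _; rewrite addnS.
rewrite ler_wpM2r ?sqr_ge0//.
have -> : 16 = 4 ^+ 2 :> R by ring.
have p0 : 0 <= \prod_(i < k.+1) (1 + ((2 * i + 1)%:R ^+ 2)^-1) :> R.
  by apply: prodr_ge0 => i _; rewrite addr_ge0 ?invr_ge0 ?sqr_ge0.
rewrite lerXn2r ?nnegrE//.
by apply: le_trans (prod_invsq_le k) _; rewrite gerBl divr_ge0 ?ler0n.
Qed.

(** In the limit this says |Gamma ((q + 1)/2 + i lam)|^2 <= C (1 + lam) |Gamma (q/2 + i lam)|^2.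
    Log-concavity bounds [qprod k q * qprod k q.+2], and [qprod_shift] expresses the second factor
    through the first. *)
Lemma qprod_step k q :
  qprod k q * k.+1%:R <= 2 * q.+2%:R * (1 + lam) * qprod k q.+1.
Proof.
have q0 := qprod_gt0 k q; have q1 := qprod_gt0 k q.+1; have q2 := qprod_gt0 k q.+2.
have l1 : 0 < 1 + lam by rewrite addr_gt0.
have n1 : 0 <= qprod k q * k.+1%:R by exact: mulr_ge0 (ltW q0) (ler0n _ _).
have n2 : 0 <= 2 * q.+2%:R * (1 + lam) * qprod k q.+1.
  exact: mulr_ge0 (mulr_ge0 (mulr_ge0 (ler0n _ 2) (ler0n _ _)) (ltW l1)) (ltW q1).
rewrite -(@ler_pXn2r _ 2) ?nnegrE//.
have h := qprod_log_concave k q; have hs := qprod_shift k q.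
have F1 : 4 * k.+1%:R ^+ 2 <= qfac (2 * k.+1 + q).
  rewrite /qfac natrD natrM; have := ler0n R q; have := ler0n R k.+1; have := sqr_ge0 lam.
  move: (q%:R : R) (k.+1%:R : R) => a b' h1 h2 h3; have := mulr_ge0 h2 h3; nra.
have F2 : qfac q <= q.+2%:R ^+ 2 * (1 + lam) ^+ 2.
  have -> : q.+2%:R = q%:R + 2 :> R by rewrite -addn2 natrD.
  rewrite /qfac; have := ler0n R q; move: (q%:R : R) => a a0.
  have := mulr_ge0 a0 (ltW lam0); have := mulr_ge0 (sqr_ge0 a) (ltW lam0).
  have := mulr_ge0 (sqr_ge0 a) (sqr_ge0 lam); have := mulr_ge0 a0 (sqr_ge0 lam).
  by have := lam0; nra.
have qf := qfac_gt0 q.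
have h1 : qprod k q ^+ 2 * qfac (2 * k.+1 + q) <= 16 * qprod k q.+1 ^+ 2 * qfac q.
  have -> : qprod k q ^+ 2 * qfac (2 * k.+1 + q) = qprod k q * qprod k q.+2 * qfac q.
    by rewrite -mulrA hs; ring.
  by rewrite ler_pM2r.
have h2 := ler_wpM2l (sqr_ge0 (qprod k q)) F1.
have h3 := ler_wpM2l (mulr_ge0 (ler0n R 16) (sqr_ge0 (qprod k q.+1))) F2.
rewrite !exprMn; lra.
Qed.

Definition qconst (q m : nat) : R := \prod_(i < m) (2 * (q + i).+2%:R).

Lemma qconst_gt0 q m : 0 < qconst q m.
Proof. by apply: prodr_gt0 => i _; rewrite mulr_gt0 ?ltr0n. Qed.

Lemma qprod_iter k q m :
  qprod k q * k.+1%:R ^+ m <= qconst q m * (1 + lam) ^+ m * qprod k (q + m).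
Proof.
elim: m => [|m ih]; first by rewrite /qconst big_ord0 !expr0 addn0 !mulr1 mul1r.
have l1 : 0 < 1 + lam by rewrite addr_gt0.
have C0 := qconst_gt0 q m.
rewrite exprSr mulrA; apply: le_trans (ler_wpM2r (ler0n _ _) ih) _.
have S := qprod_step k (q + m).
have := ler_wpM2l (mulr_ge0 (ltW C0) (exprn_ge0 m (ltW l1))) S.
rewrite /qconst big_ord_recr/= -/(qconst q m) exprSr addnS.
lra.
Qed.

(** Equivalent to binomial (2 k, k) >= 4^k / (2 sqrt k); it takes the place of the constant in the
    duplication formula. *)
Lemma central_factorial k : (0 < k)%N ->
  16 ^+ k * k`!%:R ^+ 4 <= 4 * k%:R * (2 * k)`!%:R ^+ 2 :> R.
Proof.
elim: k => [//|[_ _|k ih _]]; first by rewrite (_ : (2 * 1)`! = 2)// (_ : 1`! = 1)// expr1n !mulr1 expr1; lra.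
have {}ih := ih isT; have: (0 < k.+1)%N by [].
move: k.+1 ih => a ih a0.
have aR : 0 < a%:R :> R by rewrite ltr0n.
have -> : (2 * a.+1)`! = ((2 * a).+2 * ((2 * a).+1 * (2 * a)`!))%N by rewrite mulnS add2n !factS.
rewrite (factS a) (exprS 16 a) !natrM.
have -> : (2 * a).+2%:R = 2 * (a%:R + 1) :> R by rewrite -addn2 natrD natrM; ring.
have -> : (2 * a).+1%:R = 2 * a%:R + 1 :> R by rewrite -addn1 natrD natrM.
have -> : a.+1%:R = a%:R + 1 :> R by rewrite -addn1 natrD.
move: (a%:R : R) (16 ^+ a) (a`!%:R : R) ((2 * a)`!%:R : R) aR ih => x y z w x0 ih.
apply: (@le_trans _ _ (16 * (x + 1) ^+ 4 * (4 * x * w ^+ 2))).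
  rewrite [leLHS](_ : _ = 16 * (x + 1) ^+ 4 * (y * z ^+ 4)); last by ring.
  by rewrite ler_wpM2l// mulr_ge0 ?exprn_ge0// addr_ge0// ltW.
rewrite -subr_ge0 [leRHS](_ : _ = 16 * (x + 1) ^+ 3 * w ^+ 2); last by ring.
exact: mulr_ge0 (mulr_ge0 (ler0n _ 16) (exprn_ge0 3 (addr_ge0 (ltW x0) ler01))) (sqr_ge0 w).
Qed.

Lemma odd_factorial k : (0 < k)%N ->
  16 ^+ k * k`!%:R ^+ 4 * k%:R <= (2 * k).+1`!%:R ^+ 2 :> R.
Proof.
move=> k0; have h := central_factorial k0; have kR : 0 < k%:R :> R by rewrite ltr0n.
rewrite factS natrM exprMn.
have -> : (2 * k).+1%:R = 2 * k%:R + 1 :> R by rewrite -addn1 natrD natrM.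
move: (k%:R : R) (16 ^+ k) (k`!%:R : R) ((2 * k)`!%:R : R) kR h => x y z w x0 h.
apply: (@le_trans _ _ (4 * x * w ^+ 2 * x)); first by rewrite ler_wpM2r// ltW.
by have := sqr_ge0 w; have := mulr_ge0 (ltW x0) (sqr_ge0 w); nra.
Qed.

Lemma gauss_half k m : (0 < k)%N ->
  Normc.normc (gauss_prod (Complex (m%:R / 2) lam) k) ^+ 2 =
  k`!%:R ^+ 2 * k%:R ^+ m * 4 ^+ k.+1 / qprod k m.
Proof.
move=> k0; have kR : 0 < k%:R :> R by rewrite ltr0n.
rewrite normc_gauss_prod_sqr//.
have -> : expR (2 * (m%:R / 2) * ln k%:R) = k%:R ^+ m :> R.
  have -> : 2 * (m%:R / 2) = m%:R :> R by field.
  by rewrite expRM_natl lnK.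
have -> : \prod_(j < k.+1) ((m%:R / 2 + j%:R) ^+ 2 + lam ^+ 2) = qprod k m / 4 ^+ k.+1.
  apply: (mulIf (_ : 4 ^+ k.+1 != 0)); first by rewrite expf_neq0.
  rewrite divfK ?expf_neq0// /qprod.
  transitivity (\prod_(j < k.+1) (((m%:R / 2 + j%:R) ^+ 2 + lam ^+ 2) * 4)).
    by rewrite big_split/= big_const_ord iter_mulr_1.
  by apply: eq_bigr => j _; rewrite /qfac natrD natrM; field.
by rewrite invfM invrK; ring.
Qed.

Lemma prod_even_odd k : \prod_(j < (2 * k).+2) qfac j = qprod k 0 * qprod k 1.
Proof.
elim: k => [|k ih]; first by rewrite /qprod !big_ord1 muln0 !big_ord_recr big_ord0 /= mul1r.
have -> : (2 * k.+1 = (2 * k).+2)%N by rewrite mulnS add2n.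
rewrite big_ord_recr big_ord_recr/= ih !qprodS addn0 addn1.
have -> : (2 * k.+1 = (2 * k).+2)%N by rewrite mulnS add2n.
by ring.
Qed.

(* At a purely imaginary point, 2k+1 factors are used so that the product splits into even and
   odd indices, as in the duplication formula. *)
Lemma gauss_imaginary k :
  Normc.normc (gauss_prod (Complex 0 (2 * lam)) (2 * k).+1) ^+ 2 =
  (2 * k).+1`!%:R ^+ 2 / (qprod k 0 * qprod k 1).
Proof.
rewrite normc_gauss_prod_sqr ?mulr_gt0// mulr0 mul0r expR0 mulr1 -prod_even_odd.
by congr (_ / _); apply: eq_bigr => j _; rewrite add0r exprMn /qfac; ring.
Qed.

(** The denominators are the [qprod] of indices l + m and l + 1 on the left, 0 and 1 on the right.
    Raising the index from 1 to l + 1 and from 2 to l + m costs 2 l + m - 2 powers of 1 + lam,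
    raising it from 0 to 2 a factor lam^2. The 16 comes from the two factors 4^(k + 1). *)
Lemma gauss_ratio k l m : (0 < k)%N -> (0 < l)%N -> (0 < m)%N ->
  Normc.normc (gauss_prod (Complex ((l + m)%:R / 2) lam) k) ^+ 2 *
  Normc.normc (gauss_prod (Complex (l.+1%:R / 2) lam) k) ^+ 2 <=
  16 * (qconst 1 l * qconst 2 (l + m - 2)) * (lam ^+ 2 * (1 + lam) ^+ (2 * l + m - 2)) *
  Normc.normc (gauss_prod (Complex 0 (2 * lam)) (2 * k).+1) ^+ 2.
Proof.
move=> k0 l0 m0; rewrite (gauss_half (l + m) k0) (gauss_half l.+1 k0) (gauss_imaginary k).
have lm : (2 <= l + m)%N by rewrite -[2%N]/(1 + 1)%N leq_add.
have kR : 0 < k%:R :> R by rewrite ltr0n.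
have k1R : 0 < k.+1%:R :> R by rewrite ltr0n.
have l1 : 0 < 1 + lam by rewrite addr_gt0.
have h1 := qprod_iter k 1 l; rewrite add1n in h1.
have h2 := qprod_iter k 2 (l + m - 2); rewrite subnKC// in h2.
(* [qfac 0] is 4 lam^2, the trace of the pole of Gamma (2 i lam) at lam = 0; it makes the bound
   vanish to second order there. *)
have h0 : qprod k 0 * k.+1%:R ^+ 2 <= lam ^+ 2 * qprod k 2.
  have := qprod_shift k 0; rewrite addn0 /(qfac 0) expr0n/= add0r => hs.
  have : qprod k 0 * (4 * k.+1%:R ^+ 2) <= qprod k 0 * qfac (2 * k.+1).
    rewrite ler_pM2l ?qprod_gt0// /qfac natrM exprMn.
    by have := sqr_ge0 lam; have := sqr_ge0 (k.+1%:R : R); lra.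
  by rewrite -hs; lra.
have c1 := qconst_gt0 1 l; have c2 := qconst_gt0 2 (l + m - 2).
have D k' q := qprod_gt0 k' q.
set p := (2 * l + m)%N.
have pE : k.+1%:R ^+ p = k.+1%:R ^+ 2 * k.+1%:R ^+ l * k.+1%:R ^+ (l + m - 2) :> R.
  rewrite -!exprD; congr (_ ^+ _); rewrite /p -addnA addnCA subnKC//.
  by rewrite mul2n -addnn addnA.
have p2E : (1 + lam) ^+ (p - 2) = (1 + lam) ^+ l * (1 + lam) ^+ (l + m - 2).
  by rewrite -exprD addnBA// /p mul2n -addnn addnA.
have key : qprod k 0 * qprod k 1 * k.+1%:R ^+ p <=
  qconst 1 l * qconst 2 (l + m - 2) * (lam ^+ 2 * (1 + lam) ^+ (p - 2)) *
  (qprod k l.+1 * qprod k (l + m)).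
  have a1 := ler_pM (mulr_ge0 (ltW (D k 0)) (sqr_ge0 _)) (mulr_ge0 (ltW (D k 1)) (exprn_ge0 l (ltW k1R))) h0 h1.
  have a2 := ler_wpM2r (exprn_ge0 (l + m - 2) (ltW k1R)) a1.
  rewrite pE; apply: le_trans (_ : _ <= lam ^+ 2 * qprod k 2 *
    (qconst 1 l * (1 + lam) ^+ l * qprod k l.+1) * k.+1%:R ^+ (l + m - 2)) _.
    by apply: le_trans a2; rewrite le_eqVlt; apply/orP; left; apply/eqP; ring.
  have c0 : 0 <= lam ^+ 2 * (qconst 1 l * (1 + lam) ^+ l * qprod k l.+1).
    exact: mulr_ge0 (sqr_ge0 _) (mulr_ge0 (mulr_ge0 (ltW c1) (exprn_ge0 _ (ltW l1))) (ltW (D _ _))).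
  have := ler_wpM2l c0 h2; rewrite p2E; lra.
have of_ := odd_factorial k0.
have kk : k%:R ^+ p.+1 <= k.+1%:R ^+ p * k%:R :> R.
  by rewrite exprSr ler_wpM2r ?(ltW kR)// lerXn2r ?nnegrE ?ler0n// ler_nat.
have DD : 0 < qprod k l.+1 * qprod k (l + m) by rewrite mulr_gt0.
have D01 : 0 < qprod k 0 * qprod k 1 by rewrite mulr_gt0.
rewrite [leRHS]mulrA ler_pdivlMr//.
have -> : k`!%:R ^+ 2 * k%:R ^+ (l + m) * 4 ^+ k.+1 / qprod k (l + m) *
   (k`!%:R ^+ 2 * k%:R ^+ l.+1 * 4 ^+ k.+1 / qprod k l.+1) * (qprod k 0 * qprod k 1)
   = 16 * (16 ^+ k * k`!%:R ^+ 4 * k%:R ^+ p.+1 * (qprod k 0 * qprod k 1)) / (qprod k l.+1 * qprod k (l + m)).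
  have e16 : 16 ^+ k = 4 ^+ k * 4 ^+ k :> R by rewrite -exprMn; congr (_ ^+ _); ring.
  have ep : k%:R ^+ p.+1 = k%:R ^+ (l + m) * k%:R ^+ l.+1 :> R.
    by rewrite -exprD; congr (_ ^+ _); rewrite addnS /p mul2n -addnn addnAC.
  rewrite e16 ep !exprSr; field.
  by rewrite !gt_eqF.
rewrite ler_pdivrMr//.
set CC := qconst 1 l * _ in key *; set W := lam ^+ 2 * _ in key *.
have f0 : 0 <= 16 ^+ k * k`!%:R ^+ 4 :> R by rewrite mulr_ge0 ?exprn_ge0 ?ler0n.
apply: (@le_trans _ _ (16 * (16 ^+ k * k`!%:R ^+ 4 * k%:R * (qprod k 0 * qprod k 1 * k.+1%:R ^+ p)))).
  rewrite ler_pM2l//; have := ler_wpM2l f0 (ler_wpM2r (ltW D01) kk).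
  by rewrite -[X in _ <= X -> _]mulrA => /le_trans h3; rewrite -mulrA; apply: h3; rewrite le_eqVlt; apply/orP; left; apply/eqP; ring.
have CW : 0 <= CC * W * (qprod k l.+1 * qprod k (l + m)).
  exact: mulr_ge0 (mulr_ge0 (mulr_ge0 (ltW c1) (ltW c2)) (mulr_ge0 (sqr_ge0 _) (exprn_ge0 _ (ltW l1)))) (ltW DD).
have := ler_pM (mulr_ge0 f0 (ltW kR)) (mulr_ge0 (ltW D01) (exprn_ge0 p (ltW k1R))) of_ key.
lra.
Qed.

End HalfIntegerProducts.

Section Plancherel.
Local Open Scope complex_scope.
Context {R : realType} {mv mz : nat} (h : htype R mv mz).
Local Notation C := R[i].
Local Notation normc := (@Normc.normc R).

Lemma normc_Gamma_ratio (lam : R) l m : 0 < lam -> (0 < l)%N -> (0 < m)%N ->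
  normc (Gamma (((l + m)%:R / 2) +i* lam)) ^+ 2 * normc (Gamma ((l.+1%:R / 2) +i* lam)) ^+ 2 <=
  16 * (qconst 1 l * qconst 2 (l + m - 2)) * (lam ^+ 2 * (1 + lam) ^+ (2 * l + m - 2)) *
  normc (Gamma (0 +i* (2 * lam))) ^+ 2.
Proof.
move=> lam0 l0 m0.
have cv (x y : R) : 0 <= x -> 0 < y ->
    normc (gauss_prod (x +i* y) k) ^+ 2 @[k --> \oo] --> normc (Gamma (x +i* y)) ^+ 2.
  move=> x0 y0; have c := cvg_normc_gauss_prod x0 y0.
  by rewrite expr2; under eq_fun do rewrite expr2; exact: cvgM.
have q0 j : 0 <= j%:R / 2 :> R by rewrite divr_ge0 ?ler0n.
have ca := cvgM (cv _ _ (q0 (l + m)%N) lam0) (cv _ _ (q0 l.+1) lam0).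
have cb : normc (gauss_prod (0 +i* (2 * lam)) (2 * k).+1) ^+ 2 @[k --> \oo] -->
    normc (Gamma (0 +i* (2 * lam))) ^+ 2.
  have c2 := cv 0 (2 * lam) (lexx _) (mulr_gt0 (ltr0Sn _ 1) lam0).
  apply: (cvg_comp _ _ _ c2).
  apply/cvgnyPge => A; near=> k; apply: (@leq_trans k); first by near: k; exact: nbhs_infty_ge.
  by rewrite leqW// leq_pmull.
set B := _ * (lam ^+ 2 * _).
have cb' : B * normc (gauss_prod (0 +i* (2 * lam)) (2 * k).+1) ^+ 2 @[k --> \oo] -->
    B * normc (Gamma (0 +i* (2 * lam))) ^+ 2 by exact: cvgMr cb.
apply: (ler_cvg_to (ca _) cb'); near=> k.
by apply: gauss_ratio => //; near: k; exact: nbhs_infty_gt.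
Unshelve. all: by end_near. Qed.

(** As mv = 2 l, the arguments rho + i lam and (mv + 4 i lam + 2)/4 are (l + mz)/2 + i lam and (l +
    1)/2 + i lam, which is the situation of [normc_Gamma_ratio]. *)
Lemma plancherel_bound : exists2 B : R, 0 <= B & forall lam, 0 < lam ->
  @plancherel R mv mz lam <= B * (lam ^+ 2 * (1 + lam) ^+ (mv + mz - 2)).
Proof.
pose l := mv./2; have mvE : mv = (2 * l)%N by rewrite mul2n even_halfK ?(mv_even h).
have l0 : (0 < l)%N by have := mv_gt0 h; rewrite mvE muln_gt0 => /andP[].
have m0 := mz_gt0 h.
pose c4 := expR (@rho R mv mz * ln 4).
pose cn := normc (Gamma ((mv + mz + 1)%:R / 2 : C)).
have Q0 : 0 <= 16 * (qconst 1 l * qconst 2 (l + mz - 2)) :> R.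
  exact: mulr_ge0 (ler0n _ 16) (mulr_ge0 (ltW (qconst_gt0 _ _)) (ltW (qconst_gt0 _ _))).
have I0 : 0 <= ((c4 * cn) ^+ 2)^-1 by rewrite invr_ge0 sqr_ge0.
exists (((c4 * cn) ^+ 2)^-1 * (16 * (qconst 1 l * qconst 2 (l + mz - 2)))).
  exact: mulr_ge0.
move=> lam lam0; have := normc_Gamma_ratio lam0 l0 m0; rewrite -mvE.
set ga := normc _; set gb := normc _; set g2 := normc _ => hr.
have -> : @plancherel R mv mz lam = ((c4 * cn) ^+ 2)^-1 * (ga ^+ 2 * gb ^+ 2 / g2 ^+ 2).
  have e1 : normc (cpow 4 ((@rho R mv mz)%:C - 0 +i* lam)) = c4.
    by rewrite normc_cpow /= subr0.
  have e2 : 2 * (0 +i* lam) = 0 +i* (2 * lam) :> C.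
    rewrite -[2]/(2%:R) -(rmorph_nat (real_complex R)).
    by apply/eqP; rewrite eq_complex /=; apply/andP; split; apply/eqP; ring.
  have e3 : (@rho R mv mz)%:C + 0 +i* lam = ((l + mz)%:R / 2) +i* lam :> C.
    apply/eqP; rewrite eq_complex /= add0r eqxx andbT addr0 /rho mvE natrM natrD.
    by apply/eqP; field.
  have e4 : ((mv%:R + 4 * (0 +i* lam) + 2) / 4 : C) = (l.+1%:R / 2) +i* lam.
    apply: (mulIf (_ : 4 != 0 :> C)); first by rewrite pnatr_eq0.
    rewrite divfK ?pnatr_eq0// mvE -!(rmorph_nat (real_complex R)).
    apply/eqP; rewrite eq_complex /=; apply/andP; split; apply/eqP.
      by rewrite natrM -addn1 natrD; field.
    by ring.
  rewrite /plancherel /cfun e2 e3 e4 !(Normc.normcM, Normc.normcV) e1 -/ga -/gb -/g2 -/cn.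
  by rewrite !(exprMn, exprVn, invfM, invrK); ring.
(* Were Gamma (2 i lam) zero, the left side would be 0, since the inverse of 0 is 0. *)
have [g20|g20] := eqVneq g2 0.
  rewrite g20 expr0n/= invr0 !mulr0; apply: mulr_ge0 (mulr_ge0 I0 Q0) _.
  by rewrite mulr_ge0 ?sqr_ge0// exprn_ge0// addr_ge0// ltW.
rewrite -[leRHS]mulrA ler_wpM2l// ler_pdivrMr//.
by rewrite exprn_gt0// lt_def g20 normc_ge0.
Qed.

End Plancherel.

(** * Lower integrals *)

Section LowerIntegral.
Local Open Scope ereal_scope.
Context d (T : measurableType d) (R : realType) (mu : {measure set T -> \bar R}).
Implicit Types (D : set T) (f g h : T -> \bar R).

Import HBNNSimple.

(* The integral of a nonnegative function is a supremum over measurable simple functions,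
   so that monotonicity needs no measurability. *)
Lemma le_integral_nonneg D f g : (forall x, D x -> 0 <= f x) ->
  (forall x, D x -> f x <= g x) -> \int[mu]_(x in D) f x <= \int[mu]_(x in D) g x.
Proof.
move=> f0 fg; rewrite !ge0_integralE//; last by move=> x Dx; apply: le_trans (fg _ Dx); exact: f0.
apply: ereal_sup_le => _ [s /= sf <-]; exists s => // x.
apply: le_trans (sf x) _; rewrite /patch; case: ifPn => // /[!inE] Dx.
exact: fg.
Qed.

(** For a simple function s <= f + h, the function max (s - h, 0) is measurable and lies below f;
    this is where h has to be measurable and finite. *)
Lemma le_integralD_nonneg D f h : measurable D -> (forall x, D x -> 0 <= f x) ->
  (forall x, D x -> 0 <= h x) -> (forall x, D x -> h x \is a fin_num) -> measurable_fun D h ->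
  \int[mu]_(x in D) (f x + h x) <= \int[mu]_(x in D) f x + \int[mu]_(x in D) h x.
Proof.
move=> mD f0 h0 hfin mh.
rewrite [leLHS]ge0_integralE; last by move=> x Dx; rewrite adde_ge0 ?f0 ?h0.
apply: ge_ereal_sup => _ [s /= sfh <-].
pose k := h \_ D.
have k0 x : 0 <= k x by rewrite /k /patch; case: ifPn => // /[!inE] /h0.
have kfin x : k x \is a fin_num by rewrite /k /patch; case: ifPn => // /[!inE] /hfin.
have mk : measurable_fun setT k by apply/(measurable_restrictT _ _).1.
have ms : measurable_fun setT (EFin \o s) by apply/measurable_EFinP; exact: measurable_funP.
pose m x := maxe ((s x)%:E - k x) 0.
have mm : measurable_fun setT m.
  apply: measurable_maxe; last exact: measurable_cst.
  exact: emeasurable_funB.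
have m0 x : 0 <= m x by rewrite le_max lexx orbT.
have mf x : m x <= (f \_ D) x.
  rewrite /m ge_max; have := sfh x; rewrite /k /patch; case: ifPn => [/[!inE] Dx sx|_ sx].
    by rewrite f0// andbT leeBlDr// hfin.
  by rewrite sube0 lexx andbT.
have -> : sintegral mu s = \int[mu]_x (s x)%:E.
  by rewrite integral_nnsfun// patch_setT.
have -> : \int[mu]_(x in D) h x = \int[mu]_x k x by rewrite /k -integral_mkcond.
apply: (@le_trans _ _ (\int[mu]_x (m x + k x))).
  apply: le_integral_nonneg => x _; first by rewrite lee_fin.
  by rewrite -leeBlDr// /m le_max lexx.
rewrite ge0_integralD//; apply: leeD => //.
rewrite [leRHS]integral_mkcond; apply: le_integral_nonneg => //.
Qed.

(** A simple function below c f is c times a simple function below f. *)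
Lemma le_integralZ_nonneg D f (c : R) : (0 < c)%R -> (forall x, D x -> 0 <= f x) ->
  \int[mu]_(x in D) (c%:E * f x) <= c%:E * \int[mu]_(x in D) f x.
Proof.
move=> c0 f0; have ci0 : (0 <= c^-1)%R by rewrite invr_ge0 ltW.
rewrite [leLHS]ge0_integralE; last by move=> x Dx; rewrite mule_ge0 ?lee_fin ?f0// ltW.
apply: ge_ereal_sup => _ [s /= sf <-].
have -> : sintegral mu s = c%:E * sintegral mu (scale_nnsfun s ci0).
  by rewrite sintegralrM muleA -EFinM mulfV ?gt_eqF// mul1e.
apply: lee_wpmul2l; first by rewrite lee_fin ltW.
rewrite ge0_integralE//; apply: ereal_sup_ubound; exists (scale_nnsfun s ci0) => // x /=.
have := sf x; rewrite /patch; case: ifPn => [_|_]; last first.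
  by rewrite !lee_fin => h; rewrite pmulr_rle0// invr_gt0.
by rewrite EFinM lee_pdivrMl.
Qed.

End LowerIntegral.

Section RealIntegrals.
Context d (T : measurableType d) (R : realType) (mu : {measure set T -> \bar R}).
Implicit Types (D : set T) (f g h : T -> R) (B : R).

Let abs_integrable D f := (\int[mu]_(x in D) `|f x|%:E)%E.

(** The positive and negative parts both have integral in [0, B], so that [fine] meets no infinite
    value and the difference stays in [-B, B]. *)
Lemma le_norm_Rintegral D f B : (abs_integrable D f <= B%:E)%E ->
  `|\int[mu]_(x in D) f x| <= B.
Proof.
move=> fB; rewrite /Rintegral integralE.
set F := fun x => (f x)%:E.
have p0 : (0 <= \int[mu]_(x in D) (F^\+ x))%E by apply: integral_ge0 => x _; exact: funepos_ge0.
have n0 : (0 <= \int[mu]_(x in D) (F^\- x))%E by apply: integral_ge0 => x _; exact: funeneg_ge0.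
have pB : (\int[mu]_(x in D) (F^\+ x) <= B%:E)%E.
  apply: le_trans fB; apply: le_integral_nonneg => x _; first exact: funepos_ge0.
  by rewrite /F funeposE -EFin_max lee_fin ge_max ler_norm normr_ge0.
have nB : (\int[mu]_(x in D) (F^\- x) <= B%:E)%E.
  apply: le_trans fB; apply: le_integral_nonneg => x _; first exact: funeneg_ge0.
  by rewrite /F funenegE -EFinN -EFin_max lee_fin ge_max normr_ge0 -normrN ler_norm.
move: p0 n0 pB nB; case: (integral _ _ _) => [p| |] //; case: (integral _ _ _) => [q| |] //.
rewrite !lee_fin /= => p0 q0 pB qB; rewrite ler_norml; apply/andP; split; lra.
Qed.

(** Stands for linearity when [f] and [g] may fail to be measurable, the majorant [h] of their
    difference being measurable. Positive and negative parts are compared separately, which gives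
    the factor 2; [C] makes all four integrals finite, so that [fine] loses nothing. *)
Lemma le_norm_RintegralB D f g h B C : measurable D -> measurable_fun D h ->
  (forall x, D x -> `|f x - g x| <= h x) ->
  (\int[mu]_(x in D) (h x)%:E <= B%:E)%E ->
  (abs_integrable D f <= C%:E)%E -> (abs_integrable D g <= C%:E)%E ->
  `|\int[mu]_(x in D) f x - \int[mu]_(x in D) g x| <= 2 * B.
Proof.
move=> mD mh fgh hB fC gC.
have h0 x : D x -> 0 <= h x by move=> /fgh; exact: le_trans.
have mh' : measurable_fun D (EFin \o h) by exact/measurable_EFinP.
have key (a b : T -> R) : (forall x, D x -> 0 <= a x) -> (forall x, D x -> 0 <= b x) ->
    (forall x, D x -> a x <= b x + h x) ->
    (\int[mu]_(x in D) (a x)%:E <= \int[mu]_(x in D) (b x)%:E + B%:E)%E.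
  move=> a0 b0 ab; apply: (@le_trans _ _ (\int[mu]_(x in D) ((b x)%:E + (h x)%:E))%E).
    by apply: le_integral_nonneg => x Dx; [rewrite lee_fin a0|rewrite -EFinD lee_fin ab].
  apply: le_trans (leeD (lexx _) hB).
  by apply: le_integralD_nonneg => // x Dx; rewrite lee_fin ?b0 ?h0.
pose pos (u : T -> R) x := Num.max (u x) 0; pose neg (u : T -> R) x := Num.max (- u x) 0.
have pE u : (\int[mu]_(x in D) ((fun x => (u x)%:E)^\+ x) = \int[mu]_(x in D) (pos u x)%:E)%E.
  by apply: eq_integral => x _; rewrite /pos funeposE EFin_max.
have nE u : (\int[mu]_(x in D) ((fun x => (u x)%:E)^\- x) = \int[mu]_(x in D) (neg u x)%:E)%E.
  by apply: eq_integral => x _; rewrite /neg funenegE EFin_max EFinN.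
have p0 u x : 0 <= pos u x by rewrite le_max lexx orbT.
have n0 u x : 0 <= neg u x by rewrite le_max lexx orbT.
have bnd u (w : T -> R) : (forall x, 0 <= w x <= `|u x|) -> (abs_integrable D u <= C%:E)%E ->
    (0 <= \int[mu]_(x in D) (w x)%:E <= C%:E)%E.
  move=> wu uC; apply/andP; split.
    by apply: integral_ge0 => x _; rewrite lee_fin; case/andP: (wu x).
  by apply: le_trans uC; apply: le_integral_nonneg => x _; rewrite lee_fin; case/andP: (wu x).
have pb u x : 0 <= pos u x <= `|u x| by rewrite p0 ge_max ler_norm normr_ge0.
have nb u x : 0 <= neg u x <= `|u x| by rewrite n0 ge_max normr_ge0 -normrN ler_norm.
have posB (u v : T -> R) x : 0 <= h x -> `|u x - v x| <= h x -> pos u x <= pos v x + h x.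
  move=> hx; rewrite ler_norml /pos => /andP[h1 h2].
  have h3 : v x <= Num.max (v x) 0 by rewrite le_max lexx.
  have h4 : 0 <= Num.max (v x) 0 by rewrite le_max lexx orbT.
  by rewrite ge_max; apply/andP; split; lra.
have negB (u v : T -> R) x : 0 <= h x -> `|u x - v x| <= h x -> neg u x <= neg v x + h x.
  move=> hx uv; apply: (posB (fun x => - u x) (fun x => - v x)) => //.
  by rewrite -opprD normrN.
have gfh x : D x -> `|g x - f x| <= h x by move=> /fgh; rewrite distrC.
have fg1 x (Dx : D x) := posB f g x (h0 x Dx) (fgh x Dx).
have fg2 x (Dx : D x) := negB f g x (h0 x Dx) (fgh x Dx).
have gf1 x (Dx : D x) := posB g f x (h0 x Dx) (gfh x Dx).
have gf2 x (Dx : D x) := negB g f x (h0 x Dx) (gfh x Dx).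
have k1 := key _ _ (fun x _ => p0 f x) (fun x _ => p0 g x) fg1.
have k2 := key _ _ (fun x _ => n0 f x) (fun x _ => n0 g x) fg2.
have k3 := key _ _ (fun x _ => p0 g x) (fun x _ => p0 f x) gf1.
have k4 := key _ _ (fun x _ => n0 g x) (fun x _ => n0 f x) gf2.
rewrite /Rintegral integralE [X in _ - fine X]integralE !pE !nE.
have fin (e : \bar R) : (0 <= e <= C%:E)%E -> exists r, e = r%:E.
  by case: e => [r _|/andP[_]|/andP[]]; [exists r|rewrite leye_eq|rewrite leeNy_eq].
have [r1 e1] := fin _ (bnd _ _ (pb f) fC); have [r2 e2] := fin _ (bnd _ _ (nb f) fC).
have [r3 e3] := fin _ (bnd _ _ (pb g) gC); have [r4 e4] := fin _ (bnd _ _ (nb g) gC).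
move: k1 k2 k3 k4; rewrite e1 e2 e3 e4 -!EFinD !lee_fin /= => k1 k2 k3 k4.
by rewrite ler_norml; apply/andP; split; lra.
Qed.

End RealIntegrals.

(** * Integrals over the half-line *)

Section ImproperIntegrals.
Context {R : realType}.
Local Notation mu := (@lebesgue_measure R).
Implicit Types (f F : R -> R) (x b : R).

Lemma powR1D x b : 0 <= x -> (1 + x) `^ b = expR (b * ln (1 + x)).
Proof. by move=> x0; rewrite /powR gt_eqF// ltr_pwDl. Qed.

Lemma integral_powR_y b : 1 < b ->
  (\int[mu]_(x in `]0%R, +oo[) ((1 + x) `^ (- b))%:E <= ((b - 1)^-1)%:E)%E.
Proof.
move=> b1; have b10 : b - 1 != 0 by rewrite subr_eq0 gt_eqF.
pose f x := expR (- b * ln (1 + x)).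
pose F x := - ((b - 1)^-1 * expR (- (b - 1) * ln (1 + x))).
have dF x : 0 <= x -> has_deriv F x (f x).
  move=> x0; have x1 : 0 < 1 + x by rewrite ltr_pwDl.
  rewrite /F; eapply der1_eq; first by derive_rules.
  rewrite /= /f.
  have -> : - b * ln (1 + x) = - (b - 1) * ln (1 + x) - ln (1 + x) by ring.
  rewrite expRD expRN lnK ?posrE//; field.
  by rewrite b10 gt_eqF.
have cf x : 0 <= x -> continuous_at x f.
  move=> x0; have x1 : 0 < 1 + x by rewrite ltr_pwDl.
  apply: cont_expR; apply: contM; first exact: cont_cst.
  by apply: cont_ln => //; apply: contD; [exact: cont_cst|exact: cvg_id].
have fE : (\int[mu]_(x in `]0%R, +oo[) ((1 + x) `^ (- b))%:E <=
    \int[mu]_(x in `[0%R, +oo[) (f x)%:E)%E.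
  rewrite [leLHS]integral_mkcond [leRHS]integral_mkcond.
  apply: le_integral_nonneg => x _; rewrite /patch.
    by case: ifPn => // _; rewrite lee_fin powR_ge0.
  case: ifPn => [/set_mem|_]; last by case: ifPn => // _; rewrite lee_fin expR_ge0.
  rewrite /= in_itv/= andbT => x0.
  by rewrite mem_set ?powR1D ?(ltW x0)//= in_itv/= andbT ltW.
apply: le_trans fE _.
have cvgF : F x @[x --> +oo] --> 0.
  rewrite -oppr0 -(mulr0 (b - 1)^-1); apply: cvgN; apply: cvgMr.
  have -> : (fun x => expR (- (b - 1) * ln (1 + x))) = (fun x => expR (- ((b - 1) * ln (1 + x)))).
    by apply/funext => x; rewrite mulNr.
  apply: (cvg_comp _ _ _ (@cvgr_expR R)).
  apply/cvgryPge => A; near=> x.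
  have xA : expR (A / (b - 1)) <= x by near: x; exact: nbhs_pinfty_ge.
  have x0 : 0 < x by apply: lt_le_trans xA; exact: expR_gt0.
  rewrite -ler_pdivrMl ?subr_gt0// mulrC -[leLHS]expRK ler_ln ?posrE ?expR_gt0 ?addr_gt0//.
  by apply: le_trans xA _; rewrite lerDr.
have f0 x : 0 <= x -> 0 <= f x by move=> _; exact: expR_ge0.
have cfI : {within `[0, +oo[, continuous f}.
  by apply: continuous_in_subspaceT => x; rewrite inE/= in_itv/= andbT; exact: cf.
have dF1 x : 0 < x -> derivable F x 1 by move=> x0; have [] := dF x (ltW x0).
have F0 : F x @[x --> 0^'+] --> F 0.
  apply: cvg_at_right_filter; exact: (der1_continuous (dF 0 (lexx _))).
have FE : {in `]0, +oo[, derive1 F =1 f}.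
  move=> x; rewrite in_itv/= andbT => x0; rewrite derive1E.
  by have [_ ->] := dF x (ltW x0).
rewrite (ge0_continuous_FTC2y f0 cfI cvgF dF1 F0 FE) -EFinB lee_fin /F.
by rewrite addr0 ln1 mulr0 expR0 mulr1 opprK add0r.
Unshelve. all: by end_near. Qed.

Lemma measurable_powR1D b (D : set R) : measurable D ->
  measurable_fun D (fun x => (1 + x) `^ b).
Proof.
move=> mD; apply: (@measurableT_comp _ _ _ _ _ _ (fun y : R => y `^ b)).
  exact: measurable_powR.
by apply: measurable_funD => //; exact: measurable_cst.
Qed.

Lemma integral_powRZ_y b K : 1 < b -> 0 <= K ->
  (\int[mu]_(x in `]0%R, +oo[) (K * (1 + x) `^ (- b))%:E <= (K / (b - 1))%:E)%E.
Proof.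
move=> b1 K0; rewrite EFinM.
apply: le_trans (lee_wpmul2l (_ : (0 <= K%:E)%E) (integral_powR_y b1)); last by rewrite lee_fin.
rewrite -ge0_integralZl//.
- by apply/measurable_EFinP; exact: measurable_powR1D.
- by move=> x _; rewrite lee_fin powR_ge0.
Qed.

Lemma measurable_fun_pos f : (forall x, 0 < x -> continuous_at x f) ->
  measurable_fun (`]0%R, +oo[ : set R) f.
Proof.
move=> cf; apply: open_continuous_measurable_fun; first exact: interval_open.
by move=> x; rewrite inE/= in_itv/= andbT => /cf.
Qed.

Lemma cont_pow1 x : 0 <= x -> continuous_at x (fun x => (1 + x) ^- 2).
Proof.
move=> x0; apply: contV; first by rewrite expf_neq0// gt_eqF// ltr_pwDl.
by apply: contX; apply: contD; [exact: cont_cst|exact: cvg_id].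
Qed.

Lemma integral_pow2_y :
  (\int[mu]_(x in `]0%R, +oo[) ((1 + x) ^- 2)%:E <= 1%:E)%E.
Proof.
have h : 1 < (2 : R) by rewrite ltr1n.
have := integral_powR_y h; rewrite (_ : (2 - 1)^-1 = 1 :> R); last by field.
apply: le_trans; rewrite le_eqVlt; apply/orP; left; apply/eqP.
apply: eq_integral => x; rewrite inE/= in_itv/= andbT => x0; congr EFin.
have x1 : 0 < 1 + x by rewrite addr_gt0.
by rewrite powR1D ?(ltW x0)// mulNr expRN expRM_natl lnK.
Qed.

Lemma integral_norm_pow2_le f K : 0 <= K ->
  (forall x, 0 < x -> `|f x| <= K * (1 + x) ^- 2) ->
  (\int[mu]_(x in `]0%R, +oo[) `|f x|%:E <= K%:E)%E.
Proof.
move=> K0 fK.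
apply: (@le_trans _ _ (K%:E * \int[mu]_(x in `]0%R, +oo[) ((1 + x) ^- 2)%:E)%E).
  rewrite -ge0_integralZl//.
  - apply: le_integral_nonneg => x; rewrite /= in_itv/= andbT => x0; first by rewrite lee_fin.
    by rewrite lee_fin fK.
  - apply/measurable_EFinP; apply: measurable_fun_pos => x x0.
    by apply: cont_pow1; exact: ltW.
  - by move=> x _; rewrite lee_fin invr_ge0 sqr_ge0.
by rewrite -[leRHS]mule1; apply: lee_wpmul2l; [rewrite lee_fin|exact: integral_pow2_y].
Qed.

Lemma integrable_pow2 f K : 0 <= K -> (forall x, 0 < x -> continuous_at x f) ->
  (forall x, 0 < x -> `|f x| <= K * (1 + x) ^- 2) ->
  mu.-integrable `]0%R, +oo[ (EFin \o f).
Proof.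
move=> K0 cf fK; apply/integrableP; split.
  by apply/measurable_EFinP; exact: measurable_fun_pos.
by apply: le_lt_trans (integral_norm_pow2_le K0 fK) _; rewrite ltry.
Qed.

Lemma le_norm_Rintegral_pow2 f K : 0 <= K ->
  (forall x, 0 < x -> `|f x| <= K * (1 + x) ^- 2) ->
  `|\int[mu]_(x in `]0%R, +oo[) f x| <= K.
Proof. by move=> K0 fK; apply: le_norm_Rintegral; exact: integral_norm_pow2_le. Qed.

(** Dominated convergence along the intervals [1/(k + 2), k + 2]; the shift by 2 keeps the endpoints
    apart already at k = 0. *)
Lemma Rintegral_derive_y F f K : 0 <= K ->
  (forall x, 0 < x -> has_deriv F x (f x)) -> (forall x, 0 < x -> continuous_at x f) ->
  (forall x, 0 < x -> `|f x| <= K * (1 + x) ^- 2) ->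
  F k.+2%:R @[k --> \oo] --> 0 -> F k.+2%:R^-1 @[k --> \oo] --> 0 ->
  \int[mu]_(x in `]0%R, +oo[) f x = 0.
Proof.
move=> K0 dF cf fK F1 F2.
have if_ := integrable_pow2 K0 cf fK.
pose D := `]0%R, +oo[%classic : set R; pose I k := `[k.+2%:R^-1, k.+2%:R]%classic : set R.
have ID k : I k `<=` D.
  move=> x; rewrite /I /D /= !in_itv/= andbT => /andP[+ _].
  by apply: lt_le_trans; rewrite invr_gt0.
pose f_ k := EFin \o (f \_ (I k)).
have mI k : measurable (I k) by exact: measurable_itv.
have mD : measurable D by exact: measurable_itv.
have mf : measurable_fun D f by exact: measurable_fun_pos.
have lt2 k : (k.+2%:R^-1 < k.+2%:R :> R).
  by apply: (@lt_trans _ _ 1); [rewrite invf_lt1 ?ltr0n// ltr1n|rewrite ltr1n].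
have int_k k : (\int[mu]_(x in D) f_ k x = (F k.+2%:R - F k.+2%:R^-1)%:E)%E.
  have -> : (\int[mu]_(x in D) f_ k x = \int[mu]_(x in D) ((EFin \o f) \_ (I k)) x)%E.
    by apply: eq_integral => x _; rewrite /f_ /patch/=; case: ifP.
  rewrite -integral_mkcondr setIidr//.
  have pos x : k.+2%:R^-1 <= x <= k.+2%:R -> 0 < x.
    by move=> /andP[+ _]; apply: lt_le_trans; rewrite invr_gt0.
  have h := Rintegral_derive (lt2 k) (fun x xI => dF x (pos x xI)) (fun x xI => cf x (pos x xI)).
  rewrite -h /Rintegral fineK//; apply: integrable_fin_num => //.
  by apply: integrable_itv => x /pos; exact: cf.
have mf_ k : measurable_fun D (f_ k).
  apply/measurable_EFinP.
  have : measurable_fun (D `&` I k) f by apply: measurable_funS mf => //; exact: subIsetl.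
  exact: (measurable_restrict f (mI k) mD).1.
have cv : {ae mu, forall x, D x -> f_ ^~ x @ \oo --> (f x)%:E}.
  apply: aeW => x; rewrite /D /= in_itv/= andbT => x0.
  apply: cvg_near_cst; near=> k; rewrite /f_ /= patchE ifT//.
  rewrite inE /I /= in_itv/=; apply/andP; split.
    rewrite -[leRHS]invrK lef_pV2 ?posrE ?invr_gt0//.
    apply: (@le_trans _ _ k%:R); last by rewrite ler_nat leqW.
    by near: k; exact: nbhs_infty_ger.
  apply: (@le_trans _ _ k%:R); last by rewrite ler_nat leqW.
  by near: k; exact: nbhs_infty_ger.
have ig : mu.-integrable D (EFin \o (fun x => K * (1 + x) ^- 2)).
  apply: (integrable_pow2 K0) => x x0.
    by apply: contM; [exact: cont_cst|apply: cont_pow1; exact: ltW].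
  by rewrite ger0_norm// mulr_ge0// invr_ge0 sqr_ge0.
have dom : {ae mu, forall x k, D x -> (`|f_ k x| <= (K * (1 + x) ^- 2)%:E)%E}.
  apply: aeW => x k; rewrite /D /= in_itv/= andbT => x0; rewrite /f_ /= lee_fin /patch.
  by case: ifP => _; [exact: fK|rewrite normr0 mulr_ge0// invr_ge0 sqr_ge0].
have [_ _ lim] := @dominated_convergence _ _ R mu D mD f_ (EFin \o f) _ mf_
  ((measurable_EFinP _ _).2 mf) cv ig dom.
have F12 : (F k.+2%:R - F k.+2%:R^-1)%:E @[k --> \oo] --> 0%:E.
  by apply: cvg_EFin; [near=> k|rewrite -[0](subrr 0); exact: cvgB].
have e0 : (\int[mu]_(x in D) (EFin \o f) x = 0%:E)%E.
  move: lim; rewrite (_ : (fun n => _) = (fun k => (F k.+2%:R - F k.+2%:R^-1)%:E)); last first.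
    by apply/funext => k; exact: int_k.
  by move=> lim'; exact: (cvg_unique (@ereal_hausdorff R) lim' F12).
by rewrite /Rintegral -/D; have -> : (\int[mu]_(x in D) (f x)%:E = 0%:E)%E by exact: e0.
Unshelve. all: by end_near. Qed.

Lemma RintegralZD f g b : mu.-integrable `]0%R, +oo[ (EFin \o f) ->
  mu.-integrable `]0%R, +oo[ (EFin \o g) ->
  \int[mu]_(x in `]0%R, +oo[) (b * (f x + g x)) =
  b * (\int[mu]_(x in `]0%R, +oo[) f x + \int[mu]_(x in `]0%R, +oo[) g x).
Proof.
move=> if_ ig.
have ifg : mu.-integrable `]0%R, +oo[ (EFin \o (fun x => f x + g x)).
  have -> : EFin \o (fun x => f x + g x) = (EFin \o f) \+ (EFin \o g) by [].
  by apply: (integrableD _ if_ ig).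
by rewrite (RintegralZl _ _ ifg)// (RintegralD _ if_ ig).
Qed.

End ImproperIntegrals.

(** * Spherical functions and the spherical transform *)

Section TransformDecay.
Context {R : realType} (mv mz : nat).
Local Notation P := ((mv + mz)%:R : R).
Local Notation K := (mz%:R : R).
Local Notation A := (@density R mv mz).
Local Notation D := (@drift R mv mz).
Local Notation rho := (@rho R mv mz).
Hypothesis dim2 : (2 <= mv + mz)%N.
Implicit Types (s c : R).

(* W lam is comparable to the inverse of |c(lam)|. *)
Definition weight (lam : R) : R := lam * Num.sqrt ((1 + lam) ^+ (mv + mz - 2)).

Lemma weight_sqr lam : 0 <= lam ->
  weight lam ^+ 2 = lam ^+ 2 * (1 + lam) ^+ (mv + mz - 2).
Proof.
by move=> l0; rewrite /weight exprMn sqr_sqrtr// exprn_ge0// addr_ge0.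
Qed.

Lemma weight_gt0 lam : 0 < lam -> 0 < weight lam.
Proof. by move=> l0; rewrite /weight mulr_gt0// sqrtr_gt0 exprn_gt0// addr_gt0. Qed.

Lemma rho_ge0 : 0 <= rho.
Proof. by rewrite /rho addr_ge0 ?divr_ge0. Qed.

Lemma sqrt_density_le s : 0 <= s -> Num.sqrt (A s) <= expR (rho * s).
Proof.
move=> s0; rewrite -[leRHS]ger0_norm ?expR_ge0// -sqrtr_sqr ler_sqrt ?sqr_ge0//.
have e0 := expR_gt0 (s / 2).
have en : expR (- (s / 2)) <= expR (s / 2) by rewrite ler_expR; lra.
have sh0 : 0 <= sh s by have := sh_ge s0; lra.
have sh1 : 2 * sh s <= expR (s / 2) by rewrite /sh; have := expR_gt0 (- (s / 2)); lra.
have ch1 : ch s <= expR (s / 2) by rewrite /ch; lra.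
rewrite densityE -exprMn -expRM_natl.
have -> : 2%:R * (rho * s) = (mv + mz + mz)%:R * (s / 2).
  by rewrite /rho !natrD; field.
rewrite expRM_natl (exprD _ (mv + mz) mz); apply: ler_pM.
- by rewrite exprn_ge0// mulr_ge0.
- by rewrite exprn_ge0// ltW// ch_gt0.
- by rewrite lerXn2r ?nnegrE ?(ltW e0)// mulr_ge0.
- by rewrite lerXn2r ?nnegrE ?(ltW e0)// ltW// ch_gt0.
Qed.

Definition drift_const : R := (2 * P + K) * (1 + Num.sqrt (2 ^+ (mv + mz + mz))).

(** Near 0 the pole 1/s of the drift is compensated by sqrt A = O(s), which holds as mv + mz >= 2;
    for s >= 1 the drift is bounded. *)
Lemma drift_sqrt_density_le s : 0 < s ->
  D s * Num.sqrt (A s) <= drift_const * expR (rho * s).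
Proof.
move=> s0; have PK : 0 <= 2 * P + K by rewrite addr_ge0 ?mulr_ge0 ?ler0n.
have D0 : 0 <= D s by apply: le_trans (drift_ge mv mz s0); rewrite divr_ge0 ?ler0n.
have q0 : 0 <= Num.sqrt (2 ^+ (mv + mz + mz)) :> R by exact: sqrtr_ge0.
have e1 : 1 <= expR (rho * s).
  by rewrite -[leLHS]expR0 ler_expR mulr_ge0 ?rho_ge0// ltW.
have [s1|s1] := leP s 1; last first.
  apply: (@le_trans _ _ ((2 * P + K) * expR (rho * s))).
    exact: ler_pM D0 (sqrtr_ge0 _) (drift_le1 mv mz (ltW s1)) (sqrt_density_le (ltW s0)).
  by rewrite ler_wpM2r ?expR_ge0// /drift_const ler_peMr// lerDl.
have h : Num.sqrt (A s) <= Num.sqrt (2 ^+ (mv + mz + mz)) * s.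
  rewrite -[s in leRHS](ger0_norm (ltW s0)) -sqrtr_sqr -sqrtrM ?exprn_ge0// ler_sqrt; last first.
    by rewrite mulr_ge0 ?exprn_ge0// ltW.
  apply: le_trans (density_le mv mz (_ : 0 <= s <= 1)) _; first by rewrite (ltW s0).
  rewrite ler_wpM2l ?exprn_ge0//; rewrite -(subnK dim2) exprD ler_piMl ?sqr_ge0//.
  by rewrite exprn_ile1// ltW.
have hD : D s <= (2 * P + K) / s by apply: drift_le; rewrite s0.
apply: le_trans (ler_pM D0 (sqrtr_ge0 _) hD h) _.
rewrite [leLHS](_ : _ = (2 * P + K) * Num.sqrt (2 ^+ (mv + mz + mz))); last first.
  by move: (Num.sqrt _) => q; field; rewrite gt_eqF.
rewrite /drift_const.
apply: (@le_trans _ _ ((2 * P + K) * (1 + Num.sqrt (2 ^+ (mv + mz + mz))))).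
  by rewrite ler_wpM2l// lerDr.
by rewrite ler_peMr// mulr_ge0// addr_ge0.
Qed.

Section Package.
Variables (lam : R) (u u1 u2 : R -> R).
Hypotheses (lam0 : 0 < lam).
Let mu := lam ^+ 2 + rho ^+ 2.
Hypotheses (du : forall s, has_deriv u s (u1 s))
  (du1 : forall s, has_deriv u1 s (u2 s))
  (u00 : u 0 ^+ 2 <= 1) (u10 : u1 0 = 0)
  (ode : forall s : R, 0 < s -> u2 s + D s * u1 s = - mu * u s).

Lemma ode_sqrt_bound s : 0 < s ->
  weight lam * (Num.sqrt (A s) * `|u s|) <= Num.sqrt (@ode_const R mv mz).
Proof.
move=> s0; have A0 := density_gt0 mv mz s0.
have n0 : 0 <= weight lam * (Num.sqrt (A s) * `|u s|).
  by rewrite mulr_ge0 ?mulr_ge0 ?sqrtr_ge0// ltW// weight_gt0.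
rewrite -[leLHS](ger0_norm n0) -sqrtr_sqr ler_sqrt.
  rewrite exprMn weight_sqr ?(ltW lam0)// exprMn sqr_sqrtr ?(ltW A0)// real_normK ?num_real//.
  exact: (ode_bound lam0 du du1 u00 u10 ode dim2 s0).
apply: le_trans (ode_bound lam0 du du1 u00 u10 ode dim2 s0).
have : 0 <= (1 + lam) ^+ (mv + mz - 2) by rewrite exprn_ge0// addr_ge0// ltW.
move=> h; apply: mulr_ge0; first exact: mulr_ge0 (sqr_ge0 _) h.
exact: mulr_ge0 (ltW A0) (sqr_ge0 _).
Qed.

Variables (G G1 G2 : R -> R) (Kf : R).
Hypotheses (dG : forall s : R, 0 < s -> has_deriv G s (G1 s))
  (dG1 : forall s : R, 0 < s -> has_deriv G1 s (G2 s))
  (cG2 : forall s : R, 0 < s -> continuous_at s G2)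
  (decay : forall s : R, 0 < s -> [/\ (1 + s) ^+ 2 * expR (rho * s) * `|G s| <= Kf,
     (1 + s) ^+ 2 * expR (rho * s) * `|G1 s| <= Kf &
     (1 + s) ^+ 2 * expR (rho * s) * `|G2 s| <= Kf]).

Let w s := Num.sqrt (A s).

Let Kf_ge0 : 0 <= Kf.
Proof.
have [h _ _] := decay ltr01; apply: le_trans h.
by rewrite !mulr_ge0 ?expR_ge0 ?exprn_ge0.
Qed.

Let decay_w (H : R -> R) c s : 0 < s -> 0 <= c -> c <= expR (rho * s) ->
  (1 + s) ^+ 2 * expR (rho * s) * `|H s| <= Kf -> c * `|H s| <= Kf * (1 + s) ^- 2.
Proof.
move=> s0 c0 ce h; have s1 : 0 < (1 + s) ^+ 2 by rewrite exprn_gt0// addr_gt0.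
rewrite ler_pdivlMr// mulrC; apply: le_trans h; rewrite -mulrA ler_pM2l//.
by rewrite ler_wpM2r.
Qed.

Let lap s := D s * G1 s + G2 s.
Let Kl := (drift_const + 1) * Kf.

Let drift_const_ge0 : 0 <= drift_const.
Proof. by rewrite mulr_ge0 ?addr_ge0 ?mulr_ge0 ?ler0n ?sqrtr_ge0. Qed.

Let Kl_ge0 : 0 <= Kl. Proof. by rewrite mulr_ge0// addr_ge0. Qed.

Let lap_le s : 0 < s -> w s * `|lap s| <= Kl * (1 + s) ^- 2.
Proof.
move=> s0; have [_ h1 h2] := decay s0.
have D0 : 0 <= D s by apply: le_trans (drift_ge mv mz s0); rewrite divr_ge0 ?ler0n.
have w0 : 0 <= w s by exact: sqrtr_ge0.
have e0 := expR_gt0 (rho * s).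
have a2 : w s * `|G2 s| <= Kf * (1 + s) ^- 2.
  by apply: decay_w => //; exact: sqrt_density_le (ltW s0).
have a1 : expR (rho * s) * `|G1 s| <= Kf * (1 + s) ^- 2.
  by apply: decay_w => //; exact: ltW.
have a3 := ler_wpM2r (normr_ge0 (G1 s)) (drift_sqrt_density_le s0).
have a4 := ler_wpM2l drift_const_ge0 a1.
apply: (@le_trans _ _ (w s * (D s * `|G1 s| + `|G2 s|))).
  by rewrite ler_wpM2l// (le_trans (ler_normD _ _))// normrM (ger0_norm D0).
rewrite -/(w s) in a3; rewrite /Kl; move: ((1 + s) ^- 2) a2 a4 a3 => y a2 a4 a3.
lra.
Qed.

Let C0 := Num.sqrt (@ode_const R mv mz).

Let wu_le s : 0 < s -> w s * `|u s| <= C0 / weight lam.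
Proof.
move=> s0; rewrite ler_pdivlMr ?weight_gt0// mulrC.
exact: ode_sqrt_bound.
Qed.

Let C0W_ge0 : 0 <= C0 / weight lam.
Proof. by rewrite divr_ge0 ?sqrtr_ge0// ltW// weight_gt0. Qed.

Let cA s : 0 < s -> continuous_at s A.
Proof. by move=> s0; exact: der1_continuous (has_deriv_density mv mz s0). Qed.

Let cD s : 0 < s -> continuous_at s D.
Proof. by move=> s0; exact: der1_continuous (has_deriv_drift mv mz s0). Qed.

Let cu s : continuous_at s u.
Proof. exact: der1_continuous (du s). Qed.

Let clap s : 0 < s -> continuous_at s lap.
Proof.
move=> s0; apply: contD; last exact: cG2.
by apply: contM; [exact: cD|exact: der1_continuous (dG1 s0)].
Qed.

Let A_sqr s : 0 < s -> A s = w s * w s.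
Proof. by move=> s0; rewrite -expr2 sqr_sqrtr// ltW// density_gt0. Qed.

(** Green's formula moves the radial Laplacian from u to G: mu times the transform of G is minus the
    transform of [lap]. This gains the factor 1/mu over the bound C0 / W for sqrt A |u|. *)
Lemma transform_decay :
  `|\int[lebesgue_measure]_(s in `]0%R, +oo[) (G s * u s * A s)| <=
  (C0 * Kl) / (weight lam * mu).
Proof.
have mu0 : 0 < mu by rewrite ltr_wpDr ?sqr_ge0// exprn_gt0.
(* Green's formula: N is the boundary term for the radial Laplacian (A y')' / A *)
pose N s := A s * (G s * u1 s - G1 s * u s).
pose n s := - (A s * u s * (mu * G s + lap s)).
have dN s : 0 < s -> has_deriv N s (n s).
  move=> s0; have d1 := du s; have d2 := du1 s; have d3 := dG s0; have d4 := dG1 s0.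
  have d5 := has_deriv_density mv mz s0.
  rewrite /N; eapply der1_eq; first by derive_rules.
  rewrite /= /n /lap.
  have -> : u2 s = - mu * u s - D s * u1 s by rewrite -(ode s0); ring.
  by ring.
have cG s : 0 < s -> continuous_at s G by move=> s0; exact: der1_continuous (dG s0).
have cn s : 0 < s -> continuous_at s n.
  move=> s0; apply: contN; apply: contM; first by apply: contM; [exact: cA|exact: cu].
  apply: contD; last exact: clap.
  by apply: contM; [exact: cont_cst|exact: cG].
pose B := C0 / weight lam * (mu * Kf + Kl).
have AuH (H : R -> R) M s : 0 < s -> w s * `|H s| <= M * (1 + s) ^- 2 ->
    `|A s * u s * H s| <= C0 / weight lam * M * (1 + s) ^- 2.
  move=> s0 hH; rewrite A_sqr// !normrM (ger0_norm (sqrtr_ge0 _)) -/(w s).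
  have := ler_pM (mulr_ge0 (sqrtr_ge0 _) (normr_ge0 _)) (mulr_ge0 (sqrtr_ge0 (A s)) (normr_ge0 _)) (wu_le s0) hH.
  by rewrite -/(w s); move: ((1 + s) ^- 2) => y; lra.
have hG s : 0 < s -> w s * `|G s| <= Kf * (1 + s) ^- 2.
  by move=> s0; have [h _ _] := decay s0; apply: decay_w => //; [exact: sqrtr_ge0|exact: sqrt_density_le (ltW s0)].
have hG1 s : 0 < s -> w s * `|G1 s| <= Kf * (1 + s) ^- 2.
  by move=> s0; have [_ h _] := decay s0; apply: decay_w => //; [exact: sqrtr_ge0|exact: sqrt_density_le (ltW s0)].
have nB s : 0 < s -> `|n s| <= B * (1 + s) ^- 2.
  move=> s0; rewrite /n normrN /B; apply: (AuH (fun s => mu * G s + lap s)) => //.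
  apply: (@le_trans _ _ (w s * (mu * `|G s| + `|lap s|))).
    rewrite ler_wpM2l ?sqrtr_ge0// (le_trans (ler_normD _ _))// normrM (ger0_norm (ltW mu0))//.
  have := ler_wpM2l (ltW mu0) (hG s s0); have := lap_le s0.
  by move: ((1 + s) ^- 2) => y; lra.
have B0 : 0 <= B by rewrite mulr_ge0// addr_ge0// mulr_ge0// ltW.
have small (x : nat -> R) : (forall k, 0 < x k) ->
    (exists C, forall k, `|N (x k)| <= C / k.+1%:R) -> N (x k) @[k --> \oo] --> 0.
  move=> x0 [C hC]; apply: (@squeeze_cvgr _ _ _ _ (fun k => - (C / k.+1%:R)) (fun k => C / k.+1%:R)).
  - by near=> k; rewrite -ler_norml.
  - by rewrite -oppr0 -(mulr0 C); apply: cvgN; apply: cvgMr; exact: cvg_harmonic.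
  - by rewrite -(mulr0 C); apply: cvgMr; exact: cvg_harmonic.
(* At infinity sqrt A u and sqrt A u' stay bounded, while sqrt A G and sqrt A G' are O((1 +
   s)^(-2)). *)
have N1 : N k.+2%:R @[k --> \oo] --> 0.
  apply: small => [k|]; first by rewrite ltr0n.
  have [C hC] := ode_deriv_bounded lam0 du du1 u00 u10 ode.
  exists (Kf * (Num.sqrt C + C0 / weight lam)) => k.
  set s : R := k.+2%:R; have s0 : 0 < s by rewrite ltr0n.
  have wu1 : w s * `|u1 s| <= Num.sqrt C.
    have n0 : 0 <= w s * `|u1 s| by rewrite mulr_ge0 ?sqrtr_ge0.
    have h : A s * u1 s ^+ 2 <= C by apply: hC; rewrite ler1n.
    rewrite -[leLHS](ger0_norm n0) -sqrtr_sqr ler_sqrt.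
      by rewrite exprMn sqr_sqrtr ?(ltW (density_gt0 _ _ s0))// real_normK ?num_real.
    by apply: le_trans h; rewrite mulr_ge0 ?sqr_ge0// ltW// density_gt0.
  have t1 := ler_pM (mulr_ge0 (sqrtr_ge0 (A s)) (normr_ge0 (G s))) (mulr_ge0 (sqrtr_ge0 (A s)) (normr_ge0 (u1 s))) (hG s s0) wu1.
  have t2 := ler_pM (mulr_ge0 (sqrtr_ge0 (A s)) (normr_ge0 (G1 s))) (mulr_ge0 (sqrtr_ge0 (A s)) (normr_ge0 (u s))) (hG1 s s0) (wu_le s0).
  have kk : (1 + s) ^- 2 <= k.+1%:R^-1.
    rewrite lef_pV2 ?posrE ?exprn_gt0 ?ltr0n ?addr_gt0//.
    apply: (@le_trans _ _ (1 + s)); first by rewrite /s -natr1 -[k.+2%:R]natr1; lra.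
    by nra.
  have Q0 : 0 <= Kf * (Num.sqrt C + C0 / weight lam) by rewrite mulr_ge0// addr_ge0// sqrtr_ge0.
  apply: le_trans (ler_wpM2l Q0 kk).
  rewrite /N A_sqr// normrM normrM (ger0_norm (sqrtr_ge0 _)) -/(w s).
  apply: (@le_trans _ _ (w s * w s * (`|G s| * `|u1 s| + `|G1 s| * `|u s|))).
    rewrite ler_wpM2l ?mulr_ge0 ?sqrtr_ge0//.
    by rewrite (le_trans (ler_normB _ _))// !normrM.
  by move: t1 t2; rewrite -/(w s); move: ((1 + s) ^- 2) => y; lra.
(* At 0 the boundary term vanishes with A, its other factors being bounded. *)
have N2 : N k.+2%:R^-1 @[k --> \oo] --> 0.
  apply: small => [k|]; first by rewrite invr_gt0 ltr0n.
  exists (2 ^+ (mv + mz + mz) * (Kf * (Num.sqrt mu + 1))) => k.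
  set s : R := k.+2%:R^-1; have s0 : 0 < s by rewrite invr_gt0 ltr0n.
  have s1 : s <= 1 by rewrite invf_le1 ?ltr0n// ler1n.
  have bd (H : R -> R) : (1 + s) ^+ 2 * expR (rho * s) * `|H s| <= Kf -> `|H s| <= Kf.
    move=> h; apply: le_trans h; rewrite ler_peMl//.
    rewrite -[leLHS]mulr1; apply: ler_pM => //.
      by rewrite exprn_ege1// lerDl ltW.
    by rewrite -[leLHS]expR0 ler_expR mulr_ge0 ?rho_ge0// ltW.
  have [/bd g0 /bd g1 _] := decay s0.
  have hu : `|u s| <= 1.
    by rewrite -(@expr_le1 _ 2)// real_normK ?num_real//; exact: (ode_le1 lam0 du du1 u00 u10 ode (ltW s0)).
  have hu1 : `|u1 s| <= Num.sqrt mu.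
    rewrite -sqrtr_sqr ler_sqrt ?(ltW mu0)//.
    exact: (ode_deriv_le lam0 du du1 u00 u10 ode (ltW s0)).
  have As : A s <= 2 ^+ (mv + mz + mz) / k.+1%:R.
    apply: le_trans (density_le mv mz (_ : 0 <= s <= 1)) _; first by rewrite (ltW s0).
    rewrite ler_wpM2l ?exprn_ge0//; apply: (@le_trans _ _ s).
      rewrite -(subnK (ltnW dim2)) addn1 exprSr ler_piMl ?(ltW s0)//.
      by rewrite exprn_ile1// ltW.
    by rewrite lef_pV2 ?posrE ?ltr0n// ler_nat.
  have A0 := density_gt0 mv mz s0.
  rewrite /N normrM (ger0_norm (ltW A0)) [leRHS]mulrAC; apply: (ler_pM (ltW A0) (normr_ge0 _) As).
  apply: le_trans (ler_normB _ _) _; rewrite !normrM mulrDr mulr1.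
  apply: lerD; first exact: ler_pM.
  by rewrite -[leRHS]mulr1; exact: ler_pM.
have I0 := Rintegral_derive_y B0 dN cn nB N1 N2.
pose I : set R := `]0%R, +oo[%classic.
pose e s := A s * u s * lap s.
have ce s : 0 < s -> continuous_at s e.
  move=> s0; apply: contM; last exact: clap.
  by apply: contM; [exact: cA|exact: cu].
have eB s : 0 < s -> `|e s| <= C0 / weight lam * Kl * (1 + s) ^- 2.
  by move=> s0; apply: AuH => //; exact: lap_le.
have CK0 : 0 <= C0 / weight lam * Kl by rewrite mulr_ge0.
have ie := integrable_pow2 CK0 ce eB.
have in_ := integrable_pow2 B0 cn nB.
have -> : \int[lebesgue_measure]_(s in I) (G s * u s * A s) =
    - mu^-1 * \int[lebesgue_measure]_(s in I) e s.
  rewrite -[X in _ * X]add0r -I0 -(RintegralZD _ in_ ie).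
  by apply: eq_Rintegral => s _; rewrite /n /e; field; rewrite gt_eqF.
have h := le_norm_Rintegral_pow2 CK0 eB.
have mu1 : 0 <= mu^-1 by rewrite invr_ge0 ltW.
rewrite normrM normrN (ger0_norm mu1).
rewrite [leRHS](_ : _ = mu^-1 * (C0 / weight lam * Kl)); last first.
  by field; rewrite !gt_eqF// weight_gt0.
exact: (ler_wpM2l mu1 h).
Unshelve. all: by end_near. Qed.

End Package.

End TransformDecay.

Section Spherical.
Local Open Scope complex_scope.
Context {R : realType} {mv mz : nat} (h : htype R mv mz).
Local Notation C := R[i].
Local Notation n := (mv + mz + 1)%N.
Local Notation pt := 'rV[R]_n.
Local Notation Re := (@complex.Re R).
Local Notation Im := (@complex.Im R).
Local Notation normc := (@Normc.normc R).
Local Notation A := (@density R mv mz).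
Local Notation D := (@drift R mv mz).
Local Notation rho := (@rho R mv mz).
Implicit Types (s lam : R).

Definition sph_ode lam (u u1 u2 : R -> R) : Prop :=
  [/\ forall s : R, has_deriv u s (u1 s), forall s : R, has_deriv u1 s (u2 s),
      u 0 ^+ 2 <= 1, u1 0 = 0 &
      forall s : R, 0 < s -> u2 s + D s * u1 s = - (lam ^+ 2 + rho ^+ 2) * u s].

Lemma Re_mul_real (a : R) (z : C) : Re (a%:C * z) = a * Re z.
Proof. by case: z => x y; rewrite /= mul0r subr0. Qed.

Lemma Im_mul_real (a : R) (z : C) : Im (a%:C * z) = a * Im z.
Proof. by case: z => x y; rewrite /= mul0r addr0. Qed.

Lemma eigenvalueE lam :
  - (lam%:C ^+ 2 + (rho ^+ 2)%:C) = (- (lam ^+ 2 + rho ^+ 2))%:C :> C.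
Proof. by rewrite -rmorphXn -rmorphD -rmorphN. Qed.

Lemma axis0 : axis 0 = dr_e :> pt.
Proof. by rewrite /axis expR0. Qed.

Lemma spherical_radial lam : radial h (spherical h lam%:C).
Proof.
rewrite /spherical; case: xgetP => [phi _ []//|_].
by move=> x y.
Qed.

(** The eigenvalue is real, so that the real and imaginary parts solve the same equation. The
    imaginary part vanishes at 0 together with its derivative, hence for all s >= 0 by [ode_energy].
    Where [spherical] takes its default value, u = 0 works. *)
Lemma spherical_ode lam : 0 < lam -> exists u u1 u2, sph_ode lam u u1 u2 /\
  forall x, dr_set x -> spherical h lam%:C x = (u (dr_r x))%:C.
Proof.
move=> lam0; rewrite /spherical; case: xgetP => [phi _ [rphi [sRe sIm] lphi phi1]|_]; last first.
  exists (fun=> 0), (fun=> 0), (fun=> 0); split; last by [].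
  split=> [s|s|||s s0]; rewrite ?expr0n//; [exact: der1_cst|exact: der1_cst|by rewrite !mulr0 addr0].
have rRe : radial h (fun x => Re (phi x)) by move=> x y Sx Sy xy; rewrite (rphi x y).
have rIm : radial h (fun x => Im (phi x)) by move=> x y Sx Sy xy; rewrite (rphi x y).
pose a := prof (fun x => Re (phi x)); pose b := prof (fun x => Im (phi x)).
have a0 : a 0 = 1 by rewrite /a /prof axis0 phi1.
have b0 : b 0 = 0 by rewrite /b /prof axis0 phi1.
have odeRe s : 0 < s -> ddprof (fun x => Re (phi x)) s + D s * dprof (fun x => Re (phi x)) s =
    - (lam ^+ 2 + rho ^+ 2) * a s.
  move=> s0; rewrite -(dr_laplace_prof rRe sRe s0).
  by have /(congr1 Re) := lphi _ (axis_dr_set s); rewrite eigenvalueE Re_mul_real.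
have odeIm s : 0 < s -> ddprof (fun x => Im (phi x)) s + D s * dprof (fun x => Im (phi x)) s =
    - (lam ^+ 2 + rho ^+ 2) * b s.
  move=> s0; rewrite -(dr_laplace_prof rIm sIm s0).
  by have /(congr1 Im) := lphi _ (axis_dr_set s); rewrite eigenvalueE Im_mul_real.
have da s := has_deriv_prof sRe s; have da1 s := has_deriv_dprof sRe s.
have db s := has_deriv_prof sIm s; have db1 s := has_deriv_dprof sIm s.
have b00 : b 0 ^+ 2 <= 1 by rewrite b0 expr0n/= ler01.
have bz s : 0 <= s -> b s = 0.
  move=> s0; have := ode_energy db db1 (dprof0 rIm sIm) odeIm s0.
  rewrite -/b b0 expr0n/= mulr0 => h1.
  have mu0 : 0 < lam ^+ 2 + rho ^+ 2 by rewrite ltr_wpDr ?sqr_ge0// exprn_gt0.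
  have h2 : (lam ^+ 2 + rho ^+ 2) * b s ^+ 2 <= 0.
    by apply: le_trans h1; rewrite lerDr sqr_ge0.
  move: h2; rewrite pmulr_rle0// => h2; apply/eqP; rewrite -sqrf_eq0.
  by rewrite eq_le h2 sqr_ge0.
exists a, (dprof (fun x => Re (phi x))), (ddprof (fun x => Re (phi x))); split.
  have a00 : a 0 ^+ 2 <= 1 by rewrite a0 expr1n.
  exact: And5 da da1 a00 (dprof0 rRe sRe) odeRe.
move=> x Sx; rewrite (radialE rphi Sx); have := bz _ (dr_r_ge0 Sx).
by rewrite /a /b /prof; case: (phi _) => p q /= ->.
Qed.

(** [profile] is meaningful for s >= 0 only, whereas [prof] is differentiable on the whole line; as
    derivatives are local, the two agree on s > 0 with their derivatives. *)
Lemma derive1n_pos (g G G1 G2 : R -> R) : (forall s, 0 < s -> g s = G s) ->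
  (forall s, has_deriv G s (G1 s)) -> (forall s, has_deriv G1 s (G2 s)) ->
  forall s, 0 < s ->
  [/\ derive1n 0 g s = G s, derive1n 1 g s = G1 s & derive1n 2 g s = G2 s].
Proof.
move=> gG dG dG1.
have d1 s : 0 < s -> derive1 g s = G1 s.
  move=> s0; rewrite derive1E; apply: derive_val; apply: (der1_near _ (dG s)).
  near=> y; rewrite gG//; near: y; exact: lt_nbhsr.
have d2 s : 0 < s -> derive1 (derive1 g) s = G2 s.
  move=> s0; rewrite derive1E; apply: derive_val; apply: (der1_near _ (dG1 s)).
  near=> y; rewrite d1//; near: y; exact: lt_nbhsr.
by move=> s s0; split; [exact: gG|exact: d1|exact: d2].
Unshelve. all: by end_near. Qed.

Hypothesis dim2 : (2 <= mv + mz)%N.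

Lemma sph_transform_decay (f : pt -> C) : schwartz2_radial h f ->
  exists2 K : R, 0 <= K & forall lam, 0 < lam ->
  normc (sph_transform h f lam%:C) <= K / (weight mv mz lam * (lam ^+ 2 + rho ^+ 2)).
Proof.
move=> [rf [sRe sIm] dec].
have rRe : radial h (fun x => Re (f x)) by move=> x y Sx Sy xy; rewrite (rf x y).
have rIm : radial h (fun x => Im (f x)) by move=> x y Sx Sy xy; rewrite (rf x y).
have [K0 k0] := dec 0%N 2%N; have [K1 k1] := dec 1%N 2%N; have [K2 k2] := dec 2%N 2%N.
pose Kf := Num.max (Num.max K0 K1) K2.
have w0 s : 0 < s -> 0 <= (1 + s) ^+ 2 * expR (rho * s).
  by move=> s0; exact: mulr_ge0 (sqr_ge0 _) (expR_ge0 _).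
(* [p] stands for [Re] or [Im]; the decay of the complex profile and of its first two derivatives
   passes to both. *)
have part (p : C -> R) : (forall z, `|p z| <= normc z) ->
    (forall M (s : R), 0 < s -> p (cderive1n M (profile h f) s) = derive1n M (p \o profile h f) s) ->
    smooth_on dr_set (fun x => p (f x)) -> radial h (fun x => p (f x)) ->
  forall s, 0 < s -> [/\ (1 + s) ^+ 2 * expR (rho * s) * `|prof (fun x => p (f x)) s| <= Kf,
     (1 + s) ^+ 2 * expR (rho * s) * `|dprof (fun x => p (f x)) s| <= Kf &
     (1 + s) ^+ 2 * expR (rho * s) * `|ddprof (fun x => p (f x)) s| <= Kf].
  move=> pn pd sp rp s s0.
  have gG y : 0 < y -> (p \o profile h f) y = prof (fun x => p (f x)) y.
    by move=> y0; rewrite /= (profileE rf (ltW y0)).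
  have [e0 e1 e2] := derive1n_pos gG (has_deriv_prof sp) (has_deriv_dprof sp) s0.
  have bd M K : (forall s : R, 0 < s ->
      (1 + s) ^+ 2 * expR (rho * s) * normc (cderive1n M (profile h f) s) <= K) -> K <= Kf ->
      (1 + s) ^+ 2 * expR (rho * s) * `|derive1n M (p \o profile h f) s| <= Kf.
    move=> hK KKf; apply: le_trans KKf; apply: le_trans (hK s s0).
    by rewrite -pd// ler_wpM2l// w0.
  split; [rewrite -e0|rewrite -e1|rewrite -e2].
  - by apply: (bd _ K0) => //; rewrite !le_max lexx.
  - by apply: (bd _ K1) => //; rewrite !le_max lexx orbT.
  - by apply: (bd _ K2) => //; rewrite !le_max lexx orbT.
have pRe := part Re le_Re_normc (fun _ _ _ => erefl) sRe rRe.
have pIm := part Im le_Im_normc (fun _ _ _ => erefl) sIm rIm.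
have Kf0 : 0 <= Kf.
  by have [h1 _ _] := pRe _ ltr01; apply: le_trans h1; exact: mulr_ge0 (w0 _ ltr01) (normr_ge0 _).
pose Kl := Num.sqrt (@ode_const R mv mz) * ((@drift_const R mv mz + 1) * Kf).
have dc0 : 0 <= @drift_const R mv mz.
  exact: mulr_ge0 (addr_ge0 (mulr_ge0 (ler0n _ 2) (ler0n _ _)) (ler0n _ _)) (addr_ge0 ler01 (sqrtr_ge0 _)).
exists (Kl + Kl).
  have h1 : 0 <= Kl by exact: mulr_ge0 (sqrtr_ge0 _) (mulr_ge0 (addr_ge0 dc0 ler01) Kf0).
  exact: addr_ge0.
move=> lam lam0; have [u [u1 [u2 [[du du1 u00 u10 ode] sE]]]] := spherical_ode lam0.
have tr (p : C -> R) : (forall (a : R) z, p (a%:C * z) = a * p z) ->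
    (forall s : R, 0 < s -> [/\ (1 + s) ^+ 2 * expR (rho * s) * `|prof (fun x => p (f x)) s| <= Kf,
     (1 + s) ^+ 2 * expR (rho * s) * `|dprof (fun x => p (f x)) s| <= Kf &
     (1 + s) ^+ 2 * expR (rho * s) * `|ddprof (fun x => p (f x)) s| <= Kf]) ->
    smooth_on dr_set (fun x => p (f x)) ->
    `|\int[lebesgue_measure]_(s in `]0%R, +oo[)
       p (profile h f s * profile h (spherical h lam%:C) s * (A s)%:C)| <=
    Kl / (weight mv mz lam * (lam ^+ 2 + rho ^+ 2)).
  move=> pM pd sp.
  rewrite (_ : \int[lebesgue_measure]_(s in _) _ =
    \int[lebesgue_measure]_(s in `]0%R, +oo[) (prof (fun x => p (f x)) s * u s * A s)).
    exact: (transform_decay dim2 lam0 du du1 u00 u10 ode (fun s _ => has_deriv_prof sp s)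
      (fun s _ => has_deriv_dprof sp s) (fun s _ => cont_ddprof sp (s := s)) pd).
  apply: eq_Rintegral => s; rewrite inE/= in_itv/= andbT => s0.
  rewrite (profileE rf (ltW s0)) (profileE (@spherical_radial lam) (ltW s0)).
  rewrite (sE _ (axis_dr_set s)) (dr_r_axis (ltW s0)) -mulrA -rmorphM mulrC pM /prof.
  by ring.
have t1 := tr Re Re_mul_real pRe sRe; have t2 := tr Im Im_mul_real pIm sIm.
apply: le_trans (normc_le _) _; rewrite mulrDl; exact: lerD.
Qed.

End Spherical.

(** * Volume of balls *)

Section DensityGrowth.
Context {R : realType} (mv mz : nat).
Hypothesis dim2 : (2 <= mv + mz)%N.
Local Notation A := (@density R mv mz).
Local Notation mu := (@lebesgue_measure R).
Implicit Types (s T : R).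

(** A' as a polynomial in sh and ch, valid at s = 0 as well, where A'/A is singular. *)
Definition ddensity s : R := 2 ^+ (mv + mz) *
  ((mv + mz)%:R * sh s ^+ (mv + mz).-1 * (ch s / 2) * ch s ^+ mz
   + sh s ^+ (mv + mz) * (mz%:R * ch s ^+ mz.-1 * (sh s / 2))).

Lemma has_deriv_ddensity s : has_deriv A s (ddensity s).
Proof.
have ds := has_deriv_sh s; have dc := has_deriv_ch s.
have -> : A = fun s => 2 ^+ (mv + mz) * (sh s ^+ (mv + mz) * ch s ^+ mz).
  by apply/funext => x; rewrite densityE mulrA.
apply: der1_eq; first exact: der1M (der1_cst _ _) (der1M (der1X _ ds) (der1X _ dc)).
by rewrite /ddensity; ring.
Qed.

Lemma cont_density s : continuous_at s A.
Proof. exact: der1_continuous (has_deriv_ddensity s). Qed.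

Lemma density0 : A 0 = 0.
Proof. by rewrite densityE sh0 expr0n -(subnK dim2) addn2/= mulr0 mul0r. Qed.

(** sh <= ch, and mv + mz >= 2 makes the coefficient (mv + mz)/2 at least 1. *)
Lemma density_le_ddensity s : 0 <= s -> A s <= ddensity s.
Proof.
move=> s0; have sh0 : 0 <= sh s by have := sh_ge s0; lra.
have c0 := ch_gt0 s.
have sc : sh s <= ch s by rewrite /sh /ch; have := expR_gt0 (- (s / 2)); lra.
have P1 : 1 <= (mv + mz)%:R / 2 :> R by rewrite ler_pdivlMr// mul1r ler_nat.
rewrite densityE /ddensity -mulrA ler_wpM2l ?exprn_ge0//.
have z0 : 0 <= sh s ^+ (mv + mz) * (mz%:R * ch s ^+ mz.-1 * (sh s / 2)).
  apply: mulr_ge0; first exact: exprn_ge0.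
  apply: mulr_ge0; last exact: divr_ge0.
  by apply: mulr_ge0; [exact: ler0n|exact: exprn_ge0 (ltW c0)].
rewrite -[leLHS]addr0; apply: lerD; last exact: z0.
rewrite ler_wpM2r ?exprn_ge0 ?(ltW c0)//.
have -> : (mv + mz)%:R * sh s ^+ (mv + mz).-1 * (ch s / 2) =
  sh s ^+ (mv + mz).-1 * ((mv + mz)%:R / 2 * ch s) by field.
have -> : sh s ^+ (mv + mz) = sh s ^+ (mv + mz).-1 * sh s.
  by rewrite -exprSr prednK// (leq_trans _ dim2).
rewrite ler_wpM2l ?exprn_ge0//; apply: le_trans sc _.
by rewrite ler_peMl// ltW.
Qed.

Lemma density_ge_id s : 1 <= s -> s <= A s.
Proof.
move=> s1; have s0 : 0 <= s by lra.
have sh0 := sh_ge s0; have c1 := ch_ge1 s.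
rewrite densityE -exprMn -[leLHS]mulr1; apply: ler_pM => //; last exact: exprn_ege1.
have s2 : 1 <= 2 * sh s by lra.
apply: (@le_trans _ _ (2 * sh s)); first lra.
by rewrite -(subnK (ltnW dim2)) addn1 exprS ler_peMr ?exprn_ege1//; lra.
Qed.

Lemma density_mono s t : 0 <= s -> s <= t -> A s <= A t.
Proof.
move=> s0 st; rewrite -lerN2.
apply: (@nonincreasing_is_derive _ (fun x => - A x) (fun x => - ddensity x) s t st).
- by move=> x _; exact: der1N (has_deriv_ddensity x).
- move=> x /andP[sx _]; rewrite oppr_le0.
  have x0 : 0 < x by exact: le_lt_trans sx.
  exact: le_trans (ltW (density_gt0 mv mz x0)) (density_le_ddensity (ltW x0)).
- exact: contN (@cont_density s).
- exact: contN (@cont_density t).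
Qed.

(** The set where A < T lies in [0, c] with A(c) = T, and the integral of A over [0, c] is at most
    that of A', which is T. *)
Lemma integral_density_lt T : 0 < T ->
  (\int[mu]_(s in `]0%R, +oo[) ((A s < T)%R%:R * A s)%:E <= T%:E)%E.
Proof.
move=> T0; pose b := T + 1.
have b1 : 1 <= b by rewrite /b; lra.
have b0 : 0 < b by lra.
(* A(T + 1) >= T + 1, since A(s) >= s for s >= 1. *)
have [c c01 Ac] : exists2 c, c \in `[0, b] & A c = T.
  apply: IVT; first exact: ltW.
    by apply: within_continuous_at => t _; exact: cont_density.
  have := density_ge_id b1; rewrite density0 => h.
  rewrite (min_idPl _) ?(max_idPr _); try by apply: le_trans h; lra.
  by rewrite (ltW T0)/=; apply: le_trans h; rewrite /b; lra.
have c0 : 0 < c.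
  move: c01; rewrite in_itv/= => /andP[+ _]; rewrite le_eqVlt => /predU1P[c00|//].
  by move: Ac T0; rewrite -c00 density0 => <-; rewrite ltxx.
apply: (@le_trans _ _ (\int[mu]_(s in `[0%R, c]) (A s)%:E)%E).
  rewrite [leLHS]integral_mkcond [leRHS]integral_mkcond.
  have A0 s : 0 <= s -> 0 <= A s.
    by rewrite le_eqVlt => /predU1P[<-|/(density_gt0 mv mz)/ltW//]; rewrite density0.
  apply: le_integral_nonneg => s _; rewrite /patch.
    case: ifPn => // /[!inE]/=; rewrite in_itv/= andbT => s0.
    by rewrite lee_fin mulr_ge0 ?ler0n// A0// ltW.
  case: ifPn => [/[!inE]/=|_]; last first.
    by case: ifPn => // /[!inE]/=; rewrite in_itv/= => /andP[s0 _]; rewrite lee_fin A0.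
  rewrite in_itv/= andbT => s0; have As := A0 _ (ltW s0).
  have [AT|AT] := ltP (A s) T; last first.
    by rewrite mul0r; case: ifPn => // _; rewrite lee_fin.
  rewrite mem_set ?mul1r//= in_itv/= (ltW s0)/= leNgt; apply/negP => cs.
  by have := density_mono (ltW c0) (ltW cs); rewrite Ac leNgt AT.
have cA t : 0 <= t <= c -> continuous_at t A by move=> _; exact: cont_density.
have iA := integrable_itv cA.
rewrite -[leLHS]fineK; last exact: integrable_fin_num iA.
rewrite lee_fin -/(Rintegral mu `[0%R, c] A).
have := @le_Rintegral_derive _ (fun t => - A t) (fun t => - ddensity t) (fun t => - A t) 0 c c0
  (fun t _ => der1N (has_deriv_ddensity t)).
move=> /(_ _ (fun t tc => contN (cA t tc))) => /(_ _)/wrap[t /andP[t0 _]|].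
  by rewrite lerN2 density_le_ddensity.
under [X in _ <= X -> _]eq_Rintegral do rewrite -mulN1r.
rewrite (RintegralZl _ _ iA)// Ac density0; lra.
Qed.

End DensityGrowth.

Section HaarBall.
Context {R : realType} {mv mz : nat} (h : htype R mv mz).
Local Notation n := (mv + mz + 1)%N.
Local Notation pt := 'rV[R]_n.
Local Notation borel := (g_sigma_algebraType (@open pt)).
Local Notation A := (@density R mv mz).

Lemma cont_apart (p : pt) : continuous_at p (fun q : pt => apart q).
Proof.
have -> : (fun q : pt => apart q) = fun q => q 0 (rshift (mv + mz) 0).
  by apply/funext => q; rewrite /apart mxE.
exact: coord_continuous.
Qed.

Lemma cont_vpart (p : pt) i : continuous_at p (fun q : pt => vpart q 0 i).
Proof.
have -> : (fun q : pt => vpart q 0 i) = fun q => q 0 (lshift 1 (lshift mz i)).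
  by apply/funext => q; rewrite /vpart !mxE.
exact: coord_continuous.
Qed.

Lemma cont_zpart (p : pt) i : continuous_at p (fun q : pt => zpart q 0 i).
Proof.
have -> : (fun q : pt => zpart q 0 i) = fun q => q 0 (lshift 1 (rshift mv i)).
  by apply/funext => q; rewrite /zpart !mxE.
exact: coord_continuous.
Qed.

Lemma cont_dr_r (p : pt) : dr_set p -> continuous_at p (fun q : pt => dr_r q).
Proof.
move=> Sp; have ca := @cont_apart p.
have cv : continuous_at p (fun q : pt => dot (vpart q) (vpart q)).
  by apply: cont_dot => i; exact: cont_vpart.
have cz : continuous_at p (fun q : pt => dot (zpart q) (zpart q)).
  by apply: cont_dot => i; exact: cont_zpart.
have cb : continuous_at p (fun q : pt => dr_b q).
  rewrite /dr_b; apply: contD; first by apply: contD; [exact: cont_cst|exact: ca].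
  by apply: contM; [exact: cv|exact: cont_cst].
have cc : continuous_at p (fun q : pt => 2 * dr_c q - 1).
  apply: contD; last exact: cont_cst.
  apply: contM; first exact: cont_cst.
  rewrite /dr_c; apply: contM.
    by apply: contD; [exact: contX|exact: cz].
  apply: contV; first by rewrite mulf_neq0// gt_eqF.
  by apply: contM; [exact: cont_cst|exact: ca].
have c1 := dr_c_ge1 Sp; rewrite /dr_r /arcosh.
apply: cont_ln; first by rewrite ltr_wpDr ?sqrtr_ge0//; lra.
apply: contD; first exact: cc.
apply: cont_sqrt; apply: contD; last exact: cont_cst.
exact: contX.
Qed.

Lemma open_dr_set : open (@dr_set R mv mz).
Proof.
rewrite openE => x Sx; rewrite /interior.
by have := @cont_apart x; move=> /cvgr_gt; apply.
Qed.

Lemma open_dr_lt (F : pt -> R) (c : R) : (forall x, dr_set x -> continuous_at x F) ->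
  open [set x | dr_set x /\ F x < c].
Proof.
move=> cF; rewrite openE => x [Sx Fx]; rewrite /interior.
near=> y; split; near: y; first exact: (open_nbhs_nbhs (conj open_dr_set Sx)).
by have /cvgr_lt := cF x Sx; apply.
Unshelve. all: by end_near. Qed.

Lemma borel_open (U : set pt) : open U -> measurable (U : set borel).
Proof. by move=> oU; exact: sub_sigma_algebra. Qed.

Lemma dr_r_dist (x y : pt) : dr_set x -> dr_set y ->
  dr_dist h dr_e x = dr_dist h dr_e y -> dr_r x = dr_r y.
Proof. by move=> Sx Sy; rewrite (dr_dist_e h Sx) (dr_dist_e h Sy). Qed.

Lemma haar_density_lt (mu : {measure set borel -> \bar R}) (T : R) :
  normalized_left_haar h mu -> (2 <= mv + mz)%N -> 0 < T ->
  (mu [set x | dr_set x /\ (A (dr_r x) < T)%R] <= T%:E)%E.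
Proof.
move=> hmu dim2 T0; set B := [set x | _].
have oB : open B.
  apply: open_dr_lt => x Sx; apply: (@cont_comp _ _ A (fun q => dr_r q)).
    exact: cont_density.
  exact: cont_dr_r.
have mB := borel_open oB.
have mS := borel_open open_dr_set.
pose f (x : borel) : \bar R := (\1_B x)%:E.
have rf : radial h f.
  move=> x y Sx Sy /(dr_r_dist Sx Sy) xy; rewrite /f !indicE.
  suff -> : (x \in B) = (y \in B) by [].
  apply/idP/idP => /set_mem[_ Ax]; apply/mem_set.
    by split; [exact: Sy|rewrite -xy].
  by split; [exact: Sx|rewrite xy].
have mf : measurable_fun (dr_set : set borel) f.
  by apply/measurable_EFinP; exact: measurable_indic.
have := haar_normalized hmu rf mf (fun x _ => ler0n _ _).
rewrite /f integral_indic// setIidl => [->|x []//].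
apply: le_trans (integral_density_lt dim2 T0).
rewrite le_eqVlt; apply/orP; left; apply/eqP; apply: eq_integral => s.
rewrite inE/= in_itv/= andbT => s0; rewrite (profileE rf (ltW s0)) -EFinM indicE.
suff -> : (axis s \in B) = (A s < T) by [].
apply/idP/idP.
  by rewrite inE /B/= (dr_r_axis (ltW s0)) => -[].
move=> AT; rewrite inE; split; first exact: axis_dr_set.
by rewrite (dr_r_axis (ltW s0)).
Qed.

End HaarBall.

(** * The maximal function *)

Section ParametricIntegrals.
Context {R : realType}.
Local Notation mu := (@lebesgue_measure R).
Implicit Types (s x y : R).

Lemma powR1D_sqrt x : 0 <= x -> (1 + x) `^ (- (3 / 2)) = (1 + x) ^- 2 * Num.sqrt (1 + x).
Proof.
move=> x0; have x1 : 0 < 1 + x by rewrite ltr_pwDl.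
rewrite powR1D//; move: (lnK x1); move: (ln (1 + x)) => L <-.
have -> : Num.sqrt (expR L) = expR (L / 2).
  have -> : expR L = expR (L / 2) ^+ 2 by rewrite -expRM_natl; congr expR; field.
  by rewrite sqrtr_sqr ger0_norm ?expR_ge0.
by rewrite -expRM_natl -expRN -expRD; congr expR; field.
Qed.

(** Stands for dominated convergence when [g s] may fail to be measurable: the difference has to be
    small relative to an integrable weight, uniformly in x. The second hypothesis keeps the
    integrals finite. *)
Lemma cont_param_integral (g : R -> R -> R) (s0 K : R) : 0 <= K ->
  (forall e : R, 0 < e -> \forall s \near s0, forall x : R, 0 < x ->
     `|g s x - g s0 x| <= e * (1 + x) `^ (- (3 / 2))) ->
  (\forall s \near s0, forall x : R, 0 < x -> `|g s x| <= K * (1 + x) ^- 2) ->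
  continuous_at s0 (fun s => \int[mu]_(x in `]0%R, +oo[) g s x).
Proof.
move=> K0 gc gK; apply/cvgrPdist_le => e e0.
(* The weight has integral at most 2, and [le_norm_RintegralB] brings another factor 2. *)
have e4 : 0 < e / 4 by rewrite divr_gt0.
near=> s.
have h1 : forall x : R, 0 < x -> `|g s x - g s0 x| <= e / 4 * (1 + x) `^ (- (3 / 2)).
  by near: s; exact: gc.
have h2 : forall x : R, 0 < x -> `|g s x| <= K * (1 + x) ^- 2 by near: s; exact: gK.
have h3 := nbhs_singleton gK.
have i2 := integral_norm_pow2_le K0 h2; have i3 := integral_norm_pow2_le K0 h3.
have b1 : 1 < 3 / 2 :> R by rewrite ltr_pdivlMr// mul1r ltr_nat.
have i1 := integral_powRZ_y b1 (ltW e4).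
have mI : measurable (`]0%R, +oo[%classic : set R) by exact: measurable_itv.
have mh : measurable_fun (`]0%R, +oo[%classic : set R) (fun x => e / 4 * (1 + x) `^ (- (3 / 2))).
  by apply: measurable_funM; [exact: measurable_cst|exact: measurable_powR1D].
have h1' x : (`]0%R, +oo[%classic : set R) x ->
    `|g s0 x - g s x| <= e / 4 * (1 + x) `^ (- (3 / 2)).
  by rewrite /= in_itv/= andbT distrC => /h1.
have hB := @le_norm_RintegralB _ _ _ mu _ (g s0) (g s) (fun x => e / 4 * (1 + x) `^ (- (3 / 2))) _ _ mI mh h1' i1 i3 i2.
apply: le_trans hB _.
by rewrite le_eqVlt; apply/orP; left; apply/eqP; field.
Unshelve. all: by end_near. Qed.

Lemma lipschitz_has_deriv (f df : R -> R) (L a b : R) : a <= b ->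
  (forall x, has_deriv f x (df x)) -> (forall x, a < x < b -> `|df x| <= L) ->
  `|f b - f a| <= L * (b - a).
Proof.
move=> ab d dL.
have dl x : has_deriv (fun y => L * y) x L.
  by apply: der1_eq (der1M (der1_cst x L) (der1_id x)) _; rewrite mulr0 addr0 mulr1.
have key (g dg : R -> R) : (forall x, has_deriv g x (dg x)) ->
    (forall x, a < x < b -> `|dg x| <= L) -> g b - g a <= L * (b - a).
  move=> dg_ dgL.
  have := @nonincreasing_is_derive _ (fun y => g y + - (L * y)) (fun y => dg y + - L) a b ab
    (fun x _ => der1D (dg_ x) (der1N (dl x))).
  move=> /(_ _ (der1_continuous (der1D (dg_ a) (der1N (dl a))))
               (der1_continuous (der1D (dg_ b) (der1N (dl b))))).
  suff h : forall x, a < x < b -> dg x + - L <= 0 by move=> /(_ h); lra.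
  by move=> x /dgL; rewrite ler_norml => /andP[_]; lra.
have k1 := key f df d dL.
have k2 := key (fun y => - f y) (fun y => - df y) (fun x => der1N (d x)).
rewrite ler_norml k1 andbT; have : - f b - - f a <= L * (b - a); last by lra.
by apply: k2 => x /dL; rewrite normrN.
Qed.

(** The point is min (1, y^k) <= sqrt y. It interpolates between a uniform bound and one that grows
    with lam. *)
Lemma le_sqrt_of_le_pow (d M y : R) k : (0 < k)%N -> 0 <= y -> 0 <= M ->
  d <= M -> d <= M * y ^+ k -> d <= M * Num.sqrt y.
Proof.
move=> k0 y0 M0 dM dy; have [y1|y1] := leP 1 y.
  apply: le_trans dM _; rewrite ler_peMr// -[leLHS]sqrtr1 ler_wsqrtr//.
apply: le_trans dy _; rewrite ler_wpM2l//.
have h : 0 <= Num.sqrt y <= 1 by rewrite sqrtr_ge0 -[leRHS]sqrtr1 ler_wsqrtr// ltW.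
apply: (@le_trans _ _ y).
  by rewrite -(prednK k0) exprS ler_piMr// exprn_ile1// ltW.
rewrite -[leLHS](sqr_sqrtr y0) expr2; case/andP: h => h1 h2.
by rewrite ler_piMl.
Qed.

End ParametricIntegrals.

Section SphericalEstimates.
Local Open Scope complex_scope.
Context {R : realType} {mv mz : nat} (h : htype R mv mz).
Local Notation Re := (@complex.Re R).
Local Notation pt := 'rV[R]_(mv + mz + 1).
Local Notation A := (@density R mv mz).
Local Notation rho := (@rho R mv mz).
Local Notation W := (@weight R mv mz).
Local Notation leb := (@lebesgue_measure R).
Implicit Types (s lam : R) (c F Pl : R -> R).

Lemma htype_dim2 : (2 <= mv + mz)%N.
Proof. by rewrite -[2%N]/(1 + 1)%N leq_add ?(mv_gt0 h) ?(mz_gt0 h). Qed.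

Lemma rho_gt0 : 0 < rho.
Proof.
rewrite /Defs.rho ltr_pwDl ?divr_ge0 ?ler0n// divr_gt0// ltr0n; exact: (mv_gt0 h).
Qed.

Let dim2 := htype_dim2.
Let rho0 := rho_gt0.

Definition sph_prof lam s : R := Re (spherical h lam%:C (axis s)).

Lemma sph_prof_ode lam : 0 < lam -> exists u u1 u2, @sph_ode R mv mz lam u u1 u2 /\
  forall s, 0 <= s -> sph_prof lam s = u s.
Proof.
move=> lam0; have [u [u1 [u2 [ou uE]]]] := spherical_ode h lam0.
exists u, u1, u2; split => // s s0.
by rewrite /sph_prof (uE _ (axis_dr_set s)) (dr_r_axis s0).
Qed.

Lemma sphericalE lam x : 0 < lam -> dr_set x ->
  spherical h lam%:C x = (sph_prof lam (dr_r x))%:C.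
Proof.
move=> lam0 Sx; have [u [u1 [u2 [_ uE]]]] := spherical_ode h lam0.
by rewrite /sph_prof !uE ?dr_r_axis ?dr_r_ge0//; exact: axis_dr_set.
Qed.

Lemma sph_prof_bound lam s : 0 < lam -> 0 < s ->
  W lam * (Num.sqrt (A s) * `|sph_prof lam s|) <= Num.sqrt (@ode_const R mv mz).
Proof.
move=> lam0 s0; have [u [u1 [u2 [[du du1 u00 u10 ode] ->]]]] := sph_prof_ode lam0; last exact: ltW.
exact: (ode_sqrt_bound dim2 lam0 du du1 u00 u10 ode s0).
Qed.

Lemma sph_prof_lipschitz lam a b : 0 < lam -> 0 < a -> a <= b ->
  `|sph_prof lam b - sph_prof lam a| <= Num.sqrt (lam ^+ 2 + rho ^+ 2) * (b - a).
Proof.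
move=> lam0 a0 ab; have [u [u1 [u2 [[du du1 u00 u10 ode] uE]]]] := sph_prof_ode lam0.
rewrite !uE ?(ltW a0)//; last exact: le_trans (ltW a0) ab.
apply: (lipschitz_has_deriv ab du) => x /andP[ax _].
have x0 : 0 <= x by exact: le_trans (ltW a0) (ltW ax).
have mu0 : 0 <= lam ^+ 2 + rho ^+ 2 by rewrite addr_ge0 ?sqr_ge0.
rewrite -sqrtr_sqr ler_sqrt//.
exact: (ode_deriv_le lam0 du du1 u00 u10 ode x0).
Qed.

Definition mu_const : R := 2 + 2 / rho ^+ 2.

Lemma mu_const_gt0 : 0 < mu_const.
Proof. by rewrite /mu_const ltr_pwDl// divr_ge0// sqr_ge0. Qed.

Lemma mu_ge lam : (1 + lam) ^+ 2 <= mu_const * (lam ^+ 2 + rho ^+ 2).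
Proof.
have r2 : 0 < rho ^+ 2 by rewrite exprn_gt0.
have e : 2 / rho ^+ 2 * rho ^+ 2 = 2 by field; rewrite gt_eqF.
have h1 : 0 <= 2 / rho ^+ 2 * lam ^+ 2 by rewrite mulr_ge0 ?sqr_ge0 ?divr_ge0// ltW.
have h2 := sqr_ge0 (1 - lam); have h3 := ltW r2.
rewrite /mu_const mulrDl (mulrDr (2 / rho ^+ 2)) e.
move: (2 / rho ^+ 2 * lam ^+ 2) h1 => y y0; move: (rho ^+ 2) h3 => z z0; nra.
Qed.

Lemma mu_gt0 lam : 0 < lam -> 0 < lam ^+ 2 + rho ^+ 2.
Proof. by move=> l0; rewrite ltr_wpDr ?sqr_ge0// exprn_gt0. Qed.

Lemma mu_inv_le lam : 0 < lam -> (lam ^+ 2 + rho ^+ 2)^-1 <= mu_const * (1 + lam) ^- 2.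
Proof.
move=> l0; rewrite ler_pdivlMr ?exprn_gt0 ?addr_gt0// mulrC ler_pdivrMr ?mu_gt0//.
exact: mu_ge.
Qed.

(** The exponent is at least the true order (mv + mz)/2 + 1, and being integral it fits
    [le_sqrt_of_le_pow]. *)
Lemma sqrt_mu_weight_le lam : 0 < lam ->
  Num.sqrt (lam ^+ 2 + rho ^+ 2) * W lam <= (1 + rho) * (1 + lam) ^+ (mv + mz).
Proof.
move=> l0; have l1 : 1 <= 1 + lam by rewrite lerDl ltW.
have l1p : 0 < 1 + lam by rewrite addr_gt0.
have r0 := rho0.
have -> : (1 + rho) * (1 + lam) ^+ (mv + mz) =
    ((1 + rho) * (1 + lam)) * ((1 + lam) * (1 + lam) ^+ (mv + mz - 2)).
  by rewrite -[in LHS](subnK dim2) addn2 !exprS; ring.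
apply: ler_pM; [exact: sqrtr_ge0|exact: ltW (weight_gt0 _ _ l0)| |].
  have n0 : 0 <= (1 + rho) * (1 + lam) by rewrite mulr_ge0// addr_ge0// ltW.
  rewrite -[leRHS](ger0_norm n0) -sqrtr_sqr ler_wsqrtr//; nra.
rewrite /weight; apply: ler_pM; [exact: ltW|exact: sqrtr_ge0|by rewrite lerDr|].
have y1 : 1 <= (1 + lam) ^+ (mv + mz - 2) by exact: exprn_ege1.
move: (_ ^+ (mv + mz - 2)) y1 => y y1.
have y0 : 0 <= y by lra.
rewrite -[leRHS](ger0_norm y0) -sqrtr_sqr ler_wsqrtr//.
by rewrite expr2 ler_peMl.
Qed.

(** The hypothesis on [c] cancels the factor 1/W in the bound for phi_lam and leaves (lam^2 +
    rho^2)^(-1). For s >= s0/2 that bound holds with the constant K1 / q, since A is monotone. *)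
Lemma cont_sph_integral c (K s0 : R) : 0 <= K -> 0 < s0 ->
  (forall lam, 0 < lam -> `|c lam| <= K * W lam / (lam ^+ 2 + rho ^+ 2)) ->
  continuous_at s0 (fun s => \int[leb]_(lam in `]0%R, +oo[) (sph_prof lam s * c lam)).
Proof.
move=> K0 s00 cK; pose K1 := Num.sqrt (@ode_const R mv mz).
have K10 : 0 <= K1 by exact: sqrtr_ge0.
have s02 : 0 < s0 / 2 by rewrite divr_gt0.
pose q := Num.sqrt (A (s0 / 2)).
have q0 : 0 < q by rewrite sqrtr_gt0; exact: density_gt0.
have phiW lam s : 0 < lam -> s0 / 2 <= s -> `|sph_prof lam s| * W lam <= K1 / q.
  move=> l0 s0s; have sp : 0 < s by exact: lt_le_trans s0s.
  rewrite ler_pdivlMr//; apply: le_trans (sph_prof_bound l0 sp).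
  rewrite [leLHS](_ : _ = W lam * `|sph_prof lam s| * q); last by ring.
  rewrite [leRHS](_ : _ = W lam * `|sph_prof lam s| * Num.sqrt (A s)); last by ring.
  apply: ler_wpM2l; first exact: mulr_ge0 (ltW (weight_gt0 _ _ l0)) (normr_ge0 _).
  rewrite /q ler_wsqrtr//; apply: (density_mono dim2 (ltW s02)) => //.
pose M := 2 * (K1 / q) + 1.
have M0 : 0 < M by rewrite ltr_wpDl// mulr_ge0// divr_ge0// ltW.
have mc0 := mu_const_gt0.
have cf (a lam : R) : 0 < lam -> 0 <= a -> a * `|c lam| <= a * W lam * (K * (mu_const * (1 + lam) ^- 2)).
  move=> l0 a0; apply: (@le_trans _ _ (a * (K * W lam / (lam ^+ 2 + rho ^+ 2)))).
    by rewrite ler_wpM2l// cK.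
  have w0 := ltW (weight_gt0 mv mz l0).
  have -> : a * (K * W lam / (lam ^+ 2 + rho ^+ 2)) = a * W lam * (K * (lam ^+ 2 + rho ^+ 2)^-1) by ring.
  apply: (ler_wpM2l (mulr_ge0 a0 w0)); apply: (ler_wpM2l K0); exact: mu_inv_le.
apply: (@cont_param_integral _ _ _ (K1 / q * (K * mu_const))).
- exact: mulr_ge0 (divr_ge0 K10 (ltW q0)) (mulr_ge0 K0 (ltW mc0)).
(* [d] is chosen such that the Lipschitz bound, times W, becomes M ((1 + lam) eta^2)^(mv + mz).
   Interpolated with the uniform bound M it gives M eta sqrt (1 + lam), and the decay (1 + lam)^(-2)
   turns this into the exponent -3/2. *)
- move=> e e0; pose eta := Num.min 1 (e / (M * (K * mu_const) + 1)).
  have X0 : 0 <= M * (K * mu_const) by rewrite !mulr_ge0// ltW.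
  have eta0 : 0 < eta by rewrite lt_min ltr01 divr_gt0// ltr_wpDl.
  pose d := M * (eta ^+ 2) ^+ (mv + mz) / (1 + rho).
  have r1 : 0 < 1 + rho by rewrite addr_gt0.
  have d0 : 0 < d by rewrite divr_gt0// mulr_gt0// !exprn_gt0.
  near=> s; move=> lam l0.
  have sd : `|s0 - s| < d by near: s; exact: (@cvgr_dist_lt _ _ _ _ _ id s0).
  have s02s : s0 / 2 <= s by apply: ltW; near: s; apply: lt_nbhsr; lra.
  have sp : 0 < s by exact: lt_le_trans s02s.
  set D := `|sph_prof lam s - sph_prof lam s0|.
  have l1p : 0 < 1 + lam by rewrite addr_gt0.
  have w0 := weight_gt0 mv mz l0.
  have lip : D <= Num.sqrt (lam ^+ 2 + rho ^+ 2) * `|s0 - s|.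
    have [ss|ss] := leP s0 s.
      by rewrite distrC (ger0_norm (_ : 0 <= s - s0)) ?subr_ge0//; exact: sph_prof_lipschitz.
    rewrite /D distrC (ger0_norm (_ : 0 <= s0 - s)) ?subr_ge0 ?(ltW ss)//.
    exact: (sph_prof_lipschitz l0 sp (ltW ss)).
  have D1 : D * W lam <= M.
    apply: (@le_trans _ _ ((`|sph_prof lam s| + `|sph_prof lam s0|) * W lam)).
      by rewrite ler_wpM2r ?(ltW w0)// ler_normB.
    have s02s0 : s0 / 2 <= s0 by lra.
    have t1 := phiW lam s l0 s02s; have t2 := phiW lam s0 l0 s02s0.
    by rewrite mulrDl /M; lra.
  have D2 : D * W lam <= M * ((1 + lam) * eta ^+ 2) ^+ (mv + mz).
    apply: (@le_trans _ _ (Num.sqrt (lam ^+ 2 + rho ^+ 2) * W lam * `|s0 - s|)).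
      by rewrite mulrAC ler_wpM2r// ltW.
    apply: (@le_trans _ _ ((1 + rho) * (1 + lam) ^+ (mv + mz) * d)).
      apply: ler_pM; [exact: mulr_ge0 (sqrtr_ge0 _) (ltW w0)|exact: normr_ge0|exact: sqrt_mu_weight_le|exact: ltW].
    rewrite exprMn /d; move: ((1 + lam) ^+ _) ((eta ^+ 2) ^+ _) => y z.
    rewrite le_eqVlt; apply/orP; left; apply/eqP; field.
    by rewrite gt_eqF.
  have y0 : 0 <= (1 + lam) * eta ^+ 2 by rewrite mulr_ge0 ?sqr_ge0// ltW.
  have D3 := le_sqrt_of_le_pow (ltnW dim2) y0 (ltW M0) D1 D2.
  rewrite (sqrtrM _ (ltW l1p)) sqrtr_sqr (ger0_norm (ltW eta0)) in D3.
  rewrite -mulrBl normrM -/D powR1D_sqrt ?(ltW l0)//.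
  have Q0 : 0 <= K * (mu_const * (1 + lam) ^- 2).
    by rewrite mulr_ge0// mulr_ge0 ?(ltW mc0)// invr_ge0 sqr_ge0.
  apply: le_trans (cf D lam l0 (normr_ge0 _)) _.
  apply: le_trans (ler_wpM2r Q0 D3) _.
  have -> : M * (Num.sqrt (1 + lam) * eta) * (K * (mu_const * (1 + lam) ^- 2)) =
    M * (K * mu_const) * eta * ((1 + lam) ^- 2 * Num.sqrt (1 + lam)) by ring.
  rewrite ler_wpM2r ?mulr_ge0 ?sqrtr_ge0 ?invr_ge0 ?sqr_ge0//.
  apply: (@le_trans _ _ (M * (K * mu_const) * (e / (M * (K * mu_const) + 1)))).
    by rewrite ler_wpM2l// /eta ge_min lexx orbT.
  rewrite mulrA ler_pdivrMr ?ltr_wpDl//; nra.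
- near=> s; move=> lam l0.
  have s02s : s0 / 2 <= s by apply: ltW; near: s; apply: lt_nbhsr; lra.
  rewrite normrM; apply: le_trans (cf _ lam l0 (normr_ge0 _)) _.
  rewrite -[leRHS]mulrA -[K * mu_const * _]mulrA.
  rewrite ler_wpM2r ?phiW//.
  by rewrite mulr_ge0// mulr_ge0 ?(ltW mc0)// invr_ge0 sqr_ge0.
Unshelve. all: by end_near. Qed.

Section WeightedCauchySchwarz.
Variables (alpha B : R) (alpha_gt : 1 / 2 < alpha) (B0 : 0 <= B).

(** Bounds the integral of (lam^2 + rho^2)^(-alpha); 1 / (2 alpha - 1) is the integral of (1 +
    lam)^(-2 alpha), finite because alpha > 1/2. *)
Definition sob_const : R := mu_const `^ alpha / (2 * alpha - 1).

Lemma sob_const_gt0 : 0 < sob_const.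
Proof. by rewrite /sob_const divr_gt0 ?powR_gt0 ?mu_const_gt0//; have := alpha_gt; lra. Qed.

Lemma mu_powR_le lam : 0 < lam ->
  (lam ^+ 2 + rho ^+ 2) `^ (- alpha) <= mu_const `^ alpha * (1 + lam) `^ (- (2 * alpha)).
Proof.
move=> l0; have l1p : 0 < 1 + lam by rewrite addr_gt0.
have a0 : 0 <= alpha by have := alpha_gt; lra.
rewrite !powRN ler_pdivlMr ?powR_gt0// mulrC ler_pdivrMr ?powR_gt0 ?mu_gt0//.
rewrite -powRM ?(ltW mu_const_gt0) ?(ltW (mu_gt0 l0))//.
rewrite powRrM powR_mulrn ?(ltW l1p)//.
apply: (ge0_ler_powR a0); last exact: mu_ge.
  by rewrite nnegrE sqr_ge0.
by rewrite nnegrE mulr_ge0 ?(ltW mu_const_gt0) ?(ltW (mu_gt0 l0)).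
Qed.

Lemma sph_integral_le c F Pl (m s : R) : 0 < m -> 0 < s ->
  (forall lam, 0 < lam -> 0 <= Pl lam <= B * W lam ^+ 2) ->
  (forall lam, 0 < lam -> `|c lam| <= F lam * Pl lam) ->
  (\int[leb]_(lam in `]0%R, +oo[)
     ((lam ^+ 2 + rho ^+ 2) `^ alpha * F lam ^+ 2 * Pl lam)%:E <= m%:E)%E ->
  `|\int[leb]_(lam in `]0%R, +oo[) (sph_prof lam s * c lam)| <=
   Num.sqrt B * Num.sqrt (@ode_const R mv mz) / Num.sqrt (A s) * Num.sqrt (sob_const * m).
Proof.
move=> m0 s0 PB cF Fm; set K1 := Num.sqrt (@ode_const R mv mz).
have J0 := sob_const_gt0.
have wA : 0 < Num.sqrt (A s) by rewrite sqrtr_gt0; exact: density_gt0.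
set k := Num.sqrt B * K1 / Num.sqrt (A s).
have k0 : 0 <= k by rewrite divr_ge0 ?mulr_ge0 ?sqrtr_ge0.
(* Cauchy-Schwarz is replaced by AM-GM with the optimal parameter th, which only needs the
   monotonicity and the subadditivity of the lower integral. *)
pose th := Num.sqrt (sob_const / m).
have th0 : 0 < th by rewrite sqrtr_gt0 divr_gt0.
have th2 : th ^+ 2 = sob_const / m by rewrite sqr_sqrtr// divr_ge0// ltW.
have sJm : Num.sqrt (sob_const * m) = th * m.
  have -> : sob_const * m = (th * m) ^+ 2 by rewrite exprMn th2; field; rewrite gt_eqF.
  by rewrite sqrtr_sqr (ger0_norm (mulr_ge0 (ltW th0) (ltW m0))).
pose p lam := (lam ^+ 2 + rho ^+ 2) `^ alpha.
pose f lam := p lam * F lam ^+ 2 * Pl lam.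
pose hh lam := (th * 2)^-1 * (mu_const `^ alpha) * (1 + lam) `^ (- (2 * alpha)).
have p0 lam : 0 < lam -> 0 < p lam by move=> l0; rewrite powR_gt0// mu_gt0.
have f0 lam : 0 < lam -> 0 <= f lam.
  move=> l0; have /andP[P0 _] := PB _ l0.
  exact: mulr_ge0 (mulr_ge0 (ltW (p0 _ l0)) (sqr_ge0 _)) P0.
have hc0 : 0 <= (th * 2)^-1 * (mu_const `^ alpha).
  by rewrite mulr_ge0 ?powR_ge0// invr_ge0 mulr_ge0// ltW.
have h0 lam : 0 <= hh lam by rewrite mulr_ge0 ?powR_ge0.
have pw lam : 0 < lam -> `|sph_prof lam s * c lam| <= k * (th / 2 * f lam + hh lam).
  move=> l0; have /andP[P0 PW] := PB _ l0; have w0 := weight_gt0 mv mz l0.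
  rewrite normrM.
  have sP : Num.sqrt (Pl lam) <= Num.sqrt B * W lam.
    rewrite -[W lam]ger0_norm ?(ltW w0)// -sqrtr_sqr -sqrtrM//; exact: ler_wsqrtr.
  have uP : `|sph_prof lam s| * Num.sqrt (Pl lam) <= k.
    apply: le_trans (ler_wpM2l (normr_ge0 _) sP) _.
    rewrite /k -[leRHS]mulrA [leLHS](_ : _ = Num.sqrt B * (W lam * `|sph_prof lam s|)); last by ring.
    rewrite ler_wpM2l ?sqrtr_ge0// ler_pdivlMr//; apply: le_trans (sph_prof_bound l0 s0).
    by rewrite -mulrA [X in _ * X]mulrC.
  have F0 : 0 <= `|F lam| by [].
  pose y := `|F lam| * Num.sqrt (Pl lam).
  have cy : `|c lam| <= y * Num.sqrt (Pl lam).
    rewrite /y -mulrA -expr2 sqr_sqrtr//; apply: le_trans (cF _ l0) _.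
    by rewrite ler_wpM2r// ler_norm.
  have y0 : 0 <= y by rewrite mulr_ge0 ?sqrtr_ge0.
  apply: (@le_trans _ _ (k * y)).
    apply: le_trans (ler_wpM2l (normr_ge0 _) cy) _.
    rewrite [leLHS](_ : _ = `|sph_prof lam s| * Num.sqrt (Pl lam) * y); last by ring.
    by rewrite ler_wpM2r.
  rewrite ler_wpM2l//.
  have fy : f lam = p lam * y ^+ 2.
    by rewrite /f /y exprMn sqr_sqrtr// real_normK ?num_real//; ring.
  have hp : (th * 2)^-1 * (p lam)^-1 <= hh lam.
    rewrite /hh -mulrA ler_wpM2l ?invr_ge0 ?mulr_ge0 ?(ltW th0)//.
    by have := mu_powR_le l0; rewrite powRN.
  apply: le_trans (lerD (lexx _) hp); rewrite fy.
  (* AM-GM as a completed square. *)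
  have P1 := p0 _ l0; rewrite -subr_ge0.
  have -> : th / 2 * (p lam * y ^+ 2) + (th * 2)^-1 * (p lam)^-1 - y =
     th * p lam / 2 * (y - (th * p lam)^-1) ^+ 2.
    by field; rewrite !gt_eqF.
  by rewrite mulr_ge0 ?sqr_ge0// divr_ge0// mulr_ge0// ltW.
apply: le_norm_Rintegral.
have [k00|k_gt0] := eqVneq k 0.
  rewrite k00 mul0r; apply: (@le_trans _ _ (\int[leb]_(lam in `]0%R, +oo[) 0%:E)%E).
    apply: le_integral_nonneg => lam; rewrite /= in_itv/= andbT => l0; rewrite lee_fin//.
    by have := pw _ l0; rewrite k00 mul0r.
  by rewrite integral0.
have kp : 0 < k by rewrite lt_def k_gt0.
have b1 : 1 < 2 * alpha by have := alpha_gt; lra.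
apply: (@le_trans _ _ (k%:E * \int[leb]_(lam in `]0%R, +oo[) (th / 2 * f lam + hh lam)%:E)%E).
  apply: le_trans (le_integralZ_nonneg _ kp _) => [|lam].
    apply: le_integral_nonneg => lam; rewrite /= in_itv/= andbT => l0; rewrite lee_fin//.
    exact: pw.
  rewrite /= in_itv/= andbT => l0; rewrite lee_fin.
  exact: addr_ge0 (mulr_ge0 (divr_ge0 (ltW th0) (ler0n _ 2)) (f0 _ l0)) (h0 _).
rewrite [leRHS]EFinM; apply: lee_wpmul2l; first by rewrite lee_fin.
have t20 : 0 < th / 2 by rewrite divr_gt0.
have mI : measurable (`]0%R, +oo[%classic : set R) by exact: measurable_itv.
have mh : measurable_fun (`]0%R, +oo[%classic : set R) (EFin \o hh).
  apply/measurable_EFinP; apply: measurable_funM; first exact: measurable_cst.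
  exact: measurable_powR1D.
have f0' lam : (`]0%R, +oo[%classic : set R) lam -> (0 <= (th / 2 * f lam)%:E)%E.
  by rewrite /= in_itv/= andbT => l0; rewrite lee_fin; exact: mulr_ge0 (ltW t20) (f0 _ l0).
have hD := @le_integralD_nonneg _ _ _ leb _ (fun lam => (th / 2 * f lam)%:E) (EFin \o hh)
  mI f0' (fun lam _ => h0 lam) (fun _ _ => isT) mh.
apply: le_trans hD _.
have i1 : (\int[leb]_(lam in `]0%R, +oo[) (th / 2 * f lam)%:E <= (th / 2 * m)%:E)%E.
  rewrite EFinM; apply: le_trans (lee_wpmul2l _ Fm); last by rewrite lee_fin ltW.
  apply: le_trans (le_integralZ_nonneg _ t20 _) => [|lam].
    by apply: le_integral_nonneg => lam; rewrite /= in_itv/= andbT => l0;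
      rewrite ?lee_fin// mulr_ge0 ?f0// ltW.
  by rewrite /= in_itv/= andbT => l0; rewrite lee_fin; exact: f0.
apply: le_trans (leeD i1 (integral_powRZ_y b1 hc0)) _.
rewrite -EFinD lee_fin sJm.
(* As th^2 = sob_const / m, the two terms are equal, each being th m / 2. *)
have -> : (th * 2)^-1 * mu_const `^ alpha / (2 * alpha - 1) = (th * 2)^-1 * (th ^+ 2 * m).
  by rewrite th2 /sob_const; move: (mu_const `^ alpha) => y; field; rewrite !gt_eqF//; lra.
rewrite le_eqVlt; apply/orP; left; apply/eqP; field.
by rewrite gt_eqF.
Qed.

End WeightedCauchySchwarz.

End SphericalEstimates.

Section Schrodinger.
Local Open Scope complex_scope.
Context {R : realType} {mv mz : nat} (h : htype R mv mz).
Local Notation C := R[i].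
Local Notation Re := (@complex.Re R).
Local Notation Im := (@complex.Im R).
Local Notation normc := (@Normc.normc R).
Local Notation pt := 'rV[R]_(mv + mz + 1).
Local Notation borel := (g_sigma_algebraType (@open pt)).
Local Notation A := (@density R mv mz).
Local Notation rho := (@rho R mv mz).
Local Notation W := (@weight R mv mz).
Local Notation Pl := (@plancherel R mv mz).
Local Notation leb := (@lebesgue_measure R).
Implicit Types (s lam t : R) (f : pt -> C).

(** [p] is the real or the imaginary part; since phi_lam is real, it can be applied to the remaining
    factors. *)
Definition schrod_coef f (p : C -> R) t lam : R :=
  p (cexp (0 +i* (t * (lam ^+ 2 + rho ^+ 2))) * sph_transform h f lam%:C) * Pl lam.

Lemma schrodingerE f t x : dr_set x -> schrodinger h f t x =
  (\int[leb]_(lam in `]0%R, +oo[) (sph_prof h lam (dr_r x) * schrod_coef f Re t lam)) +i*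
  (\int[leb]_(lam in `]0%R, +oo[) (sph_prof h lam (dr_r x) * schrod_coef f Im t lam)).
Proof.
move=> Sx; rewrite /schrodinger /cintegral; congr (_ +i* _).
  apply: eq_Rintegral => lam; rewrite inE/= in_itv/= andbT => l0.
  rewrite (sphericalE h l0 Sx) mulrC -!mulrA mulrCA Re_mul_real Re_mul_real /schrod_coef.
  by ring.
apply: eq_Rintegral => lam; rewrite inE/= in_itv/= andbT => l0.
rewrite (sphericalE h l0 Sx) mulrC -!mulrA mulrCA Im_mul_real Im_mul_real /schrod_coef.
by ring.
Qed.

Lemma plancherel_ge0 lam : 0 <= Pl lam.
Proof. by rewrite /plancherel invr_ge0 sqr_ge0. Qed.

Lemma schrod_coef_le f p t lam : (forall z, `|p z| <= normc z) ->
  `|schrod_coef f p t lam| <= normc (sph_transform h f lam%:C) * Pl lam.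
Proof.
move=> pn; rewrite /schrod_coef normrM (ger0_norm (plancherel_ge0 _)).
rewrite ler_wpM2r ?plancherel_ge0//; apply: le_trans (pn _) _.
by rewrite Normc.normcM normc_cexp /= expR0 mul1r.
Qed.

Lemma plancherel_le_weight : exists2 B : R, 0 <= B &
  forall lam, 0 < lam -> 0 <= Pl lam <= B * W lam ^+ 2.
Proof.
have [B B0 PB] := plancherel_bound h; exists B => // lam l0.
by rewrite plancherel_ge0 weight_sqr ?(ltW l0)// PB.
Qed.

(** The decay K / (W (lam^2 + rho^2)) of the transform and the bound B W^2 for [plancherel] multiply
    to K B W / (lam^2 + rho^2), as [cont_sph_integral] requires. *)
Lemma cont_schrod_part f p t s0 : schwartz2_radial h f -> (forall z, `|p z| <= normc z) ->
  0 < s0 -> continuous_at s0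
    (fun s => \int[leb]_(lam in `]0%R, +oo[) (sph_prof h lam s * schrod_coef f p t lam)).
Proof.
move=> sf pn s00; have [B B0 PB] := plancherel_le_weight.
have [K K0 FK] := sph_transform_decay (htype_dim2 h) sf.
apply: (@cont_sph_integral _ _ _ h _ (K * B)); rewrite ?mulr_ge0// => lam l0.
apply: le_trans (schrod_coef_le f t lam pn) _.
have /andP[P0 PW] := PB _ l0; have w0 := weight_gt0 mv mz l0.
apply: le_trans (ler_pM (normc_ge0 _) P0 (FK _ l0) PW) _.
rewrite le_eqVlt; apply/orP; left; apply/eqP; field.
by rewrite !gt_eqF// mu_gt0.
Qed.

Lemma schrodinger_radial f t x y : dr_set x -> dr_set y -> dr_r x = dr_r y ->
  schrodinger h f t x = schrodinger h f t y.
Proof. by move=> Sx Sy xy; rewrite (schrodingerE f t Sx) (schrodingerE f t Sy) xy. Qed.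

Lemma schrodinger_max_radial f x y : dr_set x -> dr_set y -> dr_r x = dr_r y ->
  schrodinger_max h f x = schrodinger_max h f y.
Proof.
move=> Sx Sy xy; rewrite /schrodinger_max; congr ereal_sup.
by apply/seteqP; split => _ [t t0 <-]; exists t => //; rewrite (schrodinger_radial f t Sx Sy xy).
Qed.

Lemma abs_schrodinger_max f x : (`|schrodinger_max h f x| = schrodinger_max h f x)%E.
Proof.
apply: gee0_abs; have r0 := rho_gt0 h.
have r2 : 0 < (rho ^+ 2)^-1 by rewrite invr_gt0 exprn_gt0.
apply: (@le_trans _ _ (normc (schrodinger h f ((rho ^+ 2)^-1 / 2) x))%:E).
  by rewrite lee_fin normc_ge0.
apply: ereal_sup_ubound; exists ((rho ^+ 2)^-1 / 2) => //=.
by apply/andP; split; lra.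
Qed.

Lemma schrodinger_max_gtP f x (tau : R) : (tau%:E < `|schrodinger_max h f x|)%E <->
  exists2 t, 0 < t < (rho ^+ 2)^-1 & tau < normc (schrodinger h f t x).
Proof.
rewrite abs_schrodinger_max; split.
  by move=> /ereal_sup_gt[_ [t t0 <-]]; rewrite lte_fin => ?; exists t.
move=> [t t0 tx]; apply: (@lt_le_trans _ _ (normc (schrodinger h f t x))%:E).
  by rewrite lte_fin.
by apply: ereal_sup_ubound; exists t.
Qed.

(* The maximal function is lower semicontinuous off the identity; the remaining part of the
   superlevel set is either empty or the whole set where the distance vanishes. *)
Lemma measurable_superlevel f (tau : R) : schwartz2_radial h f ->
  measurable ([set x | dr_set x /\ (tau%:E < `|schrodinger_max h f x|)%E] : set borel).
Proof.
move=> sf; set E := [set x | _].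
pose U : set pt := [set x | dr_set x /\ - dr_r x < 0].
have oU : open U.
  by apply: open_dr_lt => x Sx; apply: contN; exact: cont_dr_r.
pose O : set pt := E `&` U.
have oO : open O.
  rewrite openE => x [[Sx /schrodinger_max_gtP[t t0 tx]] [_ rx]]; rewrite /interior.
  have r0 : 0 < dr_r x by rewrite -oppr_lt0.
  pose V (p : C -> R) s := \int[leb]_(lam in `]0%R, +oo[) (sph_prof h lam s * schrod_coef f p t lam).
  have cRe : continuous_at (dr_r x) (V Re) by exact: (@cont_schrod_part f Re t _ sf (@le_Re_normc R) r0).
  have cIm : continuous_at (dr_r x) (V Im) by exact: (@cont_schrod_part f Im t _ sf (@le_Im_normc R) r0).
  pose G s := Num.sqrt (V Re s ^+ 2 + V Im s ^+ 2).
  have cG : continuous_at (dr_r x) G.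
    by apply: cont_sqrt; apply: contD; exact: contX.
  have GE y : dr_set y -> normc (schrodinger h f t y) = G (dr_r y).
    by move=> Sy; rewrite (schrodingerE f t Sy).
  have cGr : continuous_at x (fun y : pt => G (dr_r y)).
    by apply: (@cont_comp _ _ G (fun y : pt => dr_r y)); [exact: cG|exact: cont_dr_r].
  have tG : tau < G (dr_r x) by rewrite -(GE _ Sx).
  have nU : nbhs x U by apply: open_nbhs_nbhs; split.
  have nG : \forall y \near x, tau < G (dr_r y) by move/cvgr_gt: cGr; apply.
  near=> y.
  have Uy : U y by near: y.
  have Gy : tau < G (dr_r y) by near: y.
  have Sy := Uy.1; split => //; split => //.
  by apply/schrodinger_max_gtP; exists t => //; rewrite (GE _ Sy).
have mO := borel_open oO; have mU := borel_open oU.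
have mS := borel_open (@open_dr_set R mv mz).
have EU : E = O `|` (E `\` U).
  by apply/seteqP; split => x; [have [Ux|nUx] := pselect (U x); [left|right]|move=> [[]|[]]].
have [[x0 [Ex0 nUx0]]|no] := pselect (exists x, E x /\ ~ U x); last first.
  have -> : E = O; last exact: mO.
  rewrite EU; apply/seteqP; split => x; last by left.
  by move=> [//|[Ex nUx]]; exfalso; apply: no; exists x.
have r_eq0 x : dr_set x -> ~ U x -> dr_r x = 0.
  move=> Sx nUx; apply/eqP; rewrite eq_le (dr_r_ge0 Sx) andbT leNgt; apply/negP => r0.
  by apply: nUx; split; rewrite ?oppr_lt0.
have -> : E = O `|` ((@dr_set R mv mz) `\` U).
  rewrite {1}EU; apply/seteqP; split => x.
    by move=> [Ox|[Ex nUx]]; [left|right; split => //; exact: Ex.1].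
  move=> [Ox|[Sx nUx]]; [exact: or_introl Ox|right; split; last exact: nUx].
  have [Sx0 tx0] := Ex0; split; first exact: Sx.
  by rewrite (schrodinger_max_radial f Sx Sx0)// (r_eq0 _ Sx nUx) (r_eq0 _ Sx0 nUx0).
by apply: measurableU => //; exact: measurableD.
Unshelve. all: by end_near. Qed.

(** The summand 1 keeps the constant positive when B = 0. *)
Definition weak_const (B : R) : R := Num.sqrt B * Num.sqrt (@ode_const R mv mz) + 1.

Lemma weak_const_gt0 B : 0 < weak_const B.
Proof. by rewrite ltr_wpDl// mulr_ge0 ?sqrtr_ge0. Qed.

(** Where the maximal function exceeds tau, the pointwise bound forces A(d) < T; the factor 2
    collects the real and imaginary parts. [m] is a positive bound for the squared Sobolev norm,
    because the AM-GM parameter divides by it. *)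
Lemma superlevel_le (mu : {measure set borel -> \bar R}) (alpha B : R) f (tau m : R) :
  normalized_left_haar h mu -> schwartz2_radial h f -> 1 / 2 < alpha -> 0 <= B ->
  (forall lam, 0 < lam -> 0 <= Pl lam <= B * W lam ^+ 2) -> 0 < tau -> 0 < m ->
  (\int[leb]_(lam in `]0%R, +oo[) (((lam ^+ 2 + rho ^+ 2) `^ alpha *
     normc (sph_transform h f lam%:C) ^+ 2 * Pl lam)%:E) <= m%:E)%E ->
  (mu [set x | dr_set x /\ (tau%:E < `|schrodinger_max h f x|)%E] <=
   ((2 * weak_const B * Num.sqrt (@sob_const R mv mz alpha) / tau) ^+ 2 * m)%:E)%E.
Proof.
move=> hmu sf a2 B0 PB tau0 m0 Nm; set k := weak_const B.
have J0 := @sob_const_gt0 R mv mz alpha a2.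
set J := sob_const _ in J0 *.
have k0 : 0 < k by exact: weak_const_gt0.
set T := _ * m.
have T0 : 0 < T by rewrite mulr_gt0// exprn_gt0// divr_gt0// mulr_gt0 ?sqrtr_gt0// mulr_gt0.
have mE := measurable_superlevel tau sf.
apply: le_trans (haar_density_lt hmu (htype_dim2 h) T0).
apply: le_measure; rewrite ?inE//.
  apply: borel_open; apply: open_dr_lt => x Sx.
  by apply: (@cont_comp _ _ A (fun q : pt => dr_r q)); [exact: cont_density|exact: cont_dr_r].
move=> x [Sx /schrodinger_max_gtP[t t0 tx]]; split => //.
(* The pointwise bound holds at positive distance; at distance 0 the density is 0, which is below
   T. *)
have := dr_r_ge0 Sx; rewrite le_eqVlt => /predU1P[<-|r0]; first by rewrite (density0 (htype_dim2 h)).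
have A0 := density_gt0 mv mz r0.
have wA : 0 < Num.sqrt (A (dr_r x)) by rewrite sqrtr_gt0.
have bd p : (forall z, `|p z| <= normc z) ->
    `|\int[leb]_(lam in `]0%R, +oo[) (sph_prof h lam (dr_r x) * schrod_coef f p t lam)| <=
    k / Num.sqrt (A (dr_r x)) * Num.sqrt (J * m).
  move=> pn.
  apply: le_trans (sph_integral_le h a2 B0 m0 r0 PB (fun lam _ => schrod_coef_le f t lam pn) Nm) _.
  rewrite ler_wpM2r ?sqrtr_ge0// ler_wpM2r ?invr_ge0 ?(ltW wA)//.
  by rewrite /k /weak_const lerDl.
have hx : tau < 2 * (k / Num.sqrt (A (dr_r x)) * Num.sqrt (J * m)).
  apply: lt_le_trans tx _; apply: le_trans (normc_le _) _; rewrite (schrodingerE f t Sx)/=.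
  have := bd Re (@le_Re_normc R); have := bd Im (@le_Im_normc R); lra.
have h2 : Num.sqrt (A (dr_r x)) < 2 * k * Num.sqrt J / tau * Num.sqrt m.
  rewrite mulrAC ltr_pdivlMr//.
  have e : Num.sqrt (A (dr_r x)) * (2 * (k / Num.sqrt (A (dr_r x)) * (Num.sqrt J * Num.sqrt m))) =
      2 * k * Num.sqrt J * Num.sqrt m by field; rewrite gt_eqF.
  by rewrite -e (ltr_pM2l wA) -(sqrtrM m (ltW J0)).
rewrite -(sqr_sqrtr (ltW A0)) /T -[X in _ * X](sqr_sqrtr (ltW m0)) -exprMn.
by rewrite ltr_pXn2r ?nnegrE ?(ltW wA)// (le_trans _ (ltW h2))// ltW.
Qed.

End Schrodinger.

Theorem theorem1p3 (R : realType) (mv mz : nat) (h : htype R mv mz)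
    (mu : {measure set (g_sigma_algebraType (@open 'rV[R]_(mv + mz + 1)))
           -> \bar R})
    (hmu : normalized_left_haar h mu) (alpha : R) (halpha : 1 / 2 < alpha) :
  exists C : R, 0 < C /\
    forall f : 'rV[R]_(mv + mz + 1) -> R[i], schwartz2_radial h f ->
      (weakL2 mu (schrodinger_max h f) <= C%:E * sobolev_norm h alpha f)%E.
Proof.
have [B B0 PB] := plancherel_le_weight h.
pose k := @weak_const R mv mz B.
have J0 := @sob_const_gt0 R mv mz alpha halpha.
have k0 : 0 < k by exact: weak_const_gt0.
pose C := 2 * k * Num.sqrt (@sob_const R mv mz alpha).
have C0 : 0 < C by rewrite mulr_gt0 ?sqrtr_gt0// mulr_gt0.
exists C; split => // f sf.
rewrite /weakL2; apply: ge_ereal_sup => _ [tau /= tau0 <-].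
set E := [set x | _]; rewrite /sobolev_norm; set N := integral _ _ _.
have N0 : (0 <= N)%E.
  apply: integral_ge0 => lam _; rewrite lee_fin.
  exact: mulr_ge0 (mulr_ge0 (powR_ge0 _ _) (sqr_ge0 _)) (plancherel_ge0 _).
have i2 : 2^-1 != 0 :> R by rewrite invr_neq0.
(* If the Sobolev norm is infinite, the right side is infinite, as C > 0. *)
case EN : N N0 => [n2| |] // n20; last by rewrite poweRyr// gt0_muley ?lte_fin// leey.
rewrite lee_fin in n20.
(* [superlevel_le] asks for a positive bound, hence m > n2; letting m decrease to n2 covers n2 = 0
   as well. *)
have key m : n2 < m -> (mu E <= ((C / tau) ^+ 2 * m)%:E)%E.
  move=> nm; have m0 : 0 < m by exact: le_lt_trans nm.
  by apply: (superlevel_le hmu sf halpha B0 PB tau0 m0); rewrite -/N EN lee_fin ltW.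
have muE0 : (0 <= mu E)%E by exact: measure_ge0.
case EE : (mu E) muE0 key => [r| |] // r0 key; last first.
  by have := key (n2 + 1); rewrite ltrDl ltr01 leye_eq => /(_ isT).
rewrite lee_fin in r0.
have rn : r <= (C / tau) ^+ 2 * n2.
  have Ct : 0 < (C / tau) ^+ 2 by rewrite exprn_gt0// divr_gt0.
  rewrite -ler_pdivrMl//; apply/ler_addgt0Pr => e e0.
  rewrite ler_pdivrMl//; have := key (n2 + e); rewrite ltrDl => /(_ e0).
  by rewrite lee_fin.
rewrite !poweR_EFin -!EFinM lee_fin !powR12_sqrt//.
rewrite mulrC -ler_pdivlMr// mulrAC.
have Ct : 0 <= C / tau by rewrite divr_ge0// ltW.
rewrite -[C / tau]ger0_norm// -sqrtr_sqr -sqrtrM ?sqr_ge0//.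
exact: ler_wsqrtr.
Qed.
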